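(* For every positive integer $k$, the series $G_e(q)=\sum_{n\geq 0}\sigma_e\mathrm{mex}(n)q^n$ is lacunary modulo $2^k$; that is, \[\lim_{X\to\infty}\frac{\#\{0\le n\leq X:\ \sigma_e\mathrm{mex}(n)\equiv 0\pmod{2^k}\}}{X}=1.\]
   Context: A partition of a nonnegative integer $n$ is a non-increasing sequence of positive integers (parts) summing to $n$; $\mathcal{P}(n)$ denotes the set of partitions of $n$. The minimal excludant $\mathrm{mex}(\pi)$ of a partition $\pi$ is the least positive integer that is not a part of $\pi$. Define $\sigma_e\mathrm{mex}(n):=\sum_{\pi\in\mathcal{P}(n),\ 2\mid \mathrm{mex}(\pi)}\mathrm{mex}(\pi)$, the sum of the even minimal excludants over all partitions of $n$. An integral power series $\sum a(n)q^n$ is called lacunary modulo $M$ if the proportion of $n\le X$ with $a(n)\equiv 0\pmod M$ tends to $1$ as $X\to\infty$. *)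

(* Defs.v *)
From HB Require Import structures.
From mathcomp Require Import all_boot all_order all_algebra.
From mathcomp Require Import all_classical all_reals all_analysis.

Set Implicit Arguments.
Unset Strict Implicit.
Unset Printing Implicit Defensive.

Import Order.TTheory GRing.Theory Num.Theory.
Import numFieldNormedType.Exports.

Definition is_partition (n : nat) (s : seq nat) : bool :=
  [&& sorted geq s, all (fun m => 0 < m)%N s & sumn s == n].

Record intpart (n : nat) := IntPart {
  parts :> seq nat;
  _ : is_partition n parts }.

HB.instance Definition _ n := [isSub for @parts n].
HB.instance Definition _ n := [Countable of intpart n by <:].

(* Finiteness of [intpart n]: a partition of n has at most n parts, each of
   them at most n, so it embeds into the finite type of such sequences. *)
Section IntpartFinite.
Variable n : nat.

Lemma mem_le_sumn (s : seq nat) m : m \in s -> (m <= sumn s)%N.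
Proof.
elim: s => //= x s IH; rewrite inE => /orP[/eqP->|/IH h]; first exact: leq_addr.
exact: leq_trans h (leq_addl _ _).
Qed.

Lemma size_le_sumn (s : seq nat) :
  all (fun m => 0 < m)%N s -> (size s <= sumn s)%N.
Proof.
elim: s => //= x s IH /andP[x0 /IH h].
by rewrite -add1n; exact: leq_add.
Qed.

Definition intpart_code (p : intpart n) : n.-bseq 'I_n.+1 :=
  insub_bseq n (map inord (parts p)).

Definition intpart_decode (t : n.-bseq 'I_n.+1) : option (intpart n) :=
  insub (map val t).

Lemma intpart_codeK : pcancel intpart_code intpart_decode.
Proof.
move=> [s Hs]; rewrite /intpart_decode /intpart_code /=.
have [_ pos_s /eqP sum_s] := and3P Hs.
have -> : map val (insub_bseq n (map (@inord n) s)) = s.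
  rewrite /insub_bseq insubdK; last first.
    by rewrite unfold_in size_map -[X in (_ <= X)%N]sum_s; exact: size_le_sumn.
  rewrite -map_comp -[RHS]map_id; apply/eq_in_map => m ms /=.
  by rewrite inordK // ltnS -sum_s; exact: mem_le_sumn.
by rewrite insubT.
Qed.

HB.instance Definition _ :=
  fintype.isFinite.Build (intpart n) (pcan_enumP intpart_codeK).

End IntpartFinite.

Lemma mex_exists (s : seq nat) : exists m, (0 < m)%N && (m \notin s).
Proof.
exists (sumn s).+1 => /=; apply/negP => /mem_le_sumn.
by rewrite ltnn.
Qed.

Definition mex (s : seq nat) : nat := ex_minn (mex_exists s).

Definition sigma_e_mex (n : nat) : nat :=
  (\sum_(p : intpart n | 2 %| mex p) mex p)%N.

Local Open Scope ring_scope.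
Local Open Scope classical_set_scope.

(* An integral power series is given by its sequence of coefficients. *)
Definition G_e (n : nat) : int := (sigma_e_mex n)%:Z.

(* At X = 0 the quotient has the value 0, which does not affect the limit. *)
Definition lacunary_mod (R : realType) (a : nat -> int) (M : nat) : Prop :=
  (#|[pred n : 'I_X.+1 | (a n == 0 %[mod M%:Z])%Z]|%:R / X%:R : R)
    @[X --> \oo] --> (1 : R).

(* Main.v *)
(** Let q = e(z) = exp(2 pi i z), t = e(z/12) and W z = -1/(2z).

    The identities of Gauss and Jacobi give 2 G_e(n) = alpha_n - beta_n, where alpha and beta are the
    coefficients of prod (1 + q^i)^2 and prod (1 - q^i)^2. By Euler's pentagonal number theorem beta_n <> 0
    makes 24n + 2 a sum of two squares, so beta_n = 0 whenever a prime p = 3 mod 4 divides 12n + 1 exactly once.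

    The function F = t prod (1 + q^i)^2 = sum alpha_n t^(12n+1) has logarithmic derivative an Eisenstein series
    of weight 2; exchanging the order of a conditionally convergent double sum (Lipschitz's formula) yields
    F(z) F(W z) = C. Hence F is modular up to 12th roots of unity, and for a prime p > 3 and odd j the function
    U_p F^j is a combination of the F^i with i = p j mod 12: its coefficients are C^(j-i) times the integers
    which cancel the poles of U_p F^(-j). The case p = 5, j = 1 forces C^4 = 1/16, so the coefficient
    m_ji of F^i is an integer, divisible by 2^(i-j) when i >= j; and m_jj = 0 when p = 3 mod 4. Consequently every
    such U_p gains a factor 2, and 2^m divides alpha_n when m primes p = 3 mod 4 greater than 3 divide
    12n + 1 exactly once. Since the sum of 1/p over the primes p = 3 mod 4 diverges, almost every n has at least
    k + 1 such primes, and then 2^k divides G_e(n). *)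
Require Import Defs.
From HB Require Import structures.
From mathcomp Require Import all_boot all_order all_algebra.
From mathcomp Require Import all_classical all_reals all_analysis.
From mathcomp Require Import complex cyclic ring lra zify.

Set Implicit Arguments.
Unset Strict Implicit.
Unset Printing Implicit Defensive.
Import Order.TTheory GRing.Theory Num.Theory.
Import numFieldNormedType.Exports.
Local Open Scope ring_scope.

(** * Gauss, Jacobi and Euler identities; the generating function of even mexes *)

(** Holomorphy and contour integrals are avoided: functions on the half-plane are real coefficient
    sequences convergent on the unit disc, and F(z) F(W z) is constant because its increments along
    a segment are of second order. In place of a valence formula, a series supported on a nonzero
    class of exponents modulo 12 has no constant term, so a common bound for such a series and its
    image under W improves by a fixed factor, again and again. This is why j is odd: p j is then
    never 0 modulo 12. Besides C^4 the proof needs only that C is real, which gives C^2 = 1/4.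
    Integrality of the m_ji has two sources. For i >= j it is visible from C^(j-i) times an integer;
    for i < j that expression carries a denominator, and integrality comes from F^i = t^i + ...,
    which makes the expansion of the integral series U_p F^j unitriangular. *)

Lemma bin2D n m : 'C(n + m, 2) = ('C(n, 2) + 'C(m, 2) + n * m)%N.
Proof.
elim: n => [|n IH]; first by rewrite mul0n addn0.
by rewrite addSn !binS !bin1 IH mulSn; lia.
Qed.

Lemma bin2_ge m : (m <= 'C(m, 2).+1)%N.
Proof. by elim: m => // m IH; rewrite binS bin1; lia. Qed.

Lemma bin2S_ge m : (m <= 'C(m.+1, 2))%N.
Proof. by rewrite binS bin1 leq_addl. Qed.

(** * Polynomials modulo powers of X, in place of power series *)

Section Truncation.
Variable R : comNzRingType.
Implicit Types p q r : {poly R}.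

(** Congruence modulo X^N. Infinite products and series are represented by their truncations, and
    identities between them hold to a precision N that grows with the truncation. *)
Definition eqm N p q := forall i, (i < N)%N -> p`_i = q`_i.

Lemma eqm_refl N p : eqm N p p. Proof. by []. Qed.
Lemma eqm_sym N p q : eqm N p q -> eqm N q p. Proof. by move=> h i /h. Qed.
Lemma eqm_trans N p q r : eqm N p q -> eqm N q r -> eqm N p r.
Proof. by move=> h k i iN; rewrite h // k. Qed.
Lemma eqm_le M N p q : (M <= N)%N -> eqm N p q -> eqm M p q.
Proof. by move=> MN h i iM; apply: h; exact: leq_trans MN. Qed.
Lemma eqmD N p q r s : eqm N p q -> eqm N r s -> eqm N (p + r) (q + s).
Proof. by move=> h k i iN; rewrite !coefD h // k. Qed.
Lemma eqmM N p q r s : eqm N p q -> eqm N r s -> eqm N (p * r) (q * s).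
Proof.
move=> h k i iN; rewrite !coefM; apply: eq_bigr => j _.
have jN : (j < N)%N by apply: leq_ltn_trans iN; rewrite -ltnS.
by rewrite h // k // (leq_ltn_trans (leq_subr _ _) iN).
Qed.
Lemma eqmB N p q r s : eqm N p q -> eqm N r s -> eqm N (p - r) (q - s).
Proof. by move=> h k i iN; rewrite !coefB h // k. Qed.
Lemma eqm_sum N (I : Type) (s : seq I) (P : pred I) (f g : I -> {poly R}) :
  (forall i, P i -> eqm N (f i) (g i)) -> eqm N (\sum_(i <- s | P i) f i) (\sum_(i <- s | P i) g i).
Proof. by move=> h; elim/big_ind2: _ => //= *; exact: eqmD. Qed.
Lemma eqm_prod N (I : Type) (s : seq I) (P : pred I) (f g : I -> {poly R}) :
  (forall i, P i -> eqm N (f i) (g i)) -> eqm N (\prod_(i <- s | P i) f i) (\prod_(i <- s | P i) g i).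
Proof. by move=> h; elim/big_ind2: _ => //= *; exact: eqmM. Qed.
Lemma eqmX0 N e p : (N <= e)%N -> eqm N (p * 'X^e) 0.
Proof. by move=> Ne i iN; rewrite coefMXn (leq_trans iN Ne) coef0. Qed.
Lemma eqm_Xn N e p q : eqm N p q -> eqm (N + e) (p * 'X^e) (q * 'X^e).
Proof.
move=> h i iN; rewrite !coefMXn; case: ltnP => // ei; apply: h.
by rewrite -(ltn_add2r e) subnK.
Qed.
(** A series with constant term 1 is a unit: the coefficient of degree i of p * q is that of q plus
    terms in lower coefficients of q. *)
Lemma eqm_cancel N p q r : p`_0 = 1 -> eqm N (p * q) (p * r) -> eqm N q r.
Proof.
move=> p0 h i; elim/ltn_ind: i => i IH iN.
have := h i iN; rewrite !coefM !big_ord_recl /= p0 !mul1r !subn0.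
have -> : \sum_(j < i) p`_(bump 0 j) * q`_(i - bump 0 j) = \sum_(j < i) p`_(bump 0 j) * r`_(i - bump 0 j).
  apply: eq_bigr => j _; rewrite IH //; first by rewrite /bump /= add1n; have := ltn_ord j; lia.
  by rewrite (leq_ltn_trans (leq_subr _ _) iN).
by move/addIr.
Qed.

Definition EP L : {poly R} := \prod_(1 <= i < L.+1) (1 - 'X^i).
Definition AP L : {poly R} := \prod_(1 <= i < L.+1) (1 + 'X^i).

Lemma eqm_prod_stable N (f : nat -> {poly R}) L L' : (L <= L')%N ->
  (forall i, (L < i)%N -> eqm N (f i) 1) ->
  eqm N (\prod_(1 <= i < L.+1) f i) (\prod_(1 <= i < L'.+1) f i).
Proof.
move=> LL h; rewrite [X in eqm _ _ X](@big_cat_nat _ _ _ L.+1) //=.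
rewrite -[X in eqm _ X]mulr1; apply: eqmM => //; apply: eqm_sym.
have e1 : 1 = \prod_(L.+1 <= i < L'.+1) (1 : {poly R}) by rewrite big1.
rewrite [X in eqm _ _ X]e1 !big_nat; apply: eqm_prod => i /andP[iL _]; exact: h.
Qed.

Lemma EP_stable L L' : (L <= L')%N -> eqm L.+1 (EP L) (EP L').
Proof.
move=> LL; apply: eqm_prod_stable => // i iL; rewrite -[X in eqm _ _ X]subr0; apply: eqmB => //.
by rewrite -['X^i]mul1r; exact: eqmX0.
Qed.
Lemma AP_stable L L' : (L <= L')%N -> eqm L.+1 (AP L) (AP L').
Proof.
move=> LL; apply: eqm_prod_stable => // i iL; rewrite -[X in eqm _ _ X]addr0; apply: eqmD => //.
by rewrite -['X^i]mul1r; exact: eqmX0.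
Qed.
Lemma EP0 L : (EP L)`_0 = 1.
Proof. by have := @EP_stable 0 L (leq0n _) 0%N isT; rewrite /EP [\prod_(1 <= i < 1) _]big_geq // coef1 => <-. Qed.
Lemma AP0 L : (AP L)`_0 = 1.
Proof. by have := @AP_stable 0 L (leq0n _) 0%N isT; rewrite /AP [\prod_(1 <= i < 1) _]big_geq // coef1 => <-. Qed.

End Truncation.

(** * Gaussian binomial coefficients and the q-binomial theorem *)

Section GaussBinomial.
Variables (A : comNzRingType) (q : A).

(* Gaussian binomial coefficients in q. *)
Fixpoint gb N k : A :=
  match N, k with
  | _, 0%N => 1
  | 0%N, _.+1 => 0
  | N'.+1, k'.+1 => gb N' k'.+1 + q ^+ (N' - k') * gb N' k'
  end.

Arguments gb : simpl never.

Lemma gbS N k : gb N.+1 k.+1 = gb N k.+1 + q ^+ (N - k) * gb N k. Proof. by []. Qed.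
Lemma gbn0 N : gb N 0 = 1. Proof. by case: N. Qed.
Lemma gb_small N k : (N < k)%N -> gb N k = 0.
Proof.
elim: N k => [|N IH] [|k] // h.
by rewrite gbS IH ?IH ?mulr0 ?addr0 //; exact: ltnW.
Qed.

Definition qfac n : A := \prod_(1 <= i < n.+1) (1 - q ^+ i).

Lemma qfacS n : qfac n.+1 = qfac n * (1 - q ^+ n.+1).
Proof. by rewrite /qfac big_nat_recr. Qed.

(** The quotient formula for Gaussian binomials, kept free of division because [A] is only a
    commutative ring. *)
Lemma gb_qfac N k : (k <= N)%N -> gb N k * qfac k * qfac (N - k) = qfac N.
Proof.
elim: N k => [|N IH] [|k] // h; rewrite ?subn0 ?gbn0.
- by rewrite /qfac big_geq // !mulr1.
- by rewrite {1}/qfac big_geq // !mul1r.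
rewrite gbS subSS ltnS in h *.
have e2 : gb N k * qfac k * qfac (N - k) = qfac N by exact: IH.
have e1 : gb N k.+1 * qfac k.+1 * qfac (N - k) = qfac N * (1 - q ^+ (N - k)).
  have [kN|kN] := ltnP k N; last first.
    have -> : k = N by apply/eqP; rewrite eqn_leq h.
    by rewrite gb_small // subnn expr0 subrr mulr0 !mul0r.
  by rewrite -(IH k.+1 kN) (_ : (N - k)%N = (N - k.+1).+1) ?qfacS; [ring|lia].
have -> : (gb N k.+1 + q ^+ (N - k) * gb N k) * qfac k.+1 * qfac (N - k) =
  gb N k.+1 * qfac k.+1 * qfac (N - k) + q ^+ (N - k) * (gb N k * qfac k * qfac (N - k)) * (1 - q ^+ k.+1).
  by rewrite (qfacS k); ring.
rewrite e1 e2 qfacS.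
have -> : q ^+ N.+1 = q ^+ (N - k) * q ^+ k.+1 by rewrite -exprD; congr (_ ^+ _); lia.
by ring.
Qed.

(** Homogeneous in u and v, so that u can later be scaled by q^n. *)
Lemma qbinomial (u v : A) N : \prod_(0 <= i < N) (u + v * q ^+ i) =
  \sum_(0 <= k < N.+1) gb N k * q ^+ 'C(k, 2) * v ^+ k * u ^+ (N - k).
Proof.
elim: N => [|N IH]; first by rewrite big_geq // big_nat1 gbn0 !expr0 !mulr1.
rewrite big_nat_recr //= IH mulrDr !mulr_suml.
rewrite [RHS]big_nat_recl //= gbn0 !expr0 !mul1r subn0.
have -> : \sum_(0 <= i < N.+1) gb N i * q ^+ 'C(i, 2) * v ^+ i * u ^+ (N - i) * u =
  u ^+ N.+1 + \sum_(0 <= i < N.+1) gb N i.+1 * q ^+ 'C(i.+1, 2) * v ^+ i.+1 * u ^+ (N - i).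
  rewrite big_nat_recl //= gbn0 subn0 !expr0 !mul1r -exprSr; congr (_ + _).
  rewrite [RHS]big_nat_recr //= gb_small // !mul0r addr0.
  rewrite !big_nat; apply: eq_bigr => i /andP[_ iN].
  by rewrite (_ : (N - i)%N = (N - i.+1).+1) ?exprSr ?mulrA //; lia.
rewrite -addrA; congr (_ + _); rewrite -big_split /= !big_nat; apply: eq_bigr => i /andP[_ iN].
rewrite subSS gbS binS bin1.
have -> : q ^+ N = q ^+ (N - i) * q ^+ i by rewrite -exprD subnK.
by rewrite exprD exprS; ring.
Qed.

(** Centres the q-binomial product. The first n factors give up q^i each and the last n give up q^n
    each; what is left are the two halves of the triple product. *)
Lemma prod_shift (u v : A) n : \prod_(0 <= i < n + n) (q ^+ n * u + v * q ^+ i) =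
  q ^+ ('C(n, 2) + n * n) * (\prod_(1 <= i < n.+1) (v + u * q ^+ i) * \prod_(0 <= i < n) (u + v * q ^+ i)).
Proof.
rewrite (big_cat_nat (leq0n n) (leq_addr n n)) /=.
have -> : \prod_(n <= i < n + n) (q ^+ n * u + v * q ^+ i) = q ^+ (n * n) * \prod_(0 <= i < n) (u + v * q ^+ i).
  have -> : \prod_(n <= i < n + n) (q ^+ n * u + v * q ^+ i) = \prod_(0 + n <= i < n + n) (q ^+ n * u + v * q ^+ i) by [].
  have -> : q ^+ (n * n) = \prod_(0 <= i < n) q ^+ n by rewrite prodr_const_nat subn0 exprM.
  rewrite big_addn addnK -big_split /=.
  by apply: eq_bigr => i _; rewrite exprD; ring.
have -> : \prod_(0 <= i < n) (q ^+ n * u + v * q ^+ i) = q ^+ 'C(n, 2) * \prod_(1 <= i < n.+1) (v + u * q ^+ i).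
  have -> : q ^+ 'C(n, 2) = \prod_(0 <= i < n) q ^+ i.
    elim: (n) => [|k IH]; first by rewrite big_geq.
    by rewrite big_nat_recr //= -IH binS bin1 exprD.
  rewrite [\prod_(1 <= i < n.+1) _]big_nat_rev /= big_add1 /= -big_split /= !big_nat; apply: eq_bigr => i /andP[_ iN].
  have -> : (1 + n.+1 - i.+2)%N = (n - i)%N by lia.
  by rewrite mulrDr mulrCA -exprD subnKC ?(ltnW iN) //; ring.
by rewrite exprD; ring.
Qed.

End GaussBinomial.

Section FiniteTripleProduct.
Variables (A : idomainType) (q : A).
Hypothesis q0 : q != 0.

(* Cauchy's finite form of the Jacobi triple product. *)
Lemma finite_jtp (u v : A) n :
  \prod_(1 <= i < n.+1) (v + u * q ^+ i) * \prod_(0 <= i < n) (u + v * q ^+ i) =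
  \sum_(0 <= m < n.+1) gb q (n + n) (n + m) * q ^+ 'C(m, 2) * v ^+ (n + m) * u ^+ (n - m) +
  \sum_(1 <= m < n.+1) gb q (n + n) (n - m) * q ^+ 'C(m.+1, 2) * v ^+ (n - m) * u ^+ (n + m).
Proof.
have qe : q ^+ ('C(n, 2) + n * n) != 0 by rewrite expf_neq0.
apply: (mulfI qe); rewrite -prod_shift qbinomial (@big_cat_nat _ _ _ n) ?leqW ?leq_addr //= addrC mulrDr.
congr (_ + _).
  have -> : \sum_(n <= k < (n + n).+1) gb q (n + n) k * q ^+ 'C(k, 2) * v ^+ k * (q ^+ n * u) ^+ (n + n - k) =
    \sum_(0 + n <= k < (n + n).+1) gb q (n + n) k * q ^+ 'C(k, 2) * v ^+ k * (q ^+ n * u) ^+ (n + n - k) by [].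
  rewrite big_addn (_ : (n + n).+1 - n = n.+1)%N; last lia.
  rewrite mulr_sumr !big_nat; apply: eq_bigr => m /andP[_ mn].
  have -> : (n + n - (m + n))%N = (n - m)%N by lia.
  rewrite addnC exprMn -exprM.
  have -> : q ^+ 'C(n + m, 2) = q ^+ 'C(n, 2) * q ^+ 'C(m, 2) * q ^+ (n * m) by rewrite bin2D !exprD.
  have -> : q ^+ ('C(n, 2) + n * n) = q ^+ 'C(n, 2) * (q ^+ (n * m) * q ^+ (n * (n - m))).
    by rewrite -!exprD -mulnDr subnKC.
  by ring.
rewrite mulr_sumr big_add1 /= big_nat_rev /= add0n !big_nat; apply: eq_bigr => m /andP[_ mn].
have -> : (n + n - (n - m.+1))%N = (n + m.+1)%N by lia.
rewrite exprMn -exprM.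
have -> : q ^+ ('C(n, 2) + n * n) * (gb q (n + n) (n - m.+1) * q ^+ 'C(m.+2, 2) * v ^+ (n - m.+1) * u ^+ (n + m.+1)) =
   (q ^+ ('C(n, 2) + n * n) * q ^+ 'C(m.+2, 2)) * (gb q (n + n) (n - m.+1) * v ^+ (n - m.+1) * u ^+ (n + m.+1)) by ring.
have -> : q ^+ ('C(n, 2) + n * n) * q ^+ 'C(m.+2, 2) = q ^+ 'C(n - m.+1, 2) * q ^+ (n * (n + m.+1)).
  rewrite -!exprD; congr (_ ^+ _).
  have h := bin2D (n - m.+1) m.+1; rewrite subnK // in h.
  rewrite h (binS m.+1) bin1.
  have h2 : (2 * 'C(m.+1, 2) = m.+1 * m)%N by rewrite -mul_bin_diag bin1.
  nia.
by ring.
Qed.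

End FiniteTripleProduct.

(** * Gauss's and Jacobi's identities as limits of the finite triple product *)

Section ClassicalIdentities.
Local Notation P := {poly int}.

Lemma qfac_stable (d N a b : nat) : (a <= b)%N -> (N <= d * a.+1)%N ->
  eqm N (qfac ('X^d : P) a) (qfac 'X^d b).
Proof.
move=> ab Na; apply: eqm_prod_stable => // i ai; rewrite -[X in eqm _ _ X]subr0; apply: eqmB => //.
by rewrite -exprM -['X^_]mul1r; apply: eqmX0; apply: leq_trans Na _; rewrite leq_mul2l ai orbT.
Qed.

Lemma qfac0 d n : (0 < d)%N -> (qfac ('X^d : P) n)`_0 = 1.
Proof.
move=> d0; have h := @qfac_stable d 1 0 n (leq0n n) ltac:(lia) 0%N isT.
by rewrite -h /qfac big_geq // coef1.
Qed.

(** X-adically the binomial tends to the inverse of the infinite product. The error starts at degree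
    d (r + 1), where r bounds the distance of k from the ends 0 and 2 n. *)
Lemma gb_lim (d n k r : nat) : (0 < d)%N -> (k <= n + n)%N -> (r <= k)%N -> (r <= n + n - k)%N -> (r <= n)%N ->
  eqm (d * r.+1) (qfac ('X^d : P) n * gb 'X^d (n + n) k) 1.
Proof.
move=> d0 kn rk rk' rn; apply: (@eqm_cancel _ _ (qfac 'X^d r)); first exact: qfac0.
have st b : (r <= b)%N -> eqm (d * r.+1) (qfac ('X^d : P) r) (qfac 'X^d b).
  by move=> rb; exact: qfac_stable.
rewrite mulr1; apply: (@eqm_trans _ _ _ (gb 'X^d (n + n) k * qfac 'X^d k * qfac 'X^d (n + n - k))).
  rewrite mulrA mulrC -mulrA; apply: eqmM => //; apply: eqmM; first exact: st.
  by apply: eqm_trans (eqm_sym (st n rn)) (st _ rk').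
by rewrite gb_qfac //; apply: eqm_sym; apply: st; lia.
Qed.

Lemma EP_qfac n : EP int n = qfac ('X^1) n.
Proof. by apply: eq_bigr => i _; rewrite expr1. Qed.

Lemma gb_term1 n m : (m <= n)%N ->
  eqm n (EP int n * (gb 'X (n + n) (n + m) * 'X^'C(m, 2))) 'X^'C(m, 2) /\
  eqm n (EP int n * (gb 'X (n + n) (n - m) * 'X^'C(m.+1, 2))) 'X^'C(m.+1, 2).
Proof.
move=> mn; rewrite EP_qfac !mulrA; split.
  rewrite -[X in eqm _ _ X]mul1r.
  apply: (@eqm_le _ _ (1 * (n - m).+1 + 'C(m, 2))); first by have := bin2_ge m; lia.
  by apply: eqm_Xn; apply: gb_lim; lia.
rewrite -[X in eqm _ _ X]mul1r.
apply: (@eqm_le _ _ (1 * (n - m).+1 + 'C(m.+1, 2))); first by have := bin2S_ge m; lia.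
by apply: eqm_Xn; apply: gb_lim; lia.
Qed.

(** The triple product at u = v = 1. Its factor of index 0 equals 2, and on the right each
    triangular number occurs twice, so both sides are halved at the end. *)
Lemma gauss_identity n :
  eqm n (EP int n * AP int n ^+ 2) (\sum_(0 <= j < n) 'X^'C(j.+1, 2)).
Proof.
case: n => [//|n].
have X0 : ('X : P) != 0 by rewrite polyX_eq0.
have := finite_jtp X0 1 1 n.+1.
under eq_bigr do rewrite mul1r.
under [X in _ * X = _]eq_bigr do rewrite mul1r.
rewrite -/(AP int n.+1) [\prod_(0 <= i < n.+1) _]big_ltn // expr0 -/(AP int n).
move=> h.
have h2 : eqm n.+1 (EP int n.+1 * (AP int n.+1 * ((1 + 1) * AP int n)))
   (\sum_(0 <= m < n.+2) 'X^'C(m, 2) + \sum_(1 <= m < n.+2) 'X^'C(m.+1, 2)).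
  rewrite h mulrDr !mulr_sumr; apply: eqmD; rewrite !big_nat; apply: eqm_sum => m /andP[_ mn]; rewrite !expr1n !mulr1.
    exact: (gb_term1 (mn : (m <= n.+1)%N)).1.
  exact: (gb_term1 (mn : (m <= n.+1)%N)).2.
have h3 : eqm n.+1 (\sum_(0 <= m < n.+2) 'X^'C(m, 2) + \sum_(1 <= m < n.+2) 'X^'C(m.+1, 2) : P)
    ((1 + 1) * \sum_(0 <= j < n.+1) 'X^'C(j.+1, 2)).
  rewrite big_nat_recl // /= bin0n [\sum_(1 <= m < n.+2) _]big_add1 /= addrAC.
  have -> : 'X^0 + \sum_(0 <= i < n.+1) 'X^'C(i.+2, 2) = \sum_(0 <= i < n.+2) ('X^'C(i.+1, 2) : P).
    by rewrite [RHS]big_nat_recl.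
  rewrite [X in eqm _ (X + _) _]big_nat_recr //= mulrDl mul1r.
  apply: eqmD => //; rewrite -[X in eqm _ _ X]addr0; apply: eqmD => //.
  by rewrite -['X^_]mul1r; apply: eqmX0; exact: bin2S_ge.
have h4 : eqm n.+1 ((1 + 1) * (EP int n.+1 * AP int n.+1 ^+ 2)) (EP int n.+1 * (AP int n.+1 * ((1 + 1) * AP int n))).
  rewrite mulrC -mulrA; apply: eqmM => //; rewrite expr2 -mulrA; apply: eqmM => //.
  by rewrite mulrC; apply: eqmM => //; apply: eqm_sym; exact: AP_stable.
move=> i iN; have h5 := eqm_trans h4 (eqm_trans h2 h3); have := h5 i iN.
have c2 (p : P) : ((1 + 1) * p)`_i = p`_i + p`_i by rewrite mulrDl mul1r coefD.
by rewrite !c2; move: (_`_i) (_`_i) => a b; lia.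
Qed.

Lemma gb_map (A B : comNzRingType) (f : {rmorphism A -> B}) (q : A) N k : f (gb q N k) = gb (f q) N k.
Proof.
elim: N k => [|N IH] [|k]; rewrite ?gbn0 ?rmorph1 ?rmorph0 //.
by rewrite !gbS rmorphD rmorphM rmorphXn !IH.
Qed.

(* The finite triple product vanishes at v = -1; compare derivatives there. *)
Lemma jacobi_identity n :
  eqm n (EP int n ^+ 3) (\sum_(0 <= j < n) ((-1) ^+ j * (2 * j).+1%:R) *: 'X^'C(j.+1, 2)).
Proof.
case: n => [//|n].
(* Two variables: the inner one is q, the outer one is -v, so evaluation at 1 means v = -1. *)
pose q : {poly P} := ('X)%:P.
have q0 : q != 0 by rewrite polyC_eq0 polyX_eq0.
have jtp := finite_jtp q0 1 (- 'X) n.+1.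
(* W is the triple product without its vanishing factor 1 - X; the derivative of (1 - X) W at 1 is
   -W(1). *)
pose W : {poly P} := \prod_(1 <= i < n.+2) (- 'X + 1 * q ^+ i) * \prod_(1 <= i < n.+1) (1 + - 'X * q ^+ i).
have lhs : \prod_(1 <= i < n.+2) (- 'X + 1 * q ^+ i) * \prod_(0 <= i < n.+1) (1 + - 'X * q ^+ i) = (1 - 'X) * W.
  by rewrite [\prod_(0 <= i < n.+1) _]big_ltn // expr0 mulr1 /W; ring.
have W1 : W.[1] = (-1) ^+ n.+1 * (EP int n.+1 * EP int n).
  rewrite /W hornerM !horner_prod mulrA; congr (_ * _).
    have -> : (-1) ^+ n.+1 = \prod_(1 <= i < n.+2) (-1 : P) by rewrite prodr_const_nat subn1.
    rewrite /EP -big_split /=; apply: eq_bigr => i _.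
    by rewrite /q -rmorphXn /= !hornerE /=; ring.
  by apply: eq_bigr => i _; rewrite /q -rmorphXn /= !hornerE /=; ring.
pose a m : P := gb 'X (n.+1 + n.+1) (n.+1 + m) * 'X^'C(m, 2).
pose b m : P := gb 'X (n.+1 + n.+1) (n.+1 - m) * 'X^'C(m.+1, 2).
pose S : {poly P} := \sum_(0 <= m < n.+2) (a m * (-1) ^+ (n.+1 + m))%:P * 'X^(n.+1 + m) +
  \sum_(1 <= m < n.+2) (b m * (-1) ^+ (n.+1 - m))%:P * 'X^(n.+1 - m).
have gm N k : gb q N k = (gb 'X N k)%:P by rewrite /q -(gb_map (@polyC P)).
have rhs : (1 - 'X) * W = S.
  rewrite -lhs jtp /S; congr (_ + _); apply: eq_bigr => m _; rewrite expr1n mulr1 -/q /a /b.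
    by rewrite gm !polyCM !(rmorphXn (@polyC _)) /= -/q polyCN polyC1 exprNn; ring.
  by rewrite gm !polyCM !(rmorphXn (@polyC _)) /= -/q polyCN polyC1 exprNn; ring.
have gen (V : {poly P}) : ((1 - 'X) * V).[1] = 0 /\ ((1 - 'X) * V)^`().[1] = - V.[1].
  split; first by rewrite hornerM hornerD hornerN hornerX hornerC subrr mul0r.
  by rewrite derivM derivB derivC derivX sub0r !(hornerD, hornerM, hornerN, hornerX, hornerC) subrr mul0r addr0 mulN1r.
have v0 : \sum_(0 <= m < n.+2) a m * (-1) ^+ (n.+1 + m) + \sum_(1 <= m < n.+2) b m * (-1) ^+ (n.+1 - m) = 0.
  have S1 : S.[1] = 0 by rewrite -rhs (gen W).1.
  rewrite -[RHS]S1 /S hornerD !horner_sum.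
  by congr (_ + _); apply: eq_bigr => m _; rewrite hornerM hornerC hornerXn expr1n mulr1.
have v1 : \sum_(0 <= m < n.+2) a m * (-1) ^+ (n.+1 + m) *+ (n.+1 + m) + \sum_(1 <= m < n.+2) b m * (-1) ^+ (n.+1 - m) *+ (n.+1 - m) =
   - ((-1) ^+ n.+1 * (EP int n.+1 * EP int n)).
  have S1 : S^`().[1] = - ((-1) ^+ n.+1 * (EP int n.+1 * EP int n)) by rewrite -rhs (gen W).2 W1.
  rewrite -[RHS]S1 /S derivD !raddf_sum /= hornerD !horner_sum; congr (_ + _); apply: eq_bigr => m _.
    by rewrite derivM derivC mul0r add0r derivXn hornerM hornerC hornerMn hornerXn expr1n mulr_natr.
  by rewrite derivM derivC mul0r add0r derivXn hornerM hornerC hornerMn hornerXn expr1n mulr_natr.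
(* Subtracting n + 1 times [v0] from [v1] removes the part of the exponents n + 1 + m and n + 1 - m
   that does not depend on m. *)
have v2 : \sum_(0 <= m < n.+2) (-1) ^+ m * m%:R * a m - \sum_(1 <= m < n.+2) (-1) ^+ m * m%:R * b m = - (EP int n.+1 * EP int n).
  have s1 : (-1) ^+ n.+1 * (-1) ^+ n.+1 = 1 :> P by rewrite -exprMn mulrNN mulr1 expr1n.
  have e1 : (-1) ^+ n.+1 * \sum_(0 <= m < n.+2) (-1) ^+ m * m%:R * a m = \sum_(0 <= m < n.+2) (a m * (-1) ^+ (n.+1 + m) *+ (n.+1 + m) - n.+1%:R * (a m * (-1) ^+ (n.+1 + m))).
    rewrite mulr_sumr; apply: eq_bigr => m _; rewrite -[_ *+ (n.+1 + m)]mulr_natl natrD exprD; ring.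
  have e2 : (-1) ^+ n.+1 * \sum_(1 <= m < n.+2) (-1) ^+ m * m%:R * b m = - \sum_(1 <= m < n.+2) (b m * (-1) ^+ (n.+1 - m) *+ (n.+1 - m) - n.+1%:R * (b m * (-1) ^+ (n.+1 - m))).
    rewrite mulr_sumr -sumrN !big_nat; apply: eq_bigr => m /andP[_ mn].
    have -> : (-1) ^+ n.+1 = (-1) ^+ (n.+1 - m) * (-1) ^+ m :> P by rewrite -exprD subnK.
    have s2 : (-1) ^+ m * (-1) ^+ m = 1 :> P by rewrite -exprMn mulrNN mulr1 expr1n.
    rewrite -[_ *+ (n.+1 - m)]mulr_natl natrB //.
    transitivity ((-1) ^+ (n.+1 - m) * ((-1) ^+ m * (-1) ^+ m) * m%:R * b m); first by ring.
    by rewrite s2; ring.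
  have : (-1) ^+ n.+1 * (\sum_(0 <= m < n.+2) (-1) ^+ m * m%:R * a m - \sum_(1 <= m < n.+2) (-1) ^+ m * m%:R * b m) = - ((-1) ^+ n.+1 * (EP int n.+1 * EP int n)).
    by rewrite mulrBr e1 e2 opprK -v1 !sumrB -!mulr_sumr addrACA -opprD -mulrDr v0 mulr0 subr0.
  by move/(congr1 (fun x => (-1) ^+ n.+1 * x)); rewrite mulrN !mulrA s1 !mul1r.
have h2 : eqm n.+1 (- (EP int n.+1 ^+ 2 * EP int n))
   (\sum_(0 <= m < n.+2) (-1) ^+ m * m%:R * 'X^'C(m, 2) - \sum_(1 <= m < n.+2) (-1) ^+ m * m%:R * 'X^'C(m.+1, 2)).
  have -> : - (EP int n.+1 ^+ 2 * EP int n) = EP int n.+1 * - (EP int n.+1 * EP int n) by ring.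
  rewrite -v2 mulrBr !mulr_sumr; apply: eqmB; rewrite !big_nat; apply: eqm_sum => m /andP[_ mn].
    by rewrite mulrCA; apply: eqmM => //; exact: (gb_term1 (mn : (m <= n.+1)%N)).1.
  by rewrite mulrCA; apply: eqmM => //; exact: (gb_term1 (mn : (m <= n.+1)%N)).2.
have h3 : eqm n.+1 (- (\sum_(0 <= m < n.+2) (-1) ^+ m * m%:R * 'X^'C(m, 2) - \sum_(1 <= m < n.+2) (-1) ^+ m * m%:R * 'X^'C(m.+1, 2) : P))
    (\sum_(0 <= j < n.+1) ((-1) ^+ j * (2 * j).+1%:R) *: 'X^'C(j.+1, 2)).
  have -> : \sum_(1 <= m < n.+2) (-1) ^+ m * m%:R * 'X^'C(m.+1, 2) = \sum_(0 <= m < n.+2) (-1) ^+ m * m%:R * ('X^'C(m.+1, 2) : P).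
    by rewrite [RHS]big_ltn // mulr0 mul0r add0r.
  rewrite big_nat_recl // mulr0 mul0r add0r [X in - (_ - X)]big_nat_recr //= opprB addrAC -sumrB.
  rewrite -[X in eqm _ _ X]addr0; apply: eqmD; last by apply: eqmX0; exact: bin2S_ge.
  rewrite (eq_bigr (fun j : nat => ((-1) ^+ j * (2 * j).+1%:R) *: 'X^'C(j.+1, 2))) // => j _.
  rewrite -mul_polyC rmorphM rmorphXn rmorphN1 rmorph_nat exprS.
  have -> : (2 * j).+1%:R = j.+1%:R + j%:R :> P by rewrite -natrD; congr (_%:R); lia.
  by ring.
apply: eqm_trans h3; move=> i iN; rewrite coefN -h2 // coefN opprK.
suff : eqm n.+1 (EP int n.+1 ^+ 3) (EP int n.+1 ^+ 2 * EP int n) by apply.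
rewrite exprSr; apply: eqmM => //; apply: eqm_sym; exact: EP_stable.
Qed.

End ClassicalIdentities.

(** * Euler's pentagonal number theorem and sums of two squares *)

Section Pentagonal.
Local Notation P := {poly int}.

Lemma EP3 n : EP int (3 * n) = qfac 'X^3 n *
  (\prod_(1 <= i < n.+1) (1 - 'X^((3 * i).-1)) * \prod_(0 <= i < n) (1 - 'X^((3 * i).+1))).
Proof.
have E3 k : EP int k.+1 = EP int k * (1 - 'X^(k.+1)) by rewrite /EP big_nat_recr.
elim: n => [|n IH]; first by rewrite /EP /qfac !big_geq // !mulr1.
have e : (3 * n.+1 = (3 * n).+3)%N by lia.
have -> : \prod_(1 <= i < n.+2) (1 - 'X^((3 * i).-1)) = \prod_(1 <= i < n.+1) (1 - 'X^((3 * i).-1)) * (1 - 'X^((3 * n).+2)) :> P.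
  by rewrite big_nat_recr // e.
have -> : \prod_(0 <= i < n.+1) (1 - 'X^((3 * i).+1)) = \prod_(0 <= i < n) (1 - 'X^((3 * i).+1)) * (1 - 'X^((3 * n).+1)) :> P.
  by rewrite big_nat_recr.
by rewrite qfacS -exprM e 3!E3 IH; ring.
Qed.

(** The triple product with X^3 for q, u = 1 and v = -X yields the factors of exponent 1 and 2
    modulo 3; the multiples of 3 are the factor that cancels the Gaussian binomials in the limit. *)
Lemma pentagonal n : eqm (3 * n) (EP int (3 * n))
  (\sum_(0 <= m < n.+1) (-1) ^+ m * 'X^(3 * 'C(m, 2) + m) +
   \sum_(1 <= m < n.+1) (-1) ^+ m * 'X^(3 * 'C(m.+1, 2) - m)).
Proof.
have X0 : ('X^3 : P) != 0 by rewrite expf_neq0 // polyX_eq0.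
have jtp := finite_jtp X0 1 (- 'X) n.
have XN : (- 'X : P) ^+ n != 0 by rewrite expf_neq0 // oppr_eq0 polyX_eq0.
have e : \prod_(1 <= i < n.+1) (1 - 'X^((3 * i).-1)) * \prod_(0 <= i < n) (1 - 'X^((3 * i).+1)) =
  \sum_(0 <= m < n.+1) gb 'X^3 (n + n) (n + m) * ((-1) ^+ m * 'X^(3 * 'C(m, 2) + m)) +
  \sum_(1 <= m < n.+1) gb 'X^3 (n + n) (n - m) * ((-1) ^+ m * 'X^(3 * 'C(m.+1, 2) - m)) :> P.
  (* Each factor v + u q^i equals -X (1 - X^(3 i - 1)), hence the multiplication by (-X)^n. *)
  apply: (mulfI XN); transitivity (\prod_(1 <= i < n.+1) (- 'X + 1 * ('X^3 : P) ^+ i) * \prod_(0 <= i < n) (1 + - 'X * 'X^3 ^+ i)).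
    rewrite mulrA; congr (_ * _).
      have -> : (- 'X : P) ^+ n = \prod_(1 <= i < n.+1) (- 'X) by rewrite prodr_const_nat subn1.
      rewrite -big_split /= !big_nat; apply: eq_bigr => i /andP[i0 _].
      have -> : ('X^3 : P) ^+ i = 'X * 'X^((3 * i).-1) by rewrite -exprM -exprS prednK //; lia.
      by ring.
    by apply: eq_bigr => i _; rewrite -exprM exprS; ring.
  rewrite jtp mulrDr !mulr_sumr !big_nat; congr (_ + _); apply: eq_bigr => m /andP[m0 mn].
    by rewrite expr1n exprD -exprM [(- 'X) ^+ m]exprNn exprD; ring.
  rewrite expr1n -exprM.
  have -> : (- 'X : P) ^+ n = (- 'X) ^+ (n - m) * ((-1) ^+ m * 'X^m).
    by rewrite -exprNn -exprD subnK.
  have -> : ('X : P) ^+ (3 * 'C(m.+1, 2)) = 'X^m * 'X^(3 * 'C(m.+1, 2) - m).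
    by rewrite -exprD subnKC //; have := bin2S_ge m; lia.
  have s2 : (-1) ^+ m * (-1) ^+ m = 1 :> P by rewrite -exprMn mulrNN mulr1 expr1n.
  transitivity (gb 'X^3 (n + n) (n - m) * ('X^m * 'X^(3 * 'C(m.+1, 2) - m)) * (- 'X : P) ^+ (n - m) * ((-1) ^+ m * (-1) ^+ m)).
    by rewrite s2; ring.
  by ring.
rewrite EP3 e mulrDr !mulr_sumr; apply: eqmD; rewrite !big_nat; apply: eqm_sum => m /andP[m0 mn].
  rewrite mulrA -[X in eqm _ _ X]mul1r !mulrA.
  apply: (@eqm_le _ _ (3 * (n - m).+1 + (3 * 'C(m, 2) + m))); first by have := bin2_ge m; lia.
  by apply: eqm_Xn; apply: eqmM => //; apply: gb_lim; lia.
rewrite mulrA -[X in eqm _ _ X]mul1r !mulrA.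
apply: (@eqm_le _ _ (3 * (n - m).+1 + (3 * 'C(m.+1, 2) - m))).
  by have := bin2_ge m; have : 'C(m.+1, 2) = ('C(m, 2) + m)%N := ltac:(by rewrite binS bin1); lia.
by apply: eqm_Xn; apply: eqmM => //; apply: gb_lim; lia.
Qed.

Lemma pent_support L i : (i <= L)%N -> (EP int L)`_i != 0 -> exists x, (x ^ 2 = 24 * i + 1)%N.
Proof.
move=> iL; rewrite (@EP_stable _ L (3 * L.+1)) ?ltnS //; last by lia.
rewrite (@pentagonal L.+1) ?coefD; last lia.
have [h|h] := boolP [exists m : 'I_L.+2, (i == 3 * 'C(m, 2) + m)%N || (i == 3 * 'C(m.+1, 2) - m)%N].
  move=> _; case/existsP: h => m /orP[]/eqP ->.
    case: (nat_of_ord m) => [|k]; first by exists 1%N.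
    (* For m = k + 1 the exponent is m (3 m - 1)/2 and 24 times it plus 1 is (6 m - 1)^2; the other
       family m (3 m + 1)/2 gives (6 m + 1)^2. *)
    exists (6 * k + 5)%N; have := mul_bin_diag k.+1 1; rewrite bin1 => hh.
    by rewrite expnS expn1; nia.
  exists (6 * m + 1)%N; have := mul_bin_diag m.+1 1; rewrite bin1 => hh.
  by rewrite expnS expn1; nia.
rewrite negb_exists in h; move/forallP in h.
have sg (m : nat) (p : P) : ((-1) ^+ m * p)`_i = (-1) ^+ m * p`_i.
  have -> : (-1) ^+ m = ((-1) ^+ m)%:P :> P by rewrite rmorphXn rmorphN1.
  by rewrite coefCM.
rewrite !coef_sum !big_nat !big1 ?addr0 ?eqxx // => m /andP[_ mn]; rewrite sg coefXn;
  have := h (Ordinal mn); rewrite negb_or /= => /andP[/negbTE h1 /negbTE h2]; by rewrite ?h1 ?h2 mulr0.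
Qed.

Lemma dvdn_odd_pow a b k : (a + b %| a ^ k.*2.+1 + b ^ k.*2.+1)%N.
Proof.
elim: k => [|k IH]; first by rewrite !expn1.
have e : (a ^ k.+1.*2.+1 + b ^ k.+1.*2.+1 + a * b * (a ^ k.*2.+1 + b ^ k.*2.+1) = (a + b) * (a ^ k.*2.+2 + b ^ k.*2.+2))%N.
  by rewrite doubleS !expnS; ring.
have := dvdn_mulr (a ^ k.*2.+2 + b ^ k.*2.+2) (dvdnn (a + b)); rewrite -e dvdn_addl //.
exact: dvdn_mull.
Qed.

(** As (p - 1)/2 is odd, x^2 + y^2 divides x^(p-1) + y^(p-1). If p divided neither number, the
    latter would be 2 modulo p by Fermat's theorem. *)
Lemma dvdn_sum_sqr p x y : prime p -> (p %% 4 = 3)%N -> (p %| x ^ 2 + y ^ 2 -> p %| x)%N.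
Proof.
move=> pp p3 pxy; apply/negPn/negP => px.
have cx : coprime x p by rewrite coprime_sym prime_coprime.
have py : ~~ (p %| y)%N.
  apply: contra px => py; have : (p %| x ^ 2)%N by rewrite -(@dvdn_addl (y ^ 2)) // dvdn_exp.
  by rewrite Euclid_dvdX // => /andP[].
have cy : coprime y p by rewrite coprime_sym prime_coprime.
have e : totient p = (2 * (p %/ 4).*2.+1)%N.
  by have := divn_eq p 4; rewrite p3 totient_prime //; move: (p %/ 4)%N => k hk; clear -hk; lia.
have := dvdn_trans pxy (dvdn_odd_pow (x ^ 2) (y ^ 2) (p %/ 4)).
rewrite -!expnM -e /dvdn -modnDm (Euler_exp_totient cx) (Euler_exp_totient cy) modnDm => /dvdn_leq -/(_ isT) p2.
by have := prime_gt1 pp; case: p p3 p2 {pp pxy px py cx cy e} => [|[|[|p]]].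
Qed.

(** A nonzero term of the convolution gives x^2 + y^2 = 2 (12 n + 1) with p dividing x and y, so
    that p^2 would divide 12 n + 1. *)
Lemma EP2_vanish p n L : prime p -> (p %% 4 = 3)%N -> (p %| 12 * n + 1)%N -> ~~ (p ^ 2 %| 12 * n + 1)%N ->
  (n <= L)%N -> ((EP int L) ^+ 2)`_n = 0.
Proof.
move=> pp p3 pn ppn nL; rewrite expr2 coefM big1 // => j _.
apply/eqP/negPn/negP; rewrite mulf_eq0 negb_or => /andP[h1 h2].
have jn : (j <= n)%N by rewrite -ltnS.
have [x hx] := pent_support (leq_trans jn nL) h1.
have [y hy] := pent_support (leq_trans (leq_subr j n) nL) h2.
have exy : (x ^ 2 + y ^ 2 = 2 * (12 * n + 1))%N by rewrite hx hy; clear -jn; lia.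
have px : (p %| x)%N by apply: (@dvdn_sum_sqr p x y) => //; rewrite exy dvdn_mull.
have py : (p %| y)%N by apply: (@dvdn_sum_sqr p y x) => //; rewrite addnC exy dvdn_mull.
move/negP: ppn; apply.
have : (p ^ 2 %| 2 * (12 * n + 1))%N by rewrite -exy dvdn_add ?dvdn_exp2r.
rewrite Gauss_dvdr // coprimeXl // prime_coprime // gtnNdvd //.
by have := prime_gt1 pp; case: p p3 {pp pn px py} => [|[|[|p]]].
Qed.

End Pentagonal.

(** * Generating functions of partitions with given minimal excludant *)

Section MexSeries.
Local Notation P := {poly int}.
Variable L : nat.

(* Partitions of n < L are encoded by their multiplicity functions: part i + 1 occurs f i times. *)
Definition mexcond m (i : 'I_L) (j : 'I_L.+1) : bool :=
  ((i.+1 < m) ==> (0 < j))%N && ((i.+1 == m) ==> (j == 0 :> nat)).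

Definition mexpoly m : P := \prod_(i < L) \sum_(j < L.+1) if mexcond m i j then 'X^(i.+1 * j) else 0.

Definition weight (f : {ffun 'I_L -> 'I_L.+1}) : nat := (\sum_(i < L) i.+1 * f i)%N.

Lemma mexpoly_coef m n : (mexpoly m)`_n =
  \sum_(f : {ffun 'I_L -> 'I_L.+1} | [forall i, mexcond m i (f i)] && (weight f == n)) 1.
Proof.
rewrite /mexpoly bigA_distr_bigA /= coef_sum [RHS]big_mkcond; apply: eq_bigr => f _.
case: (boolP [forall i, _]) => [/forallP h|].
  under eq_bigr => i _ do rewrite h.
  rewrite -(big_morph (fun k => 'X^k : P) (fun a b => exprD 'X a b) (expr0 _)) coefXn.
  by rewrite /= eq_sym /weight; case: eqP.
rewrite negb_forall => /existsP[i h]; rewrite (bigD1 i) //= (negbTE h) mul0r coef0 //.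
Qed.

Definition unmult (f : {ffun 'I_L -> 'I_L.+1}) : seq nat :=
  sort geq (flatten [seq nseq (f i) i.+1 | i <- index_enum (fintype.ordinal L)]).

Lemma count_unmult f x : count_mem x (unmult f) = (\sum_(i < L | i.+1 == x) f i)%N.
Proof.
rewrite /unmult count_sort count_flatten sumnE !big_map /= [RHS]big_mkcond; apply: eq_bigr => i _.
by rewrite count_nseq /=; case: eqP; rewrite ?mul1n ?mul0n.
Qed.

Lemma sumn_unmult f : sumn (unmult f) = weight f.
Proof.
rewrite /unmult (perm_sumn (permEl (perm_sort _ _))) sumn_flatten sumnE !big_map /=.
by apply: eq_bigr => i _; rewrite sumn_nseq.
Qed.

Lemma unmult_partition f : is_partition (weight f) (unmult f).
Proof.
apply/and3P; split; last by rewrite sumn_unmult.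
  by apply: sort_sorted => a b; exact: leq_total.
apply/allP => x; rewrite mem_sort => /flatten_mapP[i _]; rewrite mem_nseq => /andP[_ /eqP ->] //.
Qed.

Definition multf n (p : intpart n) : {ffun 'I_L -> 'I_L.+1} := [ffun i : 'I_L => inord (count_mem i.+1 p)].

Lemma count_le_sumn x (s : seq nat) : (0 < x -> count_mem x s <= sumn s)%N.
Proof. by move=> x0; elim: s => //= y s IH; case: eqP => [->|_]; lia. Qed.

Lemma multfE n (p : intpart n) (i : 'I_L) : (n < L)%N -> multf p i = count_mem i.+1 p :> nat.
Proof.
move=> nL; rewrite ffunE inordK // ltnS; apply: leq_trans (ltnW nL).
have /and3P[_ _ /eqP h] : is_partition n p := valP p.
by rewrite -[X in (_ <= X)%N]h; exact: count_le_sumn.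
Qed.

(** Serves as the default value of [insubd] when multiplicity functions are turned back into
    partitions. *)
Definition ones n : intpart n.
Proof.
apply: (@IntPart n (nseq n 1%N)); apply/and3P; split; last by rewrite sumn_nseq mul1n.
  by elim: n => [//|[|n] IH] //=.
by apply/allP => x; rewrite mem_nseq => /andP[_ /eqP ->].
Defined.

Lemma multf_unmult n (p : intpart n) : (n < L)%N -> unmult (multf p) = p.
Proof.
move=> nL; have /and3P[h1 h2 /eqP h3] : is_partition n p := valP p.
apply: (@sorted_eq _ geq) => //.
- by move=> a b c /= ab bc; exact: leq_trans bc ab.
- by move=> a b /= /andP[ab ba]; apply/eqP; rewrite eqn_leq ab ba.
- by apply: sort_sorted => a b; exact: leq_total.
apply/allP => x _ /=; rewrite count_unmult.
have e : (\sum_(i < L | i.+1 == x) multf p i = \sum_(i < L | i.+1 == x) count_mem x p)%N.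
  by apply: eq_bigr => i /eqP <-; rewrite multfE.
rewrite e; case: x {e} => [|x].
  rewrite big_pred0 // eq_sym; apply/eqP/count_memPn; apply/negP => h0.
  by have /allP/(_ _ h0) := h2.
have [xL|xL] := ltnP x L.
  by rewrite (big_pred1 (Ordinal xL)) // => i; rewrite -val_eqE /= eqSS.
rewrite big_pred0; last by move=> i; apply/negbTE; rewrite eqSS; have := ltn_ord i; lia.
rewrite eq_sym; apply/eqP/count_memPn; apply/negP => /mem_le_sumn; rewrite h3; lia.
Qed.

Lemma weight_multf n (p : intpart n) : (n < L)%N -> weight (multf p) = n.
Proof. by move=> nL; rewrite -sumn_unmult multf_unmult //; have /and3P[_ _ /eqP] := valP p. Qed.

Lemma unmultK (f : {ffun 'I_L -> 'I_L.+1}) n (p : intpart n) : (n < L)%N -> unmult f = p -> multf p = f.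
Proof.
move=> nL h; apply/ffunP => i; apply/val_inj; rewrite /= multfE // -h count_unmult.
by rewrite (big_pred1 i) // => j; rewrite -val_eqE /= eqSS.
Qed.

Lemma mexE (s : seq nat) m : (mex s == m) = [&& (0 < m)%N, m \notin s & [forall i : 'I_m, (0 < i)%N ==> (nat_of_ord i \in s)]].
Proof.
rewrite /mex; case: ex_minnP => k /andP[k0 ks] hk; apply/eqP/and3P => [<-|[m0 ms /forallP h]].
  split=> //; apply/forallP => i; apply/implyP => i0; apply/negPn/negP => is_.
  by have := hk i; rewrite i0 is_ /= => /(_ isT); have := ltn_ord i; lia.
apply/eqP; rewrite eqn_leq hk ?m0 //= leqNgt; apply/negP => km.
by have := h (Ordinal km); rewrite /= k0 (negbTE ks).
Qed.

Lemma mexcond_mex n (p : intpart n) m : (n < L)%N -> (0 < m <= L)%N -> [forall i, mexcond m i (multf p i)] = (mex p == m).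
Proof.
move=> nL /andP[m0 mL]; rewrite mexE m0 /=; apply/forallP/andP => [h|[h1 /forallP h2] i].
  split.
    have mL' : (m.-1 < L)%N by lia.
    have := h (Ordinal mL'); rewrite /mexcond multfE //= prednK // eqxx /= => /andP[_ /eqP h0].
    by apply/count_memPn.
  apply/forallP => i; apply/implyP => i0; have iL : (i.-1 < L)%N by have := ltn_ord i; lia.
  have := h (Ordinal iL); rewrite /mexcond multfE //= prednK // ltn_ord /= => /andP[h0 _].
  by rewrite -has_pred1 has_count.
rewrite /mexcond multfE //; apply/andP; split; apply/implyP.
  by move=> im; have := h2 (Ordinal im); rewrite /= -has_pred1 has_count.
by move/eqP => im; rewrite im; apply/eqP/count_memPn.
Qed.

Lemma mexpoly_card n m : (n < L)%N -> (0 < m <= L)%N -> (mexpoly m)`_n = \sum_(p : intpart n | mex p == m) 1.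
Proof.
move=> nL mL; rewrite mexpoly_coef.
rewrite (reindex_onto (@multf n) (fun f => insubd (ones n) (unmult f))) /=; last first.
  move=> f /andP[_ /eqP wf]; apply: unmultK => //.
  by rewrite /insubd insubT /= ?SubK //; rewrite -wf; exact: unmult_partition.
apply: eq_bigl => p; rewrite mexcond_mex // weight_multf // eqxx andbT.
suff -> : insubd (ones n) (unmult (multf p)) = p by rewrite eqxx andbT.
by rewrite multf_unmult // valKd.
Qed.

Lemma mex_le n (p : intpart n) : (mex p <= n.+1)%N.
Proof.
have /and3P[_ _ /eqP h] : is_partition n p := valP p.
rewrite /mex; case: ex_minnP => k _; apply; rewrite /=; apply/negP => /mem_le_sumn.
by rewrite h ltnn.
Qed.

Lemma G_e_coef n : (n < L)%N -> G_e n = (\sum_(0 <= m < L.+1 | ~~ odd m) m%:R * mexpoly m)`_n.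
Proof.
move=> nL; rewrite /G_e /sigma_e_mex.
rewrite coef_sum -[Posz _]/(Posz _) -natz natr_sum.
transitivity (\sum_(p : intpart n | (2 %| mex p)%N) \sum_(0 <= m < L.+1 | ~~ odd m && (mex p == m)) (m%:R : int)).
  apply: eq_bigr => p; rewrite dvdn2 => h.
  rewrite big_mkcond (bigD1_seq (mex p)) ?iota_uniq ?mem_index_iota //=; last first.
    by rewrite ltnS; apply: leq_trans (mex_le p) _.
  by rewrite eqxx h big1 ?addr0 // => m; rewrite eq_sym => /negbTE ->; rewrite andbF.
rewrite (exchange_big_dep (fun m => ~~ odd m)) /=; last by move=> p m _ /andP[].
rewrite big_nat_cond [RHS]big_nat_cond; apply: eq_bigr => m /andP[/andP[_ mL] mo].
have [->|m0] := posnP m; first by rewrite mul0r coef0 big1.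
rewrite mulr_natl coefMn mexpoly_card ?m0 // -[RHS]mulr_natl mulr_sumr big_mkcond [RHS]big_mkcond; apply: eq_bigr => p _.
by rewrite dvdn2 mo /=; case: eqP => [->|_]; rewrite ?andbF ?mo ?mulr1.
Qed.

Lemma geom_poly (Y : P) N : (1 - Y) * \sum_(j < N) Y ^+ j = 1 - Y ^+ N.
Proof. by have := subrX1 Y N => h; rewrite -opprB mulNr -h opprB. Qed.

(** Factor by factor: a free part contributes 1 to the product, a part below m contributes X^(i+1)
    because it occurs at least once, and the missing part m leaves 1 - X^m. The exponents 1, ..., m
    - 1 add up to C(m, 2). *)
Lemma EP_mexpoly m : (0 < m <= L)%N -> eqm L (EP int L * mexpoly m) ('X^'C(m, 2) * (1 - 'X^m)).
Proof.
move=> /andP[m0 mL].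
have -> : EP int L = \prod_(i < L) (1 - 'X^(i.+1)) by rewrite /EP big_add1 /= big_mkord.
rewrite /mexpoly -big_split /=.
pose tg (i : nat) : P := if (i.+1 < m)%N then 'X^(i.+1) else if i.+1 == m then 1 - 'X^m else 1.
have -> : 'X^'C(m, 2) * (1 - 'X^m) = \prod_(i < L) tg i.
  rewrite -(big_mkord xpredT tg) (@big_cat_nat _ _ _ m) //= -[in RHS](prednK m0) big_nat_recr //= (prednK m0).
  have -> : \prod_(m <= i < L) tg i = 1.
    by rewrite big_nat big1 // => i /andP[im _]; rewrite /tg !ifF //; lia.
  rewrite mulr1.
  rewrite {2}/tg prednK // ltnn eqxx; congr (_ * _).
  rewrite big_nat (eq_bigr (fun i => 'X^(i.+1))); last by move=> i /andP[_ im]; rewrite /tg ifT //; lia.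
  rewrite -big_nat -{1}(prednK m0); elim: m.-1 => [|k IH]; first by rewrite big_geq.
  by rewrite big_nat_recr //= -IH binS bin1 exprD.
apply: eqm_prod => i _; rewrite /tg /mexcond.
have big0 : eqm L (1 - ('X^(i.+1) : P) ^+ L.+1) 1.
  rewrite -[X in eqm _ _ X]subr0; apply: eqmB => //; rewrite -exprM -['X^_]mul1r; apply: eqmX0.
  by rewrite mulSn; lia.
have bigX : eqm L (1 - ('X^(i.+1) : P) ^+ L) 1.
  by rewrite -[X in eqm _ _ X]subr0; apply: eqmB => //; rewrite -exprM -['X^_]mul1r; apply: eqmX0; rewrite mulSn leq_addr.
case: ltngtP => h /=.
- rewrite big_ord_recl /= add0r.
  have -> : \sum_(j < L) (if true then 'X^(i.+1 * lift ord0 j) else 0) = 'X^(i.+1) * \sum_(j < L) ('X^(i.+1) : P) ^+ j.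
    by rewrite mulr_sumr; apply: eq_bigr => j _; rewrite /= /bump /= add1n -exprM -exprD mulnS.
  rewrite mulrCA geom_poly -[X in eqm _ _ X]mulr1; exact: eqmM.
- have -> : \sum_(j < L.+1) 'X^(i.+1 * j) = \sum_(j < L.+1) ('X^(i.+1) : P) ^+ j by apply: eq_bigr => j _; rewrite exprM.
  by rewrite geom_poly.
rewrite big_ord_recl /= muln0 expr0 big1 ?addr0 ?mulr1; last by move=> j _.
by rewrite h.
Qed.

End MexSeries.

(** Checked after multiplication by the Euler product. Gauss minus Jacobi has coefficient 1 - (-1)^j
    (2 j + 1) at X^C(j+1, 2): 2 (j + 1) for odd j and -2 j for even j. This is twice the sum of m
    (X^C(m, 2) - X^C(m+1, 2)) over even m. *)
Lemma G_e_split n L : (n < L)%N -> 2 * G_e n = (AP int L ^+ 2)`_n - (EP int L ^+ 2)`_n.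
Proof.
move=> nL; rewrite (G_e_coef nL); set H := \sum_(_ <= m < _ | _) _.
suff h : eqm L (H + H) (AP int L ^+ 2 - EP int L ^+ 2).
  by have := h n nL; rewrite coefD coefB => <-; ring.
apply: (@eqm_cancel _ _ (EP int L)); first exact: EP0.
rewrite mulrBr -exprS; apply: (@eqm_trans _ _ _ (\sum_(0 <= j < L) 'X^'C(j.+1, 2) - \sum_(0 <= j < L) ((-1) ^+ j * (2 * j).+1%:R) *: 'X^'C(j.+1, 2))); last first.
  by apply: eqm_sym; apply: eqmB; [exact: gauss_identity|exact: jacobi_identity].
have h1 : eqm L (EP int L * H) (\sum_(0 <= m < L.+1 | ~~ odd m) m%:R * ('X^'C(m, 2) - 'X^'C(m.+1, 2))).
  rewrite /H mulr_sumr big_nat_cond [X in eqm _ _ X]big_nat_cond; apply: eqm_sum => m /andP[/andP[_ mL] _].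
  have [->|m0] := posnP m; first by rewrite !mul0r mulr0.
  rewrite mulrCA; apply: eqmM => //; apply: eqm_trans (EP_mexpoly _) _; first by rewrite m0.
  by rewrite mulrBr mulr1 -exprD binS bin1.
rewrite mulrDr; apply: eqm_trans (eqmD h1 h1) _.
have -> : \sum_(0 <= m < L.+1 | ~~ odd m) m%:R * ('X^'C(m, 2) - 'X^'C(m.+1, 2)) =
  \sum_(0 <= m < L.+1 | ~~ odd m) m%:R * 'X^'C(m, 2) - \sum_(0 <= m < L.+1 | ~~ odd m) m%:R * 'X^'C(m.+1, 2) :> {poly int}.
  by rewrite -sumrB; apply: eq_bigr => m _; rewrite mulrBr.
have -> : \sum_(0 <= m < L.+1 | ~~ odd m) m%:R * 'X^'C(m, 2) = \sum_(0 <= j < L | odd j) j.+1%:R * 'X^'C(j.+1, 2) :> {poly int}.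
  rewrite big_mkcond big_nat_recl // /= mul0r add0r [RHS]big_mkcond; apply: eq_bigr => j _.
  by rewrite /= negbK.
have h2 : eqm L (\sum_(0 <= m < L.+1 | ~~ odd m) m%:R * 'X^'C(m.+1, 2) : {poly int}) (\sum_(0 <= m < L | ~~ odd m) m%:R * 'X^'C(m.+1, 2)).
  rewrite big_mkcond big_nat_recr //= -big_mkcond -[X in eqm _ _ X]addr0; apply: eqmD => //.
  by case: ifP => // _; apply: eqmX0; exact: bin2S_ge.
apply: eqm_trans (eqmD (eqmB (@eqm_refl _ _ _) h2) (eqmB (@eqm_refl _ _ _) h2)) _.
suff -> : \sum_(0 <= j < L) 'X^'C(j.+1, 2) - \sum_(0 <= j < L) ((-1) ^+ j * (2 * j).+1%:R) *: 'X^'C(j.+1, 2) =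
  \sum_(0 <= j < L | odd j) j.+1%:R * 'X^'C(j.+1, 2) - \sum_(0 <= m < L | ~~ odd m) m%:R * 'X^'C(m.+1, 2) +
  (\sum_(0 <= j < L | odd j) j.+1%:R * 'X^'C(j.+1, 2) - \sum_(0 <= m < L | ~~ odd m) m%:R * 'X^'C(m.+1, 2)) :> {poly int} by [].
rewrite [\sum_(_ <= _ < _ | odd _) _]big_mkcond [\sum_(_ <= _ < _ | ~~ odd _) _]big_mkcond -!sumrB -big_split /=.
apply: eq_bigr => j _; rewrite -mul_polyC rmorphM rmorphXn rmorphN1 rmorph_nat -signr_odd.
have -> : (2 * j).+1%:R = 2 * j%:R + 1 :> {poly int} by rewrite -natrM natr1.
have -> : j.+1%:R = j%:R + 1 :> {poly int} by rewrite natr1.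
by case: (odd j) => /=; ring.
Qed.

(** * Logarithmic derivatives, and recurrences for alpha and for the inverse series gamma *)

Section LogDerivative.
Local Notation P := {poly int}.

(** A twisted divisor sum, stable once L >= N; the common bound L lets double sums be exchanged over
    a fixed square. *)
Definition divs L N : int := \sum_(1 <= M < L.+1) \sum_(1 <= n < L.+1) if (M * n == N)%N then (-1) ^+ M * n%:R else 0.
Definition epsm (N : nat) : int := - 2 * divs N N.

Lemma divs_stable L N : (N <= L)%N -> divs L N = divs N N.
Proof.
move=> NL; rewrite /divs (@big_cat_nat _ _ _ N.+1) //= [X in _ + X]big_nat [X in _ + X]big1 ?addr0; last first.
  move=> M /andP[NM _]; rewrite big_nat big1 // => n /andP[n0 _]; rewrite ifF //; apply/negbTE/eqP; nia.
rewrite !big_nat; apply: eq_bigr => M /andP[M0 _]; rewrite (@big_cat_nat _ _ _ N.+1) //= [X in _ + X]big_nat [X in _ + X]big1 ?addr0 //.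
by move=> n /andP[n0 _]; rewrite ifF //; apply/negbTE/eqP; nia.
Qed.

(** The negative of the truncated expansion of X^i / (1 + X^i). *)
Definition Sp L i : P := \sum_(1 <= k < L.+1) (-1) ^+ k * 'X^(i * k).
Definition EL L : P := - 2 *: \sum_(1 <= i < L.+1) i%:R * Sp L i.

Lemma coef_sign (m : nat) (p : P) i : ((-1) ^+ m * p)`_i = (-1) ^+ m * p`_i.
Proof.
have -> : (-1) ^+ m = ((-1) ^+ m)%:P :> P by rewrite rmorphXn rmorphN1.
by rewrite coefCM.
Qed.

Lemma EL_coef L N : (N <= L)%N -> (EL L)`_N = epsm N.
Proof.
move=> NL; rewrite /EL /epsm -(divs_stable NL) coefZ; congr (_ * _).
rewrite /divs coef_sum exchange_big /=; apply: eq_bigr => i _.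
rewrite mulr_natl coefMn -[LHS]mulr_natl coef_sum mulr_sumr; apply: eq_bigr => k _.
by rewrite coef_sign coefXn eq_sym mulnC; case: eqP => _; rewrite ?mulr0 // mulr1 mulrC.
Qed.

Lemma Sp_mul L i : (0 < i)%N -> eqm L.+1 ((1 + 'X^i) * - Sp L i) 'X^i.
Proof.
move=> i0.
have -> : (1 + 'X^i) * - Sp L i = 'X^i * (1 - (- 'X^i) ^+ L).
  have := geom_poly (- 'X^i) L; rewrite opprK => h.
  rewrite -h mulrCA; congr (_ * _); rewrite /Sp big_add1 /= -sumrN mulr_sumr big_mkord.
  by apply: eq_bigr => k _; rewrite [(- 'X^i) ^+ k]exprNn -exprM mulnS exprD [(-1) ^+ k.+1]exprS; ring.
rewrite mulrBr mulr1 -[X in eqm _ _ X]subr0; apply: eqmB => //.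
rewrite exprNn mulrCA -exprM -exprD; apply: eqmX0.
by rewrite -mulnS; case: (i) i0 => // j _; rewrite mulSn leq_addr.
Qed.

Definition theta (p : P) : P := 'X * p^`().
Lemma coef_theta p n : (theta p)`_n = n%:R * p`_n.
Proof. by rewrite /theta coefXM; case: n => [|n] /=; rewrite ?mul0r // coef_deriv mulr_natl. Qed.
Lemma thetaM p q : theta (p * q) = theta p * q + p * theta q.
Proof. by rewrite /theta derivM; ring. Qed.
Lemma theta_eqm N p q : eqm N p q -> eqm N (theta p) (theta q).
Proof. by move=> h i iN; rewrite !coef_theta h. Qed.

(** The operator X d/dX is a derivation, and 1 + X^i contributes i X^i / (1 + X^i). The induction
    runs over the number of factors at a fixed precision. *)
Lemma theta_AP L : eqm L.+1 (theta (AP int L ^+ 2)) (EL L * AP int L ^+ 2).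
Proof.
have h l : (l <= L)%N -> eqm L.+1 (theta (AP int l)) (- (\sum_(1 <= i < l.+1) i%:R * Sp L i) * AP int l).
  elim: l => [|l IH] lL; first by rewrite /AP !big_geq // oppr0 mul0r /theta derivC mulr0.
  have -> : AP int l.+1 = AP int l * (1 + 'X^(l.+1)) by rewrite /AP big_nat_recr.
  rewrite thetaM [\sum_(1 <= i < l.+2) _]big_nat_recr //=.
  have -> : - (\sum_(1 <= i < l.+1) i%:R * Sp L i + l.+1%:R * Sp L l.+1) * (AP int l * (1 + 'X^(l.+1))) =
    - (\sum_(1 <= i < l.+1) i%:R * Sp L i) * AP int l * (1 + 'X^(l.+1)) + AP int l * (l.+1%:R * ((1 + 'X^(l.+1)) * - Sp L l.+1)) by ring.
  apply: eqmD; apply: eqmM => //; first exact: IH (ltnW lL).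
  have -> : theta (1 + 'X^(l.+1)) = l.+1%:R * 'X^(l.+1) :> P.
    by rewrite /theta derivD derivC add0r derivXn /= mulrnAr -exprS mulr_natl.
  by apply: eqmM => //; apply: eqm_sym; apply: Sp_mul.
rewrite expr2 thetaM.
have -> : EL L * (AP int L * AP int L) = (- (\sum_(1 <= i < L.+1) i%:R * Sp L i) * AP int L) * AP int L + AP int L * (- (\sum_(1 <= i < L.+1) i%:R * Sp L i) * AP int L).
  by rewrite /EL -mul_polyC rmorphN rmorph_nat; ring.
by apply: eqmD; apply: eqmM => //; exact: h.
Qed.

Definition BP L : P := \prod_(1 <= i < L.+1) \sum_(k < L.+1) (- 'X^i) ^+ k.

Lemma AP_BP L : eqm L.+1 (AP int L * BP L) 1.
Proof.
rewrite /AP /BP -big_split /=.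
have e1 : 1 = \prod_(1 <= i < L.+1) (1 : P) by rewrite big1.
rewrite [X in eqm _ _ X]e1 !big_nat; apply: eqm_prod => i /andP[i0 _].
have := geom_poly (- 'X^i) L.+1; rewrite opprK => ->.
rewrite -[X in eqm _ _ X]subr0; apply: eqmB => //; rewrite exprNn -exprM; apply: eqmX0.
by case: (i) i0 => // j _; rewrite mulSn leq_addr.
Qed.

Lemma AP_BP2 L : eqm L.+1 (AP int L ^+ 2 * BP L ^+ 2) 1.
Proof. by rewrite -exprMn -[X in eqm _ _ X]mul1r expr2; apply: eqmM; exact: AP_BP. Qed.

Lemma AP2_0 L : (AP int L ^+ 2)`_0 = 1.
Proof. by rewrite expr2 coefM big_ord1 AP0 mulr1. Qed.

Lemma BP2_stable L L' : (L <= L')%N -> eqm L.+1 (BP L ^+ 2) (BP L' ^+ 2).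
Proof.
move=> LL; apply: (@eqm_cancel _ _ (AP int L ^+ 2)); first exact: AP2_0.
apply: eqm_trans (@AP_BP2 L) _; apply: eqm_sym.
apply: (@eqm_trans _ _ _ (AP int L' ^+ 2 * BP L' ^+ 2)).
  apply: eqmM => //; rewrite !expr2; apply: eqmM; exact: AP_stable.
by apply: (@eqm_le _ _ L'.+1) => //; exact: AP_BP2.
Qed.

Lemma theta_BP L : eqm L.+1 (theta (BP L ^+ 2)) (- EL L * BP L ^+ 2).
Proof.
apply: (@eqm_cancel _ _ (AP int L ^+ 2)); first exact: AP2_0.
have h := theta_eqm (@AP_BP2 L); rewrite thetaM in h.
have t1 : theta 1 = 0 by rewrite /theta derivC mulr0.
rewrite t1 in h.
move=> i iL; have := h i iL; rewrite coefD coef0.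
have h2 := eqmM (@theta_AP L) (@eqm_refl _ L.+1 (BP L ^+ 2)).
rewrite (h2 i iL) => /eqP; rewrite addrC addr_eq0 => /eqP ->.
have -> : AP int L ^+ 2 * (- EL L * BP L ^+ 2) = - (EL L * AP int L ^+ 2 * BP L ^+ 2) by ring.
by rewrite coefN.
Qed.

(** The truncation at level n is already exact in degree n, so this is the coefficient of the
    infinite product; likewise for [gamma]. *)
Definition alpha n : int := (AP int n ^+ 2)`_n.
Definition gamma n : int := (BP n ^+ 2)`_n.

Lemma alphaE n L : (n <= L)%N -> (AP int L ^+ 2)`_n = alpha n.
Proof. by move=> nL; have h := eqmM (@AP_stable int _ _ nL) (@AP_stable int _ _ nL); rewrite /alpha !expr2 (h n (ltnSn n)). Qed.
Lemma gammaE n L : (n <= L)%N -> (BP L ^+ 2)`_n = gamma n.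
Proof. by move=> nL; symmetry; exact: BP2_stable. Qed.

Lemma alpha0 : alpha 0 = 1. Proof. exact: AP2_0. Qed.
Lemma alpha_rec n : n%:R * alpha n = \sum_(0 <= m < n.+1) epsm m * alpha (n - m).
Proof.
rewrite -coef_theta (theta_AP (ltnSn n)) coefM big_mkord; apply: eq_bigr => m _.
by rewrite EL_coef ?alphaE // ?leq_subr // -ltnS.
Qed.
Lemma gamma_rec n : n%:R * gamma n = - \sum_(0 <= m < n.+1) epsm m * gamma (n - m).
Proof.
rewrite -coef_theta (theta_BP (ltnSn n)) mulNr coefN coefM big_mkord; congr (- _); apply: eq_bigr => m _.
by rewrite EL_coef ?gammaE // ?leq_subr // -ltnS.
Qed.
Lemma alpha_gamma n : \sum_(0 <= m < n.+1) alpha m * gamma (n - m) = (n == 0)%:R.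
Proof.
rewrite -coef1 -(AP_BP2 (ltnSn n)) coefM big_mkord; apply: eq_bigr => m _.
by rewrite alphaE ?gammaE // ?leq_subr // -ltnS.
Qed.
Lemma epsm0 : epsm 0 = 0. Proof. by rewrite /epsm /divs big_geq // mulr0. Qed.
(** The coefficient of t^25 in F, which later determines C^4 through U_5. *)
Lemma alpha2 : alpha 2 = 3.
Proof.
have h1 := alpha_rec 1; have h2 := alpha_rec 2.
have e1 : epsm 1 = 2 by rewrite /epsm /divs !big_nat1.
have e2 : epsm 2 = 2 by rewrite /epsm /divs unlock; vm_compute.
move: h1 h2; rewrite big_ltn // big_ltn // big_geq // big_ltn // big_ltn // big_ltn // big_geq // epsm0 e1 e2 alpha0.
by rewrite !mul0r !add0r !mulr1 !addr0 mul1r -[(2 - 1)%N]/1%N => -> h2; lia.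
Qed.

Lemma G_e_alpha p n : prime p -> (p %% 4 = 3)%N -> (p %| 12 * n + 1)%N -> ~~ (p ^ 2 %| 12 * n + 1)%N ->
  2 * G_e n = alpha n.
Proof.
move=> pp p3 pn ppn; rewrite (G_e_split (ltnSn n)) (@EP2_vanish p) //.
by rewrite subr0 alphaE.
Qed.

End LogDerivative.

Local Open Scope classical_set_scope.
Local Open Scope complex_scope.
Local Notation Re := complex.Re.
Local Notation Im := complex.Im.

(** * Null sequences, complex limits and the complex exponential *)

Section NullSequences.
Variable R : realType.
Implicit Types (a b : nat -> R) (r s : R).

Definition null b := forall e : R, 0 < e -> exists N, forall n, (N <= n)%N -> `|b n| < e.

Lemma null_le a b : (exists N, forall n, (N <= n)%N -> `|a n| <= b n) -> null b -> null a.
Proof.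
move=> [N0 ab] nb e e0; have [N1 h] := nb e e0.
exists (maxn N0 N1) => n; rewrite geq_max => /andP[h0 h1].
by apply: le_lt_trans (ab _ h0) (le_lt_trans (ler_norm _) (h _ h1)).
Qed.

Lemma nullD a b : null a -> null b -> null (fun n => a n + b n).
Proof.
move=> na nb e e0; have e2 : 0 < e / 2 by lra.
have [N1 h1] := na _ e2; have [N2 h2] := nb _ e2.
exists (maxn N1 N2) => n; rewrite geq_max => /andP[/h1 k1 /h2 k2].
by apply: le_lt_trans (ler_normD _ _) _; lra.
Qed.

Lemma nullZ (k : R) a : null a -> null (fun n => k * a n).
Proof.
move=> na e e0; have k1 : 0 < `|k| + 1 by have := normr_ge0 k; lra.
have [N h] := na (e / (`|k| + 1)) (divr_gt0 e0 k1).
exists N => n /h; rewrite ltr_pdivlMr // normrM => hn.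
by apply: le_lt_trans hn; rewrite mulrC ler_wpM2l // lerDl.
Qed.

Lemma null_ub (x : R) b : null b -> (forall n, `|x| <= b n) -> x = 0.
Proof.
move=> nb h; apply/eqP; rewrite -normr_eq0; apply/eqP; apply/le_anti.
rewrite normr_ge0 andbT leNgt; apply/negP => x0.
have [N hN] := nb _ x0; have := hN N (leqnn _); rewrite ltNge.
by rewrite (le_trans (h N) (ler_norm _)).
Qed.

Lemma null_le_lim (x y : R) b : null b -> (forall n, x <= y + b n) -> x <= y.
Proof.
move=> nb h; rewrite leNgt; apply/negP => xy.
have [N hN] := nb (x - y) ltac:(lra).
have := hN N (leqnn _); have := h N; have := ler_norm (b N); lra.
Qed.

Lemma null_geom r : 0 <= r -> r < 1 -> null (fun n => r ^+ n).
Proof.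
move=> r0 r1 e e0.
have /cvgrPdist_lt /(_ e e0) [N _ hN] : (r ^+ n) @[n --> \oo] --> (0:R).
  by apply: cvg_expr; rewrite ger0_norm.
by exists N => n /hN; rewrite sub0r normrN.
Qed.

Lemma null_inv (k : R) : null (fun n => k / n.+1%:R).
Proof.
move=> e e0; pose N := Num.truncn (`|k| / e).
exists N => n Nn; rewrite normrM normfV (ger0_norm (ler0n _ _)).
rewrite ltr_pdivrMr ?ltr0n //.
have : `|k| / e < N.+1%:R by rewrite /N truncnS_gt.
rewrite ltr_pdivrMr // => h; apply: lt_le_trans h _.
by rewrite mulrC ler_pM2l // ler_nat ltnS.
Qed.

Lemma geom_sum_nat r m n : r != 1 ->
  \sum_(m <= i < m + n) r ^+ i = r ^+ m * (1 - r ^+ n) / (1 - r).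
Proof.
move=> r1; have h : 1 - r != 0 by rewrite subr_eq0 eq_sym.
apply: (mulIf h); rewrite divfK //.
elim: n => [|n IH]; first by rewrite addn0 big_geq // expr0 subrr mul0r mulr0.
by rewrite addnS big_nat_recr ?leq_addr //= mulrDl IH !exprD !exprS; ring.
Qed.

Lemma geom_sum_le r m n : 0 <= r -> r < 1 ->
  \sum_(m <= i < n) r ^+ i <= r ^+ m / (1 - r).
Proof.
move=> r0 r1; have h : 0 < 1 - r by lra.
have [mn|/ltnW nm] := leqP m n; last first.
  by rewrite big_geq // divr_ge0 ?exprn_ge0 // ltW.
rewrite -(subnKC mn) geom_sum_nat ?lt_eqF // ler_pM2r ?invr_gt0 //.
by rewrite ler_piMr ?exprn_ge0 // gerBl exprn_ge0.
Qed.

(* n s^n <= 1 + s + ... + s^(n-1) *)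
Lemma natX_le s n : 0 <= s -> s < 1 -> n%:R * s ^+ n <= (1 - s)^-1.
Proof.
move=> s0 s1; apply: le_trans (_ : \sum_(0 <= i < n) s ^+ i <= _); last first.
  by apply: le_trans (geom_sum_le 0 n s0 s1) _; rewrite expr0 mul1r.
rewrite big_mkord -[n in n%:R]card_ord -sumr_const mulr_suml.
apply: ler_sum => i _; rewrite mul1r; apply: ler_wiXn2l => //; first exact: ltW.
exact: ltnW.
Qed.

End NullSequences.

(** * Norm and limits of complex sequences *)

Section ComplexNorm.
Variable R : realType.
Notation C := R[i].
Implicit Types (z w : C) (x y : R).

Definition nrm : C -> R := @Normc.normc R.

Arguments nrm : simpl never.

Lemma nrmE z : nrm z = Num.sqrt (Re z ^+ 2 + Im z ^+ 2). Proof. by case: z. Qed.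
Lemma nrm_ge0 z : 0 <= nrm z. Proof. by rewrite nrmE sqrtr_ge0. Qed.
Lemma nrm0 : nrm 0 = 0. Proof. exact: Normc.normc0. Qed.
Lemma nrm1 : nrm 1 = 1. Proof. exact: Normc.normc1. Qed.
Lemma nrm_eq0 z : nrm z = 0 -> z = 0. Proof. exact: Normc.eq0_normc. Qed.
Lemma nrmM z w : nrm (z * w) = nrm z * nrm w. Proof. exact: Normc.normcM. Qed.
Lemma nrmV z : nrm z^-1 = (nrm z)^-1. Proof. exact: Normc.normcV. Qed.
Lemma nrmf z w : nrm (z / w) = nrm z / nrm w. Proof. by rewrite nrmM nrmV. Qed.
Lemma nrmN z : nrm (- z) = nrm z. Proof. by rewrite !nrmE; case: z => a b /=; rewrite !sqrrN. Qed.
Lemma nrmD z w : nrm (z + w) <= nrm z + nrm w. Proof. exact: le_normcD. Qed.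
Lemma nrmB z w : nrm (z - w) <= nrm z + nrm w.
Proof. by rewrite -(nrmN w); exact: nrmD. Qed.
Lemma nrmBC z w : nrm (z - w) = nrm (w - z). Proof. by rewrite -nrmN opprB. Qed.
Lemma nrm_dist z w : nrm z <= nrm w + nrm (z - w).
Proof. by rewrite -{1}(subrK w z) addrC nrmD. Qed.
Lemma nrmX z n : nrm (z ^+ n) = nrm z ^+ n.
Proof. by elim: n => [|n IH]; rewrite ?expr0 ?nrm1 // !exprS nrmM IH. Qed.
Lemma nrm_sum (I : Type) (r : seq I) (P : pred I) (f : I -> C) :
  nrm (\sum_(i <- r | P i) f i) <= \sum_(i <- r | P i) nrm (f i).
Proof.
elim/big_ind2: _ => [|a b c d h k|//]; first by rewrite nrm0.
exact: le_trans (nrmD _ _) (lerD h k).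
Qed.
Lemma nrmR x : nrm x%:C = `|x|.
Proof. by rewrite nrmE /= expr0n addr0 sqrtr_sqr. Qed.
Lemma nrm_nat n : nrm n%:R = n%:R.
Proof. by rewrite -(rmorph_nat (real_complex R)) nrmR ger0_norm. Qed.
Lemma nrm_gt0 z : z != 0 -> 0 < nrm z.
Proof. by move=> h; rewrite lt_def nrm_ge0 andbT; apply: contra h => /eqP/nrm_eq0->. Qed.
Lemma Re_le_nrm z : `|Re z| <= nrm z.
Proof. by rewrite nrmE -sqrtr_sqr ler_wsqrtr // lerDl sqr_ge0. Qed.
Lemma Im_le_nrm z : `|Im z| <= nrm z.
Proof. by rewrite nrmE -sqrtr_sqr ler_wsqrtr // lerDr sqr_ge0. Qed.
Lemma nrm_le z : nrm z <= `|Re z| + `|Im z|.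
Proof.
rewrite nrmE -[leRHS]ger0_norm ?addr_ge0 // -sqrtr_sqr ler_wsqrtr //.
rewrite sqrrD !real_normK ?num_real //.
have : 0 <= `|Re z| * `|Im z| by rewrite mulr_ge0.
by set a := _ ^+ 2; set b := _ ^+ 2; set c := _ * _; rewrite mulr2n; lra.
Qed.
Lemma sqr_nrm z : nrm z ^+ 2 = Re z ^+ 2 + Im z ^+ 2.
Proof. by rewrite nrmE sqr_sqrtr // addr_ge0 ?sqr_ge0. Qed.

Lemma cReD z w : Re (z + w) = Re z + Re w. Proof. by case: z; case: w. Qed.
Lemma cImD z w : Im (z + w) = Im z + Im w. Proof. by case: z; case: w. Qed.
Lemma cReN z : Re (- z) = - Re z. Proof. by case: z. Qed.
Lemma cImN z : Im (- z) = - Im z. Proof. by case: z. Qed.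
Lemma cReM z w : Re (z * w) = Re z * Re w - Im z * Im w. Proof. by case: z; case: w. Qed.
Lemma cImM z w : Im (z * w) = Re z * Im w + Im z * Re w. Proof. by case: z; case: w. Qed.
Lemma cRe_sum (I : Type) (r : seq I) (P : pred I) (f : I -> C) :
  Re (\sum_(i <- r | P i) f i) = \sum_(i <- r | P i) Re (f i).
Proof. by elim/big_rec2: _ => // i a b _ <-; rewrite cReD. Qed.
Lemma cIm_sum (I : Type) (r : seq I) (P : pred I) (f : I -> C) :
  Im (\sum_(i <- r | P i) f i) = \sum_(i <- r | P i) Im (f i).
Proof. by elim/big_rec2: _ => // i a b _ <-; rewrite cImD. Qed.
Lemma complex_ext z w : Re z = Re w -> Im z = Im w -> z = w.
Proof. by case: z; case: w => a b c d /= -> ->. Qed.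
Lemma rcI (x : R) : Im x%:C = 0. Proof. by []. Qed.
Lemma cImV z : Im z^-1 = - Im z / nrm z ^+ 2.
Proof. by rewrite sqr_nrm; case: z => a b /=; rewrite mulNr. Qed.

Definition clim (u : nat -> C) (l : C) := null (fun n => nrm (u n - l)).

Lemma clim_le u l (b : nat -> R) : (forall n, nrm (u n - l) <= b n) -> null b -> clim u l.
Proof. by move=> h; apply: null_le; exists 0%N => n _; rewrite ger0_norm ?nrm_ge0. Qed.

Lemma clim_unique u l m : clim u l -> clim u m -> l = m.
Proof.
move=> ul um; apply/eqP; rewrite -subr_eq0; apply/eqP/nrm_eq0.
apply: (null_ub (nullD ul um)) => n; rewrite ger0_norm ?nrm_ge0 //.
rewrite (nrmBC (u n) l); apply: le_trans (nrmD _ _).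
by rewrite addrA subrK.
Qed.

Lemma climD u v l m : clim u l -> clim v m -> clim (fun n => u n + v n) (l + m).
Proof.
move=> ul vm; apply: (clim_le _ (nullD ul vm)) => n.
by rewrite opprD addrACA nrmD.
Qed.

Lemma climZ (k : C) u l : clim u l -> clim (fun n => k * u n) (k * l).
Proof.
move=> ul; apply: (clim_le _ (nullZ (nrm k) ul)) => n.
by rewrite -mulrBr nrmM.
Qed.

Lemma clim_cst (l : C) : clim (fun=> l) l.
Proof. by move=> e e0; exists 0%N => n _; rewrite subrr nrm0 normr0. Qed.

Lemma clim_near u v l : null (fun n => nrm (u n - v n)) -> clim v l -> clim u l.
Proof.
move=> uv vl; apply: (clim_le _ (nullD uv vl)) => n.
by apply: le_trans (nrmD _ _); rewrite addrA subrK.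
Qed.

Lemma eq_clim u v l : (forall n, u n = v n) -> clim u l -> clim v l.
Proof. by move=> h; have -> : u = v by apply/funext. Qed.

Lemma clim_sub u l (f : nat -> nat) : (forall n, (n <= f n)%N) -> clim u l -> clim (u \o f) l.
Proof. by move=> h ul e /ul[N hN]; exists N => n Nn; apply: hN; exact: leq_trans (h n). Qed.

Lemma clim_nrm_le u l B : clim u l -> (forall n, nrm (u n) <= B) -> nrm l <= B.
Proof.
move=> ul h; apply: (null_le_lim ul) => n.
by apply: le_trans (nrm_dist _ (u n)) _; rewrite nrmBC lerD2r.
Qed.

Definition psum (u : nat -> C) n := \sum_(0 <= i < n) u i.

Lemma psum_dist_le u (K s : R) m n : 0 <= s -> s < 1 -> (m <= n)%N ->
  (forall k, nrm (u k) <= K * s ^+ k) -> nrm (psum u n - psum u m) <= K * (s ^+ m / (1 - s)).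
Proof.
move=> s0 s1 mn h; have K0 : 0 <= K by apply: le_trans (nrm_ge0 _) (le_trans (h 0%N) _); rewrite expr0 mulr1.
rewrite /psum (big_cat_nat (leq0n m) mn) /= addrAC subrr add0r.
apply: le_trans (nrm_sum _ _ _) _; apply: le_trans (ler_sum _ (fun i _ => h i)) _.
by rewrite -mulr_sumr ler_wpM2l // geom_sum_le.
Qed.

Lemma real_geom_cvg (u : nat -> R) (K s : R) : 0 <= s -> s < 1 ->
  (forall n, `|u n| <= K * s ^+ n) -> exists l, null (fun n => \sum_(0 <= i < n) u i - l).
Proof.
move=> s0 s1 h.
have cv : cvgn (series u).
  apply: normed_cvg; apply: (@series_le_cvg _ _ (fun n => K * s ^+ n)) => //.
  - by move=> n /=.
  - by move=> n; exact: le_trans (normr_ge0 _) (h n).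
  - by apply: is_cvg_geometric_series; rewrite ger0_norm.
exists (limn (series u)) => e e0.
have /cvgrPdist_lt /(_ e e0) [N _ hN] := cv.
by exists N => n /hN; rewrite distrC.
Qed.

Lemma geom_cvg (u : nat -> C) (K s : R) : 0 <= s -> s < 1 ->
  (forall n, nrm (u n) <= K * s ^+ n) -> exists l, clim (psum u) l.
Proof.
move=> s0 s1 h.
have [a ha] := real_geom_cvg s0 s1 (fun n => le_trans (Re_le_nrm (u n)) (h n)).
have [b hb] := real_geom_cvg s0 s1 (fun n => le_trans (Im_le_nrm (u n)) (h n)).
exists (a +i* b); apply: (clim_le (b := fun n => `|\sum_(0 <= i < n) Re (u i) - a| + `|\sum_(0 <= i < n) Im (u i) - b|)).
  move=> n; apply: le_trans (nrm_le _) _.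
  by rewrite cReD cImD cReN cImN cRe_sum cIm_sum.
by apply: nullD; [move=> e /ha[N hN]|move=> e /hb[N hN]]; exists N => n /hN; rewrite normr_id.
Qed.

Lemma clim_tail u l (K s : R) : 0 <= s -> s < 1 ->
  (forall n, nrm (u n) <= K * s ^+ n) -> clim (psum u) l ->
  forall n, nrm (l - psum u n) <= K * (s ^+ n / (1 - s)).
Proof.
move=> s0 s1 h ul n; apply: (null_le_lim (clim_sub (fun m => leq_addr n m) ul)) => m /=.
have -> : l - psum u n = (l - psum u (m + n)) + (psum u (m + n) - psum u n) by rewrite addrA subrK.
apply: le_trans (nrmD _ _) _; rewrite nrmBC addrC lerD2r.
exact: psum_dist_le (leq_addl _ _) h.
Qed.

End ComplexNorm.

Arguments nrm {R} z : simpl never.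

(** * The complex exponential and its elementary estimates *)

Section Exponential.
Variable R : realType.
Notation C := R[i].
Implicit Types (z w : C) (x y : R).

Definition cexp z : C := (expR (Re z) * cos (Im z)) +i* (expR (Re z) * sin (Im z)).

Lemma cexpD z w : cexp (z + w) = cexp z * cexp w.
Proof.
by apply: complex_ext; rewrite ?cReM ?cImM /cexp /= cReD cImD expRD ?cosD ?sinD; ring.
Qed.
Lemma cexp0 : cexp 0 = 1.
Proof. by apply: complex_ext; rewrite /= expR0 ?cos0 ?sin0 ?mulr1 ?mulr0. Qed.
Lemma nrm_cexp z : nrm (cexp z) = expR (Re z).
Proof.
rewrite nrmE /= !exprMn -mulrDr cos2Dsin2 mulr1 sqrtr_sqr ger0_norm //.
Qed.
Lemma cexpMn z n : cexp (z *+ n) = cexp z ^+ n.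
Proof. by elim: n => [|n IH]; rewrite ?mulr0n ?cexp0 ?expr0 // mulrS cexpD IH exprS. Qed.
Lemma cexp_neq0 z : cexp z != 0.
Proof.
apply/eqP => h; have := nrm_cexp z; rewrite h nrm0 => /esym/eqP.
by rewrite expR_eq0.
Qed.
Lemma cexpN z : cexp (- z) = (cexp z)^-1.
Proof. by apply: (mulIf (cexp_neq0 z)); rewrite -cexpD addNr cexp0 mulVf // cexp_neq0. Qed.

Definition ee z : C := cexp (2%:R * (pi : R)%:C * 'i * z).

Lemma ReIpi z : Re (2%:R * (pi : R)%:C * 'i * z) = - (2 * pi * Im z).
Proof. by case: z => a b; rewrite -(rmorph_nat (real_complex R)) /=; ring. Qed.
Lemma ImIpi z : Im (2%:R * (pi : R)%:C * 'i * z) = 2 * pi * Re z.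
Proof. by case: z => a b; rewrite -(rmorph_nat (real_complex R)) /=; ring. Qed.

Lemma eeD z w : ee (z + w) = ee z * ee w.
Proof. by rewrite /ee mulrDr cexpD. Qed.
Lemma ee0 : ee 0 = 1. Proof. by rewrite /ee mulr0 cexp0. Qed.
Lemma ee_neq0 z : ee z != 0. Proof. exact: cexp_neq0. Qed.
Lemma eeN z : ee (- z) = (ee z)^-1. Proof. by rewrite /ee mulrN cexpN. Qed.
Lemma eeMn z n : ee (n%:R * z) = ee z ^+ n.
Proof. by rewrite mulr_natl /ee mulrnAr cexpMn. Qed.
Lemma ee1 : ee 1 = 1.
Proof.
rewrite /ee mulr1; apply: complex_ext; rewrite /cexp;
by rewrite -(rmorph_nat (real_complex R)) /= !(mul0r,mulr0,subr0,addr0,mulr1,add0r,oppr0,expR0,mul1r) mulr_natl ?cos2pi ?sin2pi.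
Qed.
Lemma ee_nat n : ee n%:R = 1.
Proof. by rewrite -[n%:R]mulr1 eeMn ee1 expr1n. Qed.
Lemma ee_int (k : int) : ee k%:~R = 1.
Proof. by case: k => n; rewrite ?NegzE ?mulrNz ?eeN -pmulrn ee_nat ?invr1. Qed.
Lemma nrm_ee z : nrm (ee z) = expR (- (2 * pi * Im z)).
Proof. by rewrite /ee nrm_cexp ReIpi. Qed.
Lemma nrm_ee_lt1 z : 0 < Im z -> nrm (ee z) < 1.
Proof.
move=> h; rewrite nrm_ee expR_lt1 oppr_lt0 !mulr_gt0 //; exact: pi_gt0.
Qed.
Lemma nrm_ee_real x : nrm (ee x%:C) = 1.
Proof. by rewrite nrm_ee /= mulr0 oppr0 expR0. Qed.

Lemma ee_real_neq1 x : 0 < x -> x < 1 -> ee x%:C != 1.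
Proof.
move=> x0 x1; apply/eqP => h.
have : Re (ee x%:C) = 1 by rewrite h.
rewrite /ee /cexp; have := ReIpi x%:C; have := ImIpi x%:C; rewrite /= => -> ->.
rewrite mulr0 oppr0 expR0 mul1r.
have -> : 2 * pi * x = (pi * x) *+ 2 by rewrite mulr2n; ring.
rewrite cos_mulr2n cos2sin2 mulr2n => hs.
have : 0 < sin (pi * x).
  by apply: sin_gt0_pi; rewrite mulr_gt0 ?pi_gt0 //= gtr_pMr // pi_gt0.
by nra.
Qed.

Lemma sin_le x : `|sin x| <= `|x|.
Proof.
wlog x0 : x / 0 < x.
  move=> h; have [x0|x0|<-] := ltgtP 0 x; first exact: h.
    by rewrite -normrN -sinN -(normrN x); apply: h; lra.
  by rewrite sin0.
have [y _] := @MVT_segment _ sin cos 0 x (ltW x0)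
  (fun y _ => is_derive_sin y) (continuous_subspaceT (@continuous_sin R)).
rewrite sin0 !subr0 => ->; rewrite normrM ler_piMl // cos_max //.
Qed.

Lemma cos_ge x : 1 - x ^+ 2 / 2 <= cos x.
Proof.
have -> : cos x = 1 - 2 * sin (x / 2) ^+ 2.
  have -> : cos x = cos ((x / 2) *+ 2) by congr cos; rewrite mulr2n; field.
  rewrite cos_mulr2n cos2sin2 mulr2n; ring.
have : sin (x / 2) ^+ 2 <= (x / 2) ^+ 2.
  by rewrite -(real_normK (num_real (sin _))) -(real_normK (num_real (x / 2))) lerXn2r ?nnegrE // sin_le.
have -> : (x / 2) ^+ 2 = x ^+ 2 / 4 by field.
by lra.
Qed.

Lemma sin_sub_le x : `|sin x - x| <= x ^+ 2.
Proof.
wlog x0 : x / 0 < x.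
  move=> h; have [x0|x0|<-] := ltgtP 0 x; first exact: h.
    by rewrite -normrN opprB addrC -[x in _ + x]opprK -sinN -sqrrN; apply: h; lra.
  by rewrite sin0 subrr normr0 expr0n.
have [y /andP[y0 yx]] := @MVT_segment _ sin cos 0 x (ltW x0)
  (fun y _ => is_derive_sin y) (continuous_subspaceT (@continuous_sin R)).
rewrite sin0 !subr0 => ->.
have -> : cos y * x - x = - ((1 - cos y) * x) by ring.
rewrite normrN normrM (gtr0_norm x0) expr2 ler_pM2r // ger0_norm ?subr_ge0 ?cos_le1 //.
have : y <= x by move: yx; rewrite bnd_simp.
have : 0 <= y by move: y0; rewrite bnd_simp.
have := cos_ge y; have := cos_geN1 y; have := cos_ge (y); nra.
Qed.

(** Everything follows from 1 + y <= exp y, used at y = x and y = -x. *)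
Lemma expR_sub_le x : `|expR x - 1 - x| <= x ^+ 2 * expR `|x|.
Proof.
have h1 : expR x - 1 - x <= x ^+ 2 * expR `|x|.
  have : 1 - x <= expR (- x) by have := expR_ge1Dx (- x); lra.
  have e0 := expR_gt0 x; have := expRxMexpNx_1 x => h h2.
  have h3 : expR x * (1 - x) <= 1 by nra.
  have h4 : expR x <= expR `|x| by rewrite ler_expR ler_norm.
  have [x0|x0] := leP 0 x.
    have h5 : expR x - 1 - x <= x * (expR x - 1) by nra.
    have h6 : expR x - 1 <= x * expR x by nra.
    rewrite (ger0_norm x0); nra.
  have h5 : expR x - 1 <= x * expR x by nra.
  have h6 : 1 + x <= expR x := expR_ge1Dx x.
  have h7 : 1 <= expR `|x| by rewrite -expR0 ler_expR.
  nra.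
have := expR_ge1Dx x => h2; rewrite ger0_norm //; lra.
Qed.

(** The real part contributes 1 and 1/2 to the constant and the imaginary part 1 and 1; the total is
    rounded up to 4. *)
Lemma cexp_sub1_le z : nrm (cexp z - 1 - z) <= 4 * nrm z ^+ 2 * expR (nrm z).
Proof.
case: z => a b; set z := a +i* b.
have ha : `|a| <= nrm z := Re_le_nrm z; have hb : `|b| <= nrm z := Im_le_nrm z.
have n0 := nrm_ge0 z.
have ea : expR `|a| <= expR (nrm z) by rewrite ler_expR.
have ea1 : expR a <= expR (nrm z) by rewrite ler_expR (le_trans (ler_norm a)).
have ep := expR_gt0 a; have ep' := expR_gt0 (nrm z).
have e1 : 1 <= expR (nrm z) by rewrite -expR0 ler_expR.
have s2 : a ^+ 2 + b ^+ 2 = nrm z ^+ 2 by rewrite sqr_nrm.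
have hexp := expR_sub_le a.
have hs := sin_sub_le b; have hc := cos_ge b; have hc1 := cos_le1 b.
apply: le_trans (nrm_le _) _; rewrite !(cReD,cImD,cReN,cImN) /=.
rewrite !oppr0 !addr0.
have -> : expR a * cos b - 1 - a = (expR a - 1 - a) - expR a * (1 - cos b) by ring.
have -> : expR a * sin b - b = expR a * (sin b - b) + (expR a - 1) * b by ring.
have k1 : `|expR a * (1 - cos b)| <= expR (nrm z) * (b ^+ 2 / 2).
  rewrite ger0_norm ?mulr_ge0 ?expR_ge0 ?subr_ge0 //; apply: ler_pM; rewrite ?expR_ge0 ?subr_ge0 //; lra.
have k2 : `|expR a * (sin b - b)| <= expR (nrm z) * b ^+ 2.
  by rewrite normrM ger0_norm ?expR_ge0 // ler_pM // expR_ge0.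
have k3 : `|expR a - 1| <= `|a| * expR (nrm z).
  have := expR_ge1Dx a; have := expR_ge1Dx (- a); rewrite expRN => q1 q2.
  have q3 : (1 - a) * expR a <= 1 by rewrite -ler_pdivlMr // mul1r.
  have := ler_norm a; have := ler_norm (- a); rewrite normrN.
  have := normr_ge0 a => ? ? ?; rewrite ler_norml; apply/andP; split; nra.
have k4 : `|(expR a - 1) * b| <= expR (nrm z) * (`|a| * `|b|).
  by rewrite normrM; apply: le_trans (ler_wpM2r (normr_ge0 b) k3) _; rewrite le_eqVlt; apply/orP; left; apply/eqP; ring.
have k5 : `|a| * `|b| <= nrm z ^+ 2 by rewrite expr2 ler_pM.
have k6 : a ^+ 2 * expR `|a| <= nrm z ^+ 2 * expR (nrm z).
  by apply: ler_pM; rewrite ?sqr_ge0 ?expR_ge0 // -s2 lerDl sqr_ge0.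
have k7 : b ^+ 2 <= nrm z ^+ 2 by rewrite -s2 lerDr sqr_ge0.
have k8 := ler_normB (expR a - 1 - a) (expR a * (1 - cos b)).
have k9 := ler_normD (expR a * (sin b - b)) ((expR a - 1) * b).
have k10 : expR (nrm z) * b ^+ 2 <= expR (nrm z) * nrm z ^+ 2 by rewrite ler_pM2l.
have k11 : expR (nrm z) * (`|a| * `|b|) <= expR (nrm z) * nrm z ^+ 2 by rewrite ler_pM2l.
have := mulr_ge0 (sqr_ge0 (nrm z)) (ltW ep'); lra.
Qed.

(** Two doublings of the angle 3/8, starting from the quadratic lower bound of the cosine, give
    cos(3/2) > 0. The numerical bound is used in [theta_bound]. *)
Lemma pi_gt3 : 3 < pi :> R.
Proof.
have c1 := cos_ge (3/8 : R).
have c2 : cos (3/4 : R) = 2 * cos (3/8) ^+ 2 - 1.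
  have -> : 3/4 = (3/8 : R) *+ 2 by rewrite mulr2n; field.
  by rewrite cos_mulr2n mulr2n; ring.
have c3 : cos (3/2 : R) = 2 * cos (3/4) ^+ 2 - 1.
  have -> : 3/2 = (3/4 : R) *+ 2 by rewrite mulr2n; field.
  by rewrite cos_mulr2n mulr2n; ring.
have c5 : 9/10 <= cos (3/8 : R) by lra.
have c6 : 929/1000 <= cos (3/8 : R) by lra.
have c7 : 72/100 <= cos (3/4 : R) by nra.
have c4 : 0 < cos (3/2 : R) by nra.
have := pi_ge2 R => p2.
have : 3/2 < (pi : R) / 2.
  rewrite -ltr_cos ?in_itv /=; try lra.
  by rewrite cos_pihalf.
lra.
Qed.

End Exponential.

(** * Power series on the unit disc *)

Section PowerSeries.
Variable R : realType.
Notation C := R[i].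
Implicit Types (c d : nat -> R) (t u : C) (r s : R).

(** Radius of convergence at least 1, expressed by bounded terms on every smaller circle;
    [good_geom] gains geometric decay by passing to a slightly larger radius. *)
Definition good c := forall r, 0 <= r -> r < 1 -> exists K : R, forall n, `|c n| * r ^+ n <= K.

Lemma mid_radius r : 0 <= r -> r < 1 -> exists rho s : R,
  [/\ 0 < rho < 1, 0 <= s < 1, r < rho & r = s * rho].
Proof.
move=> r0 r1; exists ((1 + r) / 2), (r / ((1 + r) / 2)); split; first lra.
- by rewrite divr_ge0 /=; [rewrite ltr_pdivrMr; lra|lra|lra].
- lra.
- by rewrite divfK //; apply/eqP; lra.
Qed.

Lemma good_geom c r : good c -> 0 <= r -> r < 1 ->
  exists K s : R, [/\ 0 <= K, 0 <= s, s < 1 & forall n, `|c n| * r ^+ n <= K * s ^+ n].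
Proof.
move=> gc r0 r1; have [rho [s [/andP[h0 h1] /andP[s0 s1] _ ->]]] := mid_radius r0 r1.
have [K hK] := gc rho (ltW h0) h1; exists K, s; split=> // [|n].
  by have := hK 0%N; apply: le_trans; rewrite expr0 mulr1.
by rewrite exprMn mulrCA mulrC ler_wpM2r ?exprn_ge0.
Qed.

Lemma goodD c d : good c -> good d -> good (fun n => c n + d n).
Proof.
move=> gc gd r r0 r1; have [K hK] := gc r r0 r1; have [L hL] := gd r r0 r1.
exists (K + L) => n; apply: le_trans (lerD (hK n) (hL n)).
by rewrite -mulrDl ler_wpM2r ?exprn_ge0 // ler_normD.
Qed.

Lemma goodZ (k : R) c : good c -> good (fun n => k * c n).
Proof.
move=> gc r r0 r1; have [K hK] := gc r r0 r1.
by exists (`|k| * K) => n; rewrite normrM -mulrA ler_wpM2l.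
Qed.

Lemma good_natM c : good c -> good (fun n => n%:R * c n).
Proof.
move=> gc r r0 r1; have [K [s [K0 s0 s1 h]]] := good_geom gc r0 r1.
exists (K * (1 - s)^-1) => n; rewrite normrM ger0_norm // -mulrA.
apply: le_trans (ler_wpM2l (ler0n _ _) (h n)) _.
by rewrite mulrCA ler_wpM2l // natX_le.
Qed.

Lemma null_powX k s : 0 <= s -> s < 1 -> null (fun n => n%:R ^+ k * s ^+ n).
Proof.
elim: k s => [|k IH] s s0 s1.
  by apply: null_le (null_geom s0 s1); exists 0%N => n _; rewrite expr0 mul1r ger0_norm ?exprn_ge0.
have [rho [q [/andP[h0 h1] /andP[k0 k1] _ ->]]] := mid_radius s0 s1.
apply: null_le (nullZ (1 - q)^-1 (IH rho (ltW h0) h1)).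
exists 0%N => n _; rewrite ger0_norm; last by rewrite mulr_ge0 ?exprn_ge0 ?mulr_ge0 // ltW.
have -> : n%:R ^+ k.+1 * (q * rho) ^+ n = (n%:R * q ^+ n) * (n%:R ^+ k * rho ^+ n).
  by rewrite exprS exprMn; ring.
by rewrite ler_wpM2r ?mulr_ge0 ?exprn_ge0 ?(ltW h0) // natX_le.
Qed.

Lemma null_natX s : 0 <= s -> s < 1 -> null (fun n => n%:R * s ^+ n).
Proof. by move=> s0 s1; apply: null_le (null_powX 1 s0 s1); exists 0%N => n _; rewrite expr1 ger0_norm ?mulr_ge0 ?exprn_ge0. Qed.

Definition conv c d n : R := \sum_(0 <= i < n.+1) c i * d (n - i)%N.

Lemma good_conv c d : good c -> good d -> good (conv c d).
Proof.
move=> gc gd r r0 r1; have [K [s [K0 s0 s1 h]]] := good_geom gc r0 r1.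
have [L hL] := gd r r0 r1.
have L0 : 0 <= L by have := hL 0%N; apply: le_trans; rewrite expr0 mulr1.
exists (K * (1 - s)^-1 * L) => n.
rewrite -(ger0_norm (exprn_ge0 n r0)) -normrM /conv mulr_suml.
apply: le_trans (ler_norm_sum _ _ _) _.
apply: (@le_trans _ _ (\sum_(0 <= i < n.+1) K * s ^+ i * L)).
  rewrite !big_nat; apply: ler_sum => i /andP[_ ilt].
  have -> : c i * d (n - i)%N * r ^+ n = (c i * r ^+ i) * (d (n - i)%N * r ^+ (n - i)).
    have -> : r ^+ n = r ^+ i * r ^+ (n - i) by rewrite -exprD subnKC.
    by ring.
  rewrite normrM; apply: ler_pM => //; rewrite normrM (ger0_norm (exprn_ge0 _ r0)) //.
rewrite -mulr_suml -mulr_sumr ler_wpM2r // ler_wpM2l //.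
by apply: le_trans (geom_sum_le 0 n.+1 s0 s1) _; rewrite expr0 mul1r.
Qed.

Definition undil p c n : R := if (p %| n)%N then c (n %/ p)%N else 0.
Definition shift m c n : R := if (n < m)%N then 0 else c (n - m)%N.

Lemma good_undil p c : (0 < p)%N -> good c -> good (undil p c).
Proof.
move=> p0 gc r r0 r1; have [K hK] := gc r r0 r1; exists K => n; rewrite /undil.
have K0 : 0 <= K by have := hK 0%N; apply: le_trans; rewrite expr0 mulr1.
case: ifP => _; last by rewrite normr0 mul0r.
apply: le_trans (hK (n %/ p)%N); rewrite ler_wpM2l //.
by apply: ler_wiXn2l => //; [exact: ltW|exact: leq_div].
Qed.

Lemma good_shift m c : good c -> good (shift m c).
Proof.
move=> gc r r0 r1; have [K hK] := gc r r0 r1; exists K => n; rewrite /shift.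
have K0 : 0 <= K by have := hK 0%N; apply: le_trans; rewrite expr0 mulr1.
case: ifP => _; first by rewrite normr0 mul0r.
apply: le_trans (hK (n - m)%N); rewrite ler_wpM2l //.
by apply: ler_wiXn2l => //; [exact: ltW|exact: leq_subr].
Qed.

Lemma good_dil p c : (0 < p)%N -> good c -> good (fun n => c (p * n)%N).
Proof.
move=> p0 gc r r0 r1.
(* Bernoulli's inequality gives x^p >= 1 - p (1 - x) = r, so growth at radius x controls the
   subsequence at radius r. *)
pose x := 1 - (1 - r) / p%:R.
have pp : 0 < p%:R :> R by rewrite ltr0n.
have x1 : x < 1 by rewrite /x gtrBl divr_gt0 // subr_gt0.
have x0 : 0 <= x.
  by rewrite subr_ge0 ler_pdivrMr // mul1r; apply: le_trans (_ : 1 <= _); [lra|rewrite ler1n].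
have hx : r <= x ^+ p.
  have bern : forall n, 1 - n%:R * (1 - x) <= x ^+ n.
    elim=> [|n IH]; first by rewrite mul0r subr0 expr0.
    rewrite exprS; apply: le_trans (ler_wpM2l x0 IH); rewrite -natr1.
    have : 0 <= n%:R * (1 - x) ^+ 2 by rewrite mulr_ge0 // sqr_ge0.
    rewrite expr2; lra.
  apply: le_trans (bern p); have -> : 1 - x = (1 - r) / p%:R by rewrite /x; ring.
  by rewrite mulrCA divff ?lt0r_neq0 // mulr1; lra.
have [K hK] := gc x x0 x1; exists K => n; apply: le_trans (hK (p * n)%N).
by rewrite ler_wpM2l // exprM lerXn2r ?nnegrE // exprn_ge0.
Qed.

Definition term c t n : C := (c n)%:C * t ^+ n.
(* The junk value 0 is taken when the series diverges. *)
Definition ev c t : C := xget 0 [set l | clim (psum (term c t)) l].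

Lemma nrm_term c t n : nrm (term c t n) = `|c n| * nrm t ^+ n.
Proof. by rewrite nrmM nrmR nrmX. Qed.

Lemma ev_eq c t l : clim (psum (term c t)) l -> ev c t = l.
Proof. move=> h; apply: (clim_unique _ h).
by have /(xgetPex 0) : exists l, [set l | clim (psum (term c t)) l] l by exists l. Qed.

Lemma evP c t : good c -> nrm t < 1 -> clim (psum (term c t)) (ev c t).
Proof.
move=> gc t1; have [K [s [K0 s0 s1 h]]] := good_geom gc (nrm_ge0 t) t1.
have h' n : nrm (term c t n) <= K * s ^+ n by rewrite nrm_term.
have [l hl] := geom_cvg s0 s1 h'.
by rewrite (ev_eq hl).
Qed.

Lemma ev_tail c t : good c -> nrm t < 1 -> exists K s : R,
  [/\ 0 <= K, 0 <= s, s < 1, forall n, nrm (term c t n) <= K * s ^+ n &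
      forall n, nrm (ev c t - psum (term c t) n) <= K * (s ^+ n / (1 - s))].
Proof.
move=> gc t1; have [K [s [K0 s0 s1 h]]] := good_geom gc (nrm_ge0 t) t1.
have h' n : nrm (term c t n) <= K * s ^+ n by rewrite nrm_term.
by exists K, s; split=> //; exact: clim_tail s0 s1 h' (evP gc t1).
Qed.

Lemma ev_bounded c r : good c -> 0 <= r -> r < 1 ->
  exists K, forall t, nrm t <= r -> nrm (ev c t) <= K.
Proof.
move=> gc r0 r1; have [K [s [K0 s0 s1 h]]] := good_geom gc r0 r1.
exists (K * (s ^+ 0 / (1 - s))) => t tr.
have h' n : nrm (term c t n) <= K * s ^+ n.
  rewrite nrm_term; apply: le_trans (h n); rewrite ler_wpM2l // lerXn2r ?nnegrE //.
  exact: nrm_ge0.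
have := clim_tail s0 s1 h' (evP gc (le_lt_trans tr r1)) 0%N.
by rewrite /psum big_geq // subr0.
Qed.

Lemma evD c d t : good c -> good d -> nrm t < 1 -> ev (fun n => c n + d n) t = ev c t + ev d t.
Proof.
move=> gc gd t1; apply: ev_eq; apply: eq_clim (climD (evP gc t1) (evP gd t1)) => n.
by rewrite /psum -big_split; apply: eq_bigr => i _; rewrite /term rmorphD mulrDl.
Qed.

Lemma evZ (k : R) c t : good c -> nrm t < 1 -> ev (fun n => k * c n) t = k%:C * ev c t.
Proof.
move=> gc t1; apply: ev_eq; apply: eq_clim (climZ k%:C (evP gc t1)) => n.
by rewrite /psum mulr_sumr; apply: eq_bigr => i _; rewrite /term rmorphM mulrA.
Qed.

Lemma psum_conv c d t N : psum (term (conv c d) t) N =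
  \sum_(0 <= i < N) term c t i * psum (term d t) (N - i).
Proof.
elim: N => [|N IH]; first by rewrite /psum !big_geq.
rewrite {1}/psum big_nat_recr //= -/(psum _ _) IH.
rewrite [RHS]big_nat_recr //=.
have -> : \sum_(0 <= i < N) term c t i * psum (term d t) (N.+1 - i) =
   \sum_(0 <= i < N) (term c t i * psum (term d t) (N - i) + term c t i * term d t (N - i)).
  rewrite !big_nat; apply: eq_bigr => i /andP[_ iN]; rewrite -mulrDr subSn; last exact: ltnW.
  by rewrite {1}/psum big_nat_recr.
rewrite big_split /= -addrA; congr (_ + _).
rewrite /term /conv rmorph_sum mulr_suml big_nat_recr //=; congr (_ + _).
  rewrite !big_nat; apply: eq_bigr => i /andP[_ iN].
  have -> : t ^+ N = t ^+ i * t ^+ (N - i) by rewrite -exprD subnKC // ltnW.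
  by rewrite rmorphM; ring.
by rewrite subnn subSnn /psum big_nat1 /term rmorphM expr0; ring.
Qed.

(** Row i of the truncated Cauchy product misses a tail of order s'^(N-i); all rows together miss
    O(N m^N), with m the larger of the two ratios. *)
Lemma ev_conv c d t : good c -> good d -> nrm t < 1 -> ev (conv c d) t = ev c t * ev d t.
Proof.
move=> gc gd t1.
have [K [s [K0 s0 s1 hc _]]] := ev_tail gc t1.
have [L [s' [L0 s'0 s'1 _ hd]]] := ev_tail gd t1.
pose m := Num.max s s'.
have m0 : 0 <= m by rewrite le_max s0.
have m1 : m < 1 by rewrite gt_max s1.
apply: ev_eq.
apply: (@clim_near _ _ (fun N => ev d t * psum (term c t) N)); last first.
  by rewrite mulrC; apply: climZ; exact: evP.
have h : null (fun n => K * L / (1 - s') * (n%:R * m ^+ n)) by apply: nullZ; exact: null_natX.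
apply: null_le h; exists 0%N => N _; rewrite ger0_norm ?nrm_ge0 //.
rewrite psum_conv mulrC /psum mulr_suml -sumrB.
apply: le_trans (nrm_sum _ _ _) _.
have -> : K * L / (1 - s') * (N%:R * m ^+ N) = \sum_(0 <= i < N) K * L / (1 - s') * m ^+ N.
  by rewrite big_mkord sumr_const card_ord -[RHS]mulr_natl; ring.
rewrite !big_nat; apply: ler_sum => i /andP[_ iN].
rewrite -mulrBr nrmM nrmBC.
apply: le_trans (ler_pM (nrm_ge0 _) (nrm_ge0 _) (hc i) (hd (N - i)%N)) _.
have e1 : s ^+ i <= m ^+ i by rewrite lerXn2r ?nnegrE // le_max lexx.
have e2 : s' ^+ (N - i) <= m ^+ (N - i) by rewrite lerXn2r ?nnegrE // le_max lexx orbT.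
have -> : m ^+ N = m ^+ i * m ^+ (N - i) by rewrite -exprD subnKC // ltnW.
have -> : K * s ^+ i * (L * (s' ^+ (N - i) / (1 - s'))) =
  K * L / (1 - s') * (s ^+ i * s' ^+ (N - i)) by ring.
rewrite ler_wpM2l ?ler_pM ?exprn_ge0 //.
by rewrite divr_ge0 ?mulr_ge0 // subr_ge0 ltW.
Qed.

Lemma ev_shift m c t : good c -> nrm t < 1 -> ev (shift m c) t = t ^+ m * ev c t.
Proof.
move=> gc t1; have := evP (good_shift m gc) t1 => /(clim_sub (fun n => leq_addl m n)) h.
apply: (clim_unique h); apply: eq_clim (climZ (t ^+ m) (evP gc t1)) => n /=; symmetry.
rewrite /psum (big_cat_nat (leq0n m) (leq_addr n m)) /= big_nat big1 ?add0r; last first.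
  by move=> i /andP[_ im]; rewrite /term /shift im rmorph0 mul0r.
have -> : \sum_(m <= i < m + n) term (shift m c) t i = \sum_(0 + m <= i < m + n) term (shift m c) t i by [].
rewrite big_addn addKn mulr_sumr; apply: eq_bigr => i _.
by rewrite /term /shift ltnNge leq_addl addnK exprD; ring.
Qed.

Lemma sum_blocks (V : nmodType) (f : nat -> V) p N :
  \sum_(0 <= n < p * N) f n = \sum_(0 <= k < N) \sum_(0 <= j < p) f (p * k + j)%N.
Proof.
elim: N => [|N IH]; first by rewrite muln0 !big_geq.
rewrite big_nat_recr //= -IH mulnS addnC (big_cat_nat (leq0n (p * N)) (leq_addr p _)) /=.
congr (_ + _); rewrite -{1}[(p * N)%N]add0n big_addn addKn.
by apply: eq_bigr => j _; rewrite addnC.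
Qed.

Lemma sum_blocks0 (V : nmodType) (f : nat -> V) p N : (0 < p)%N ->
  (forall n, ~~ (p %| n)%N -> f n = 0) ->
  \sum_(0 <= n < p * N) f n = \sum_(0 <= k < N) f (p * k)%N.
Proof.
move=> p0 h; rewrite sum_blocks; apply: eq_bigr => k _.
rewrite big_ltn // addn0 big_nat big1 ?addr0 // => j /andP[j0 jp]; apply: h.
by rewrite dvdn_addr ?dvdn_mulr // gtnNdvd.
Qed.

Lemma leq_pmul p n : (0 < p)%N -> (n <= p * n)%N. Proof. exact: leq_pmull. Qed.

Lemma ev_undil p c t : (0 < p)%N -> good c -> nrm t < 1 -> ev (undil p c) t = ev c (t ^+ p).
Proof.
move=> p0 gc t1; have := evP (good_undil p0 gc) t1 => /(clim_sub (fun n => leq_pmul n p0)) h.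
have tp : nrm (t ^+ p) < 1 by rewrite nrmX exprn_ilt1 ?nrm_ge0 // -lt0n.
apply: (clim_unique h); apply: eq_clim (evP gc tp) => n /=; symmetry.
rewrite /psum sum_blocks0 //; last first.
  by move=> m /negbTE pm; rewrite /term /undil pm rmorph0 mul0r.
by apply: eq_bigr => k _; rewrite /term /undil dvdn_mulr // mulKn // exprM.
Qed.

Lemma root_sum (M j : nat) : (0 < M)%N ->
  \sum_(0 <= b < M) ee (j%:R / M%:R : C) ^+ b = if (M %| j)%N then M%:R else 0.
Proof.
move=> M0; have Mn : M%:R != 0 :> C by rewrite pnatr_eq0 -lt0n.
set w := ee _.
have wj : w = ee (((j %% M)%:R / M%:R : R)%:C).
  rewrite /w {1}(divn_eq j M) natrD mulrDl natrM mulfK // eeD ee_nat mul1r.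
  by rewrite rmorphM fmorphV !rmorph_nat.
have wM : w ^+ M = 1 by rewrite /w -eeMn mulrCA divff // mulr1 ee_nat.
case: ifP => h.
  have -> : w = 1 by rewrite wj (eqP h) mul0r ee0.
  under eq_bigr do rewrite expr1n.
  by rewrite big_mkord sumr_const card_ord.
have w1 : w != 1.
  have MR : 0 < M%:R :> R by rewrite ltr0n.
  rewrite wj; apply: ee_real_neq1; first by rewrite divr_gt0 // ltr0n lt0n -/(dvdn M j) h.
  by rewrite ltr_pdivrMr // mul1r ltr_nat ltn_mod.
have : (w - 1) * \sum_(0 <= b < M) w ^+ b = 0 by rewrite big_mkord -subrX1 wM subrr.
by move/eqP; rewrite mulf_eq0 subr_eq0 (negbTE w1) => /eqP.
Qed.

(** The root e(2/p) appears because translating z by 24 b before dividing by p multiplies t by e(24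
    b / (12 p)); it is primitive as p is odd. *)
Lemma ev_root_sum p c t : (0 < p)%N -> odd p -> good c -> nrm t < 1 ->
  \sum_(0 <= b < p) ev c (t * ee (2%:R / p%:R) ^+ b) = p%:R * ev (fun n => c (p * n)%N) (t ^+ p).
Proof.
move=> p0 po gc t1; set w := ee _.
have pR : 0 < p%:R :> R by rewrite ltr0n.
have nw : nrm w = 1.
  by rewrite /w -[2%:R](rmorph_nat (real_complex R)) -[p%:R](rmorph_nat (real_complex R)) -fmorphV -rmorphM nrm_ee_real.
have tb b : nrm (t * w ^+ b) < 1 by rewrite nrmM nrmX nw expr1n mulr1.
have tp : nrm (t ^+ p) < 1 by rewrite nrmX exprn_ilt1 ?nrm_ge0 // -lt0n.
have h1 : clim (fun N => \sum_(0 <= b < p) psum (term c (t * w ^+ b)) N)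
    (\sum_(0 <= b < p) ev c (t * w ^+ b)).
  elim: (p) => [|k IH]; first by rewrite big_geq //; apply: eq_clim (clim_cst _) => n; rewrite big_geq.
  rewrite big_nat_recr //=; apply: eq_clim (climD IH (evP gc (tb k))) => n.
  by rewrite big_nat_recr.
apply: (clim_unique (clim_sub (fun n => leq_pmul n p0) h1)).
apply: eq_clim (climZ _ (evP (good_dil p0 gc) tp)) => N /=; symmetry.
rewrite /psum exchange_big /= (eq_bigr (fun n => if (p %| n)%N then p%:R * term c t n else 0)).
  rewrite sum_blocks0 //; last by move=> n /negbTE ->.
  by rewrite mulr_sumr; apply: eq_bigr => k _; rewrite dvdn_mulr // /term exprM.
move=> n _; transitivity (term c t n * \sum_(0 <= b < p) ee ((2 * n)%:R / p%:R) ^+ b).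
  rewrite mulr_sumr; apply: eq_bigr => b _; rewrite /term exprMn -exprM mulrA; congr (_ * _).
  by rewrite -eeMn -eeMn; congr ee; rewrite !natrM; ring.
by rewrite root_sum // Gauss_dvdr ?coprimen2 //; case: ifP => _; rewrite ?mulr0 // mulrC.
Qed.

(* Averaging over the M-th roots of unity isolates one coefficient of a partial sum. *)
Lemma coef_bound c t B n : good c -> nrm t < 1 ->
  (forall x : R, nrm (ev c (t * ee x%:C)) <= B) -> `|c n| * nrm t ^+ n <= B.
Proof.
move=> gc t1 hB; have [K [s [K0 s0 s1 h]]] := good_geom gc (nrm_ge0 t) t1.
apply: (null_le_lim (b := fun N => K / (1 - s) * s ^+ (N + n.+1)%N)).
  apply: null_le (nullZ (K / (1 - s)) (null_geom s0 s1)).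
  exists 0%N => N _; rewrite ger0_norm; last by rewrite mulr_ge0 ?exprn_ge0 ?divr_ge0 // subr_ge0 ltW.
  rewrite ler_wpM2l ?divr_ge0 ?subr_ge0 ?(ltW s1) //.
  by apply: ler_wiXn2l => //; [exact: ltW|exact: leq_addr].
move=> N0; set N := (N0 + n.+1)%N.
have nN : (n < N)%N by rewrite /N addnS ltnS leq_addl.
have N1 : (0 < N)%N by exact: leq_ltn_trans nN.
have NC : N%:R != 0 :> C by rewrite pnatr_eq0 -lt0n.
pose w : C := ee (1 / N%:R).
have tb b : nrm (psum (term c (t * w ^+ b)) N) <= B + K / (1 - s) * s ^+ N.
  have wb : w ^+ b = ee ((b%:R / N%:R : R)%:C).
    by rewrite /w -eeMn rmorphM fmorphV !rmorph_nat; congr ee; ring.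
  have nt : nrm (t * w ^+ b) = nrm t by rewrite nrmM wb nrm_ee_real mulr1.
  have h' k : nrm (term c (t * w ^+ b) k) <= K * s ^+ k by rewrite nrm_term nt.
  apply: le_trans (nrm_dist _ (ev c (t * w ^+ b))) _; apply: lerD.
    by rewrite wb.
  rewrite nrmBC; apply: le_trans (clim_tail s0 s1 h' (evP gc _) N) _; first by rewrite nt.
  by rewrite mulrCA mulrC.
have key : \sum_(0 <= b < N) psum (term c (t * w ^+ b)) N * w ^+ (b * (N - n)) = N%:R * term c t n.
  transitivity (\sum_(0 <= k < N) term c t k * \sum_(0 <= b < N) ee ((k + (N - n))%:R / N%:R) ^+ b).
    under [RHS]eq_bigr do rewrite mulr_sumr.
    rewrite [RHS]exchange_big /=; apply: eq_bigr => b _; rewrite /psum mulr_suml.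
    apply: eq_bigr => k _; rewrite /term exprMn -!mulrA; congr (_ * (_ * _)).
    rewrite /w -exprM -exprD -!eeMn; congr ee; rewrite !(natrD,natrM); ring.
  rewrite (bigD1_seq n) ?mem_index_iota ?iota_uniq //= [X in _ + X]big_nat_cond [X in _ + X]big1.
    by rewrite addr0 subnKC ?(ltnW nN) // root_sum // dvdnn mulrC.
  move=> k /andP[/andP[_ kN] kn]; rewrite root_sum // ifF ?mulr0 //.
  apply/negP => /dvdnP[q hq]; move: kn => /eqP; apply.
  have q1 : q = 1%N by nia.
  by rewrite q1 in hq; lia.
have : nrm (N%:R * term c t n) <= N%:R * (B + K / (1 - s) * s ^+ N).
  rewrite -key; apply: le_trans (nrm_sum _ _ _) _.
  have -> : N%:R * (B + K / (1 - s) * s ^+ N) = \sum_(0 <= b < N) (B + K / (1 - s) * s ^+ N).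
    by rewrite big_mkord sumr_const card_ord mulr_natl.
  apply: ler_sum => b _; rewrite nrmM nrmX.
  have -> : nrm w = 1.
    rewrite /w -[N%:R](rmorph_nat (real_complex R)) -fmorphV mul1r nrm_ee_real //.
  by rewrite expr1n mulr1.
rewrite nrmM nrm_nat ler_pM2l ?ltr0n // nrm_term.
by apply.
Qed.

(** Multiplying t by exp(u) corresponds to translating z. The remainder is estimated term by term
    with [cexp_sub1_le] at n u, which costs the coefficients n^2 c_n at a slightly larger radius. *)
Lemma ev_taylor c r : good c -> 0 <= r -> r < 1 -> exists K del : R, [/\ 0 <= K, 0 < del &
  forall t u, nrm t <= r -> nrm u <= del ->
    nrm (ev c (t * cexp u) - ev c t - u * ev (fun n => n%:R * c n) t) <= K * nrm u ^+ 2].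
Proof.
move=> gc r0 r1; have [rho [q [/andP[h0 h1] /andP[q0 q1] rr req]]] := mid_radius r0 r1.
have g2 := good_natM (good_natM gc).
have [K [s [K0 s0 s1 h]]] := good_geom g2 (ltW h0) h1.
(* For |u| <= (1 - q)/2 one has exp(-|u|) >= 1 - |u| >= q, so t exp(u) stays within radius rho. *)
exists (4 * (K / (1 - s))), ((1 - q) / 2); split; [by rewrite mulr_ge0 // divr_ge0 // subr_ge0 ltW|lra|].
move=> t u tr ud.
have eu : r * expR (nrm u) <= rho.
  have := expR_ge1Dx (- nrm u); rewrite expRN => k1.
  have e0 := expR_gt0 (nrm u).
  have k2 : q * expR (nrm u) <= 1.
    by rewrite -ler_pdivlMr // mul1r; apply: le_trans k1; lra.
  by rewrite req mulrAC -[leRHS]mul1r ler_pM2r.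
have t1 : nrm t < 1 := le_lt_trans tr r1.
have t2 : nrm (t * cexp u) < 1.
  rewrite nrmM nrm_cexp; apply: le_lt_trans h1; apply: le_trans eu.
  apply: ler_pM => //; rewrite ?nrm_ge0 ?expR_ge0 // ler_expR.
  exact: le_trans (ler_norm _) (Re_le_nrm _).
have := climD (evP gc t2) (climZ (-1) (climD (evP gc t1) (climZ u (evP (good_natM gc) t1)))).
set l := (X in clim _ X -> _) => hl.
have -> : ev c (t * cexp u) - ev c t - u * ev (fun n => n%:R * c n) t = l.
  by rewrite /l mulN1r opprD addrA.
apply: (clim_nrm_le hl) => n.
have -> : psum (term c (t * cexp u)) n + -1 * (psum (term c t) n + u * psum (term (fun n0 : nat => n0%:R * c n0) t) n)
   = \sum_(0 <= k < n) term c t k * (cexp (u *+ k) - 1 - u *+ k).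
  rewrite /psum !mulr_sumr -big_split /= mulr_sumr -big_split /=; apply: eq_bigr => k _.
  rewrite /term cexpMn exprMn rmorphM rmorph_nat -[u *+ k]mulr_natl; ring.
apply: le_trans (nrm_sum _ _ _) _.
apply: (@le_trans _ _ (\sum_(0 <= k < n) 4 * nrm u ^+ 2 * (K * s ^+ k))).
  apply: ler_sum => k _; rewrite nrmM nrm_term.
  have nuk : nrm (u *+ k) = k%:R * nrm u by rewrite -[u *+ k]mulr_natl nrmM nrm_nat.
  apply: le_trans (ler_wpM2l _ (cexp_sub1_le _)) _; first by rewrite mulr_ge0 // exprn_ge0 // nrm_ge0.
  rewrite nuk expRM_natl.
  have -> : `|c k| * nrm t ^+ k * (4 * (k%:R * nrm u) ^+ 2 * expR (nrm u) ^+ k) =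
     4 * nrm u ^+ 2 * (`|k%:R * (k%:R * c k)| * (nrm t * expR (nrm u)) ^+ k).
    by rewrite !normrM (ger0_norm (ler0n R k)) !exprMn; ring.
  apply: ler_wpM2l; first by rewrite mulr_ge0 ?sqr_ge0.
  apply: le_trans (h k); apply: ler_wpM2l => //.
  apply: lerXn2r; rewrite ?nnegrE ?mulr_ge0 ?nrm_ge0 ?expR_ge0 ?(ltW h0) //.
  by apply: le_trans eu; rewrite ler_wpM2r // expR_ge0.
rewrite -!mulr_sumr.
have hg : \sum_(0 <= i < n) s ^+ i <= (1 - s)^-1.
  by apply: le_trans (geom_sum_le 0 n s0 s1) _; rewrite expr0 mul1r.
have -> : 4 * (K / (1 - s)) * nrm u ^+ 2 = 4 * nrm u ^+ 2 * (K * (1 - s)^-1) by ring.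
by apply: ler_wpM2l; [rewrite mulr_ge0 ?sqr_ge0|exact: ler_wpM2l].
Qed.

End PowerSeries.

(** * Lipschitz's formula *)

Section Lipschitz.
Variable R : realType.
Notation C := R[i].
Implicit Types (u v w z : C).

(* Closed form of the sum of 1/(w + k)^2 over all integers k. *)
Definition lips w : C := - (4 * pi ^+ 2 : R)%:C * (ee w / (1 - ee w) ^+ 2).

Lemma ee_half : ee (1 / 2%:R : C) = -1.
Proof.
have e : ee (1 / 2%:R : C) = cexp (0 +i* (pi : R)).
  rewrite /ee; congr cexp; apply: (mulIf (x := 2%:R)); first by rewrite pnatr_eq0.
  have h : (1 / 2%:R : C) * 2%:R = 1 by rewrite divfK // pnatr_eq0.
  rewrite -[LHS]mulrA h mulr1 -[2%:R](rmorph_nat (real_complex R)); apply: complex_ext; rewrite !(cReM, cImM) /=; ring.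
by rewrite e; apply: complex_ext; rewrite /cexp /= expR0 ?cospi ?sinpi ?mulr0 ?mul1r ?oppr0.
Qed.

(** With y = e(w/2) this is 4 y^2/(1 - y^2)^2 = y/(1 - y)^2 - y/(1 + y)^2. *)
Lemma lips_dup w : ee w != 1 -> lips w = (lips (w / 2%:R) + lips ((w + 1) / 2%:R)) / 4%:R.
Proof.
move=> h; rewrite /lips; set y := ee (w / 2%:R).
have n2 : 2%:R != 0 :> C by rewrite pnatr_eq0.
have -> : ee ((w + 1) / 2%:R) = - y by rewrite mulrDl eeD ee_half mulrN1.
have yy : ee w = y ^+ 2 by rewrite /y -eeMn mulrC divfK.
rewrite yy in h *.
have h1 : 1 - y != 0 by apply: contra h; rewrite subr_eq0 => /eqP <-; rewrite expr1n.
have h2 : 1 + y != 0 by apply: contra h; rewrite addrC addr_eq0 => /eqP ->; rewrite sqrrN expr1n.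
have h3 : 1 - y ^+ 2 != 0 by rewrite subr_eq0 eq_sym.
by field; rewrite ?opprK ?h1 ?h2 ?h3.
Qed.

Lemma lips_period w (k : int) : lips (w + k%:~R) = lips w.
Proof. by rewrite /lips eeD ee_int mulr1. Qed.

Lemma lips_even w : ee w != 1 -> lips (- w) = lips w.
Proof.
move=> h; rewrite /lips eeN; congr (_ * _).
have h0 := ee_neq0 w; have h3 : 1 - ee w != 0 by rewrite subr_eq0 eq_sym.
by field; rewrite h0 h3 subr_eq0 h.
Qed.

Lemma lips_sum w n : ee w != 1 ->
  lips w = (\sum_(0 <= k < 2 ^ n) lips ((w + k%:R) / 2%:R ^+ n)) / 4%:R ^+ n.
Proof.
move=> h; have n2 k : 2%:R ^+ k != 0 :> C by rewrite expf_neq0 // pnatr_eq0.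
elim: n => [|n IH]; first by rewrite expn0 big_nat1 !expr0 !divr1 addr0.
rewrite {1}IH expnS mul2n -addnn (big_cat_nat (leq0n _) (leq_addr (2 ^ n) _)) /=.
have -> : \sum_(2 ^ n <= i < 2 ^ n + 2 ^ n) lips ((w + i%:R) / 2%:R ^+ n.+1) =
  \sum_(0 + 2 ^ n <= i < 2 ^ n + 2 ^ n) lips ((w + i%:R) / 2%:R ^+ n.+1) by [].
rewrite big_addn addnK -big_split /= [4%:R ^+ n.+1]exprS invfM mulrA; congr (_ / _).
rewrite mulr_suml; apply: eq_bigr => k _.
have -> : (w + k%:R) / 2%:R ^+ n.+1 = ((w + k%:R) / 2%:R ^+ n) / 2%:R.
  by rewrite exprSr invfM mulrA.
have -> : (w + (k + 2 ^ n)%:R) / 2%:R ^+ n.+1 = ((w + k%:R) / 2%:R ^+ n + 1) / 2%:R.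
  by rewrite exprSr invfM mulrA natrD natrX addrA (mulrDl (w + _)) divff.
apply: lips_dup; apply: contra h => /eqP h1.
have : ee (2%:R ^+ n * ((w + k%:R) / 2%:R ^+ n)) = 1 by rewrite -[X in X * _]natrX eeMn h1 expr1n.
by rewrite mulrC divfK // eeD ee_nat mulr1 => ->.
Qed.

(** The upper half of the range is moved by the period 1 to negative k; for large m all arguments
    then lie in the region of [lips_bound]. *)
Lemma lips_sum2 w m : ee w != 1 -> lips w =
  (\sum_(0 <= j < 2 ^ m) (lips ((w + j%:R) / 2%:R ^+ m.+1) + lips ((w - j.+1%:R) / 2%:R ^+ m.+1)))
   / 4%:R ^+ m.+1.
Proof.
move=> h; rewrite {1}(lips_sum m.+1 h); congr (_ / _).
rewrite expnS mul2n -addnn (big_cat_nat (leq0n _) (leq_addr (2 ^ m) _)) /= big_split /=.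
congr (_ + _).
have -> : \sum_(2 ^ m <= i < 2 ^ m + 2 ^ m) lips ((w + i%:R) / 2%:R ^+ m.+1) =
  \sum_(0 + 2 ^ m <= i < 2 ^ m + 2 ^ m) lips ((w + i%:R) / 2%:R ^+ m.+1) by [].
rewrite big_addn addnK big_nat_rev /= add0n !big_nat; apply: eq_bigr => k /andP[_ kl].
rewrite -[RHS](lips_period _ 1); congr lips.
have n2 : 2%:R ^+ m.+1 != 0 :> C by rewrite expf_neq0 // pnatr_eq0.
apply: (mulIf n2); rewrite divfK // mulrDl divfK // mul1r.
have -> : (2 ^ m - k.+1 + 2 ^ m)%N = (2 ^ m.+1 - k.+1)%N by rewrite expnS; lia.
rewrite natrB ?natrX; first ring.
by rewrite expnS; lia.
Qed.

(** With x = |exp v| and s = sin(pi/4) one has cos(Im v) >= -s, so the squared norm is at least (x -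
    s)^2 + 1 - s^2 >= 1/2. *)
Lemma cexp1_lb v : `|Im v| <= 3 / 4 * pi -> 1 / 2 <= nrm (cexp v + 1).
Proof.
move=> hb; set b := Im v; have p0 := pi_gt0 R.
have ck : sin (pi / 4 : R) ^+ 2 = 1 / 2.
  have : cos ((pi / 4 : R) *+ 2) = 0.
    have -> : (pi / 4 : R) *+ 2 = pi / 2 by rewrite mulr2n; field.
    exact: cos_pihalf.
  rewrite cos_mulr2n cos2sin2 mulr2n; lra.
have cb : - sin (pi / 4 : R) <= cos b.
  rewrite -cosDpihalf -(cos_norm b) leNgt; apply/negP.
  rewrite ltr_cos ?in_itv /= ?normr_ge0 /=; lra.
have e0 := expR_gt0 (Re v).
have sq : nrm (cexp v + 1) ^+ 2 = expR (Re v) ^+ 2 + 2 * expR (Re v) * cos b + 1.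
  rewrite sqr_nrm /cexp /= !addr0 -/b.
  by rewrite [(_ * sin b) ^+ 2]exprMn sin2cos2; ring.
have : (1 / 2) ^+ 2 <= nrm (cexp v + 1) ^+ 2.
  have k1 := sqr_ge0 (expR (Re v) - sin (pi / 4)).
  rewrite sq; nra.
by rewrite ler_pXn2r ?nnegrE ?nrm_ge0 //; lra.
Qed.

(** Repeated use of exp v - 1 = (exp(v/2) - 1)(exp(v/2) + 1); every halving keeps the imaginary part
    small enough for [cexp1_lb]. *)
Lemma expm1_lb m v : `|Im v| <= 3 / 2 * pi ->
  (1 / 2) ^+ m * nrm (cexp (v / 2%:R ^+ m) - 1) <= nrm (cexp v - 1).
Proof.
elim: m v => [|m IH] v hv; first by rewrite !expr0 divr1 mul1r.
have p0 := pi_gt0 R.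
have iv : Im (v / 2%:R) = Im v / 2.
  by rewrite -[2%:R](rmorph_nat (real_complex R)) -fmorphV cImM /=; ring.
have e : cexp v - 1 = (cexp (v / 2%:R) - 1) * (cexp (v / 2%:R) + 1).
  have -> : cexp v = cexp (v / 2%:R) ^+ 2 by rewrite -cexpMn -[_ *+ 2]mulr_natr divfK // pnatr_eq0.
  ring.
have h1 : 1 / 2 <= nrm (cexp (v / 2%:R) + 1).
  by apply: cexp1_lb; rewrite iv normrM normfV (ger0_norm (ler0n _ 2)); lra.
have h2 : (1 / 2) ^+ m * nrm (cexp (v / 2%:R / 2%:R ^+ m) - 1) <= nrm (cexp (v / 2%:R) - 1).
  apply: IH; rewrite iv normrM normfV (ger0_norm (ler0n _ 2)).
  by have := normr_ge0 (Im v); lra.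
rewrite e nrmM exprSr.
have -> : v / 2%:R ^+ m.+1 = v / 2%:R / 2%:R ^+ m by rewrite exprS invfM mulrA.
rewrite mulrAC; apply: ler_pM => //.
by apply: mulr_ge0; [apply: exprn_ge0; lra|exact: nrm_ge0].
Qed.

(** Put v = 2 pi i u and D = 2 sinh(v/2). Then lips u = -4 pi^2/D^2 and 1/u^2 = -4 pi^2/v^2, so it
    suffices that v - D = O(|v|^2) and |D| >= c |v|. *)
Lemma lips_bound : exists A : R, 0 <= A /\ forall u, `|Re u| <= 3 / 4 -> nrm u <= 2 -> u != 0 ->
  nrm (lips u - (u ^+ 2)^-1) <= A / nrm u.
Proof.
(* Eight halvings bring |v| <= 16 below 1/16, where |exp x - 1| >= |x|/2; they cost the first factor
   2^(-8). The factor exp(-8) bounds exp(-v/2). *)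
pose c : R := (1/2) ^+ 8 * (1 / (2 * 2 ^+ 8)) * expR (-8).
have c0 : 0 < c by rewrite /c !mulr_gt0 ?expR_gt0 ?exprn_gt0 ?invr_gt0 ?mulr_gt0 ?exprn_gt0 //; lra.
pose A : R := 4 * pi ^+ 2 * (2 * expR 8 * (c^-1 ^+ 2 + c^-1)) / (2 * pi).
have p0 := pi_gt0 R; have p4 : pi < 4 :> R by have := pihalf_lt2 R; lra.
exists A; split.
  have ci : 0 <= c^-1 by rewrite invr_ge0 ltW.
  rewrite /A; apply: divr_ge0; last by apply: mulr_ge0 => //; exact: ltW.
  apply: mulr_ge0; first by apply: mulr_ge0 => //; exact: sqr_ge0.
  apply: mulr_ge0; first by apply: mulr_ge0 => //; exact: expR_ge0.
  by apply: addr_ge0 => //; exact: sqr_ge0.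
move=> u hr hn u0; set v : C := 2%:R * (pi : R)%:C * 'i * u.
have nu : 0 < nrm u := nrm_gt0 u0.
have nv : nrm v = 2 * pi * nrm u.
  rewrite /v !nrmM nrm_nat nrmR gtr0_norm //; congr (_ * _).
  have -> : nrm ('i : C) = 1 by rewrite nrmE /= expr0n add0r expr1n sqrtr1.
  by rewrite mulr1.
have nv16 : nrm v <= 16 by rewrite nv; nra.
have v0 : v != 0 by apply/eqP => h; move: nv; rewrite h nrm0; nra.
have hiv : `|Im v| <= 3 / 2 * pi.
  by rewrite /v ImIpi normrM ger0_norm ?mulr_ge0 ?pi_ge0 //; nra.
pose D := cexp (v / 2%:R) - cexp (- (v / 2%:R)).
have n2 : 2%:R != 0 :> C by rewrite pnatr_eq0.
have vv : v / 2%:R + v / 2%:R = v by rewrite -mulr2n -[_ *+ 2]mulr_natr divfK.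
have eD : D = cexp (- (v / 2%:R)) * (cexp v - 1).
  rewrite /D -{4}vv mulrBr -cexpD mulr1 addrA addNr add0r //.
have nh : nrm (v / 2%:R) = nrm v / 2 by rewrite nrmf nrm_nat.
have lbD : c * nrm v <= nrm D.
  rewrite eD nrmM nrm_cexp.
  have k1 : expR (-8) <= expR (Re (- (v / 2%:R))).
    rewrite ler_expR cReN; have := Re_le_nrm (v / 2%:R); rewrite nh.
    have := ler_norm (Re (v / 2%:R)); lra.
  have k2 := expm1_lb 8 hiv.
  pose x := v / 2%:R ^+ 8.
  have nx : nrm x = nrm v / 2 ^+ 8 by rewrite /x nrmf nrmX nrm_nat.
  have k3 : nrm x / 2 <= nrm (cexp x - 1).
    have k4 := cexp_sub1_le x.
    have k5 : nrm x <= nrm (cexp x - 1) + nrm (cexp x - 1 - x).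
      have -> : nrm x = nrm ((cexp x - 1) - (cexp x - 1 - x)) by congr nrm; ring.
      exact: nrmB.
    have nx16 : nrm x <= 1 / 16 by rewrite nx ler_pdivrMr ?exprn_gt0 //; lra.
    have k6 : expR (nrm x) <= 2.
      have := expR_ge1Dx (- nrm x); rewrite expRN => q1.
      have q2 : (1 - nrm x) * expR (nrm x) <= 1 by rewrite -ler_pdivlMr ?expR_gt0 // mul1r.
      have := expR_gt0 (nrm x); have := nrm_ge0 x; nra.
    have := nrm_ge0 x; have := expR_gt0 (nrm x); nra.
  rewrite -/x in k2.
  have k7 : (1 / 2) ^+ 8 * (1 / (2 * 2 ^+ 8)) * nrm v <= nrm (cexp v - 1).
    apply: le_trans k2; rewrite -mulrA ler_pM2l ?exprn_gt0 //; last lra.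
  have -> : c * nrm v = expR (-8) * ((1 / 2) ^+ 8 * (1 / (2 * 2 ^+ 8)) * nrm v).
    by rewrite /c mulrAC mulrC.
  apply: ler_pM => //; apply: mulr_ge0; last exact: nrm_ge0.
  by apply: mulr_ge0; [apply: exprn_ge0|apply: divr_ge0 => //; apply: mulr_ge0]; lra.
have D0 : D != 0.
  apply/eqP => h; move: lbD; rewrite h nrm0 nv leNgt => /negP; apply.
  by rewrite !mulr_gt0.
have dDv : nrm (v - D) <= 2 * expR 8 * nrm v ^+ 2.
  have -> : v - D = (cexp (- (v / 2%:R)) - 1 - (- (v / 2%:R))) - (cexp (v / 2%:R) - 1 - v / 2%:R).
    by rewrite -{1}vv /D; ring.
  apply: le_trans (nrmB _ _) _.
  have h1 := cexp_sub1_le (- (v / 2%:R)); have h2 := cexp_sub1_le (v / 2%:R).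
  rewrite nrmN nh in h1; rewrite nh in h2.
  have h3 : expR (nrm v / 2) <= expR 8 by rewrite ler_expR; lra.
  have h4 : (nrm v / 2) ^+ 2 * expR (nrm v / 2) <= (nrm v / 2) ^+ 2 * expR 8.
    by rewrite ler_wpM2l ?sqr_ge0.
  have -> : 2 * expR 8 * nrm v ^+ 2 = 2 * (4 * ((nrm v / 2) ^+ 2 * expR 8)) by field.
  lra.
have n4 : 4%:R != 0 :> C by rewrite pnatr_eq0.
have pC : (pi : R)%:C != 0 by apply/eqP => /complexI h; move: p0; rewrite h ltxx.
have i2 : ('i : C) ^+ 2 = -1 by exact: sqr_i.
have key : lips u - (u ^+ 2)^-1 = - (4 * pi ^+ 2 : R)%:C * ((v - D) * (v + D) / (v ^+ 2 * D ^+ 2)).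
  have e1 : (u ^+ 2)^-1 = - (4 * pi ^+ 2 : R)%:C / v ^+ 2.
    have -> : v ^+ 2 = - (4 * pi ^+ 2 : R)%:C * u ^+ 2.
      rewrite /v !exprMn i2 rmorphM rmorphXn rmorph_nat; ring.
    rewrite [in RHS]invfM [RHS]mulVKf // oppr_eq0 rmorphM rmorphXn rmorph_nat.
    by rewrite mulf_neq0 // expf_neq0.
  have e2 : ee u / (1 - ee u) ^+ 2 = (D ^+ 2)^-1.
    rewrite eD {1 2}/ee -/v.
    have x0 := cexp_neq0 (v / 2%:R).
    have hx : cexp v = cexp (v / 2%:R) ^+ 2 by rewrite -cexpMn mulr2n vv.
    have hx1 : 1 - cexp v != 0.
      rewrite subr_eq0 eq_sym -subr_eq0; apply: contra D0 => /eqP h.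
      by rewrite eD h mulr0.
    rewrite cexpN hx in hx1 *; field.
    by rewrite x0 hx1 subr_eq0 eq_sym -subr_eq0 hx1.
  rewrite /lips e2 e1 -mulrBr; congr (_ * _); field.
  by rewrite v0 D0.
have p2 : 0 <= 4 * pi ^+ 2 :> R by apply: mulr_ge0 => //; exact: sqr_ge0.
rewrite key !nrmM nrmN nrmR nrmV nrmM !nrmX (ger0_norm p2).
have nv0 : 0 < nrm v by rewrite nv !mulr_gt0.
have nD0 : 0 < nrm D by rewrite nrm_gt0.
have -> : A / nrm u = 4 * pi ^+ 2 * (2 * expR 8 * (c^-1 ^+ 2 + c^-1) / nrm v).
  by rewrite /A nv [(2 * pi * nrm u)^-1]invfM !mulrA.
apply: ler_wpM2l => //.
have hvD : nrm (v + D) <= nrm v + nrm D := nrmD _ _.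
rewrite ler_pdivrMr ?mulr_gt0 ?exprn_gt0 //.
have cD : nrm v <= c^-1 * nrm D by rewrite mulrC ler_pdivlMr // mulrC.
have e8 := expR_gt0 (8 : R).
apply: le_trans (ler_pM (nrm_ge0 _) (nrm_ge0 _) dDv hvD) _.
have -> : 2 * expR 8 * (c^-1 ^+ 2 + c^-1) / nrm v * (nrm v ^+ 2 * nrm D ^+ 2) =
  2 * expR 8 * (nrm v * nrm D * ((c^-1 ^+ 2 + c^-1) * nrm D)) by field; rewrite !lt0r_neq0.
have ci : 0 < c^-1 by rewrite invr_gt0.
have m1 : nrm v * nrm v <= (c^-1 * nrm D) * (c^-1 * nrm D) by apply: ler_pM => //; exact: ltW.
have m2 : nrm v * nrm D <= (c^-1 * nrm D) * nrm D by apply: ler_wpM2r => //; exact: ltW.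
have -> : 2 * expR 8 * nrm v ^+ 2 * (nrm v + nrm D) = 2 * expR 8 * (nrm v * (nrm v * (nrm v + nrm D))) by ring.
apply: ler_wpM2l; first by apply: mulr_ge0 => //; exact: ltW.
rewrite -(mulrA (nrm v)); apply: ler_wpM2l; first exact: ltW.
have -> : nrm D * ((c^-1 ^+ 2 + c^-1) * nrm D) = (c^-1 * nrm D) * (c^-1 * nrm D) + (c^-1 * nrm D) * nrm D by ring.
by rewrite mulrDr; exact: lerD.
Qed.

End Lipschitz.

(** * The conditionally convergent double series of weight 2 *)

Section Eisenstein.
Variable R : realType.
Notation C := R[i].
Implicit Types (u v w z : C).

(** Positive distance from the integers. This admits real points such as 1/2, where Lipschitz's
    formula yields the sum over the odd squares. *)
Definition far w := exists2 y : R, 0 < y & forall k : int, y <= nrm (w + k%:~R).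

Lemma far_Im w : Im w != 0 -> far w.
Proof.
move=> h; exists `|Im w|; first by rewrite normr_gt0.
move=> k; have -> : Im w = Im (w + k%:~R); last exact: Im_le_nrm.
by rewrite cImD -(rmorph_int (real_complex R)) rcI addr0.
Qed.

Lemma far_lb w : far w -> exists2 B : R, 0 < B & forall j : nat,
  B * j.+1%:R <= nrm (w + j%:R) /\ B * j.+1%:R <= nrm (w - j.+1%:R).
Proof.
move=> [y y0 hy]; pose D := 1 + (1 + nrm w) / y.
have nw := nrm_ge0 w.
have D0 : 0 < D by rewrite /D addr_gt0 // divr_gt0 //; lra.
have key (x : C) (n : nat) : y <= nrm x -> n%:R <= 1 + nrm x + nrm w -> D^-1 * n%:R <= nrm x.
  move=> yx h; rewrite mulrC ler_pdivrMr // /D mulrDr mulr1.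
  have : 1 + nrm w <= nrm x * ((1 + nrm w) / y).
    rewrite mulrA ler_pdivlMr // mulrC; apply: ler_wpM2r => //; lra.
  lra.
exists D^-1; first by rewrite invr_gt0.
move=> j; split; apply: key.
- exact: (hy j).
- have := nrmB (w + j%:R) w; rewrite addrAC subrr add0r nrm_nat -natr1; lra.
- by have := hy (- (j.+1)%:Z); rewrite mulrNz.
- have := nrmB (w - j.+1%:R) w; rewrite addrAC subrr add0r nrmN nrm_nat; lra.
Qed.

Lemma harmonic2 m : \sum_(0 <= j < 2 ^ m) (j.+1%:R : R)^-1 <= m.+1%:R.
Proof.
elim: m => [|m IH]; first by rewrite expn0 big_nat1 invr1.
rewrite expnS mul2n -addnn (big_cat_nat (leq0n _) (leq_addr (2 ^ m) _)) /= -natr1.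
apply: lerD => //; apply: (@le_trans _ _ (\sum_(2 ^ m <= j < 2 ^ m + 2 ^ m) ((2 ^ m)%:R : R)^-1)).
  rewrite !big_nat; apply: ler_sum => j /andP[h _].
  by rewrite lef_pV2 ?posrE ?ltr0n ?expn_gt0 // ler_nat leqW.
rewrite sumr_const_nat addKn -[X in X <= _]mulr_natr mulVf // pnatr_eq0 expn_eq0 //.
Qed.

(** The sum of 1/(w + k)^2 over -N <= k < N, with k = j and k = -(j + 1) paired. *)
Definition sq2 N w : C := \sum_(0 <= j < N) (((w + j%:R) ^+ 2)^-1 + ((w - j.+1%:R) ^+ 2)^-1).

(* Iterating the duplication formula writes lips w as a mean of values at x/2^(m+1) for the x = w + k
   with -2^m <= k < 2^m, and lips u = 1/u^2 + O(1/|u|) near 0. *)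
Lemma lipschitz w : far w -> ee w != 1 -> clim (fun m => sq2 (2 ^ m) w) (lips w).
Proof.
move=> fw hw; have [A [A0 hA]] := lips_bound R; have [B B0 hB] := far_lb fw.
have bd : null (fun m => A / B * (m.+1%:R * (1/2) ^+ m)).
  apply: nullZ; have h := @null_powX R 1 (1/2) ltac:(lra) ltac:(lra).
  move=> e e0; have e2 : 0 < e / 2 by lra.
  have [N hN] := h _ e2; exists N => n Nn.
  have := hN n.+1 (leqW Nn); rewrite expr1 exprSr !normrM.
  have -> : `|1 : R| * `|2^-1| = 1/2 by rewrite normr1 (ger0_norm (_ : 0 <= 2^-1 :> R)) //; lra.
  by rewrite mulrA; lra.
(* From this m on, 2 |w| <= 2^m, so every x/2^(m+1) has norm at most 3/4. *)
apply: null_le bd; exists (Num.truncn (2 * nrm w)).+1 => m hm.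
rewrite ger0_norm ?nrm_ge0 //.
have n2 k : 2%:R ^+ k != 0 :> C by rewrite expf_neq0 // pnatr_eq0.
have P0 : 0 < 2 ^+ m :> R by rewrite exprn_gt0.
have w2 : 2 * nrm w <= 2 ^+ m.
  have : 2 * nrm w < (Num.truncn (2 * nrm w)).+1%:R by rewrite truncnS_gt.
  move/ltW/le_trans; apply; apply: le_trans (_ : m%:R <= _); first by rewrite ler_nat.
  by rewrite -natrX ler_nat ltnW // ltn_expl.
have small x (j : nat) : (j <= 2 ^ m)%N -> nrm x <= nrm w + j%:R -> nrm (x / 2%:R ^+ m.+1) <= 3/4.
  move=> jm h; rewrite nrmf nrmX nrm_nat ler_pdivrMr ?exprn_gt0 // exprS.
  have : j%:R <= 2 ^+ m :> R by rewrite -natrX ler_nat.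
  lra.
(* The error A/|u| is divided by 4^(m+1), while |u| = |x|/2^(m+1) and |x| >= B (j + 1). Summing over
   j then costs only the factor m + 1 of [harmonic2]. *)
have one x (j : nat) : (j < 2 ^ m)%N -> nrm x <= nrm w + j.+1%:R -> B * j.+1%:R <= nrm x ->
  nrm (lips (x / 2%:R ^+ m.+1) / 4%:R ^+ m.+1 - (x ^+ 2)^-1) <= A / B / 2 ^+ m.+1 * j.+1%:R^-1.
  move=> jm hx hxB; set u := x / _.
  have x0 : x != 0.
    by apply/eqP => x0; move: hxB; rewrite x0 nrm0 leNgt mulr_gt0 // ltr0n.
  have u0 : u != 0 by rewrite mulf_neq0 // invr_neq0.
  have us := small x j.+1 jm hx; rewrite -/u in us.
  have xu : x = u * 2%:R ^+ m.+1 by rewrite divfK.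
  have n4 : 4%:R ^+ m.+1 != 0 :> C by rewrite expf_neq0 // pnatr_eq0.
  have -> : lips u / 4%:R ^+ m.+1 - (x ^+ 2)^-1 = (lips u - (u ^+ 2)^-1) / 4%:R ^+ m.+1.
    have -> : 4%:R ^+ m.+1 = (2%:R ^+ m.+1) ^+ 2 :> C by rewrite exprAC; congr (_ ^+ _); rewrite -[RHS]natrX.
    have x2 : x ^+ 2 = u ^+ 2 * (2%:R ^+ m.+1) ^+ 2 by rewrite {1}xu exprMn.
    by rewrite x2 [(u ^+ 2 * _)^-1]invfM mulrBl.
  rewrite nrmf nrmX nrm_nat.
  have hu := hA u (le_trans (Re_le_nrm _) us) (le_trans us _) u0.
  have {}hu : nrm (lips u - (u ^+ 2)^-1) <= A / nrm u by apply: hu; lra.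
  have nu : 0 < nrm u by rewrite nrm_gt0.
  have nxu : nrm x = nrm u * 2 ^+ m.+1 by rewrite xu nrmM nrmX nrm_nat.
  have P1 : 0 < 2 ^+ m.+1 :> R by rewrite exprn_gt0.
  have -> : 4 ^+ m.+1 = 2 ^+ m.+1 * 2 ^+ m.+1 :> R by rewrite -exprMn; congr (_ ^+ _); lra.
  set P := 2 ^+ m.+1 in nxu P1 *.
  have J0 : 0 < B * j.+1%:R by rewrite mulr_gt0 // ltr0n.
  have nx0 : 0 < nrm x by rewrite nrm_gt0.
  have -> : A / B / P / j.+1%:R = A / P * (B * j.+1%:R)^-1 by rewrite [(B * _)^-1]invfM; ring.
  apply: le_trans (_ : A / P * (nrm x)^-1 <= _); last first.
    by apply: ler_wpM2l; [apply: divr_ge0 => //; exact: ltW|rewrite lef_pV2 ?posrE].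
  have -> : A / P * (nrm x)^-1 = A / nrm u / (P * P) by rewrite nxu !invfM; ring.
  by apply: ler_wpM2r => //; rewrite invr_ge0 mulr_ge0 // ltW.
rewrite nrmBC (lips_sum2 m hw) mulr_suml /sq2 -sumrB.
apply: le_trans (nrm_sum _ _ _) _.
apply: (@le_trans _ _ (\sum_(0 <= j < 2 ^ m) 2 * (A / B / 2 ^+ m.+1) * j.+1%:R^-1)).
  rewrite !big_nat; apply: ler_sum => j /andP[_ jm]; have [hB1 hB2] := hB j.
  rewrite mulrDl opprD addrACA; apply: le_trans (nrmD _ _) _.
  rewrite -mulrA mulr_natl mulr2n; apply: lerD; apply: one => //.
    by apply: le_trans (nrmD _ _) _; rewrite nrm_nat lerD2l ler_nat.
  by apply: le_trans (nrmB _ _) _; rewrite nrm_nat.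
rewrite -mulr_sumr.
have -> : A / B * (m.+1%:R * (1 / 2) ^+ m) = 2 * (A / B / 2 ^+ m.+1) * m.+1%:R.
  rewrite exprS mul1r exprVn; field; rewrite ?lt0r_neq0 //.
by apply: ler_wpM2l; [rewrite mulr_ge0 // !divr_ge0 ?exprn_ge0 // ltW|exact: harmonic2].
Qed.

Definition f2 w (k : nat) : C := ((w + k%:R) ^+ 2)^-1 + ((w - k%:R) ^+ 2)^-1.

(** [sq2] runs over -N <= k < N and the sum of [f2] over 0 < |k| <= N, hence the two boundary
    terms. *)
Lemma sum_f2 N w : \sum_(1 <= k < N.+1) f2 w k = sq2 N w - (w ^+ 2)^-1 + ((w + N%:R) ^+ 2)^-1.
Proof.
elim: N => [|N IH]; first by rewrite big_geq // /sq2 big_geq // addr0 add0r addNr.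
by rewrite big_nat_recr //= IH /sq2 big_nat_recr //= /f2; ring.
Qed.

Lemma sum_alt_even N (f : nat -> C) : \sum_(1 <= k < (2 * N).+1) (-1) ^+ k * f k =
    2%:R * (\sum_(1 <= k < N.+1) f (2 * k)%N) - \sum_(1 <= k < (2 * N).+1) f k.
Proof.
elim: N => [|N IH]; first by rewrite muln0 !big_geq // mulr0 subrr.
rewrite mulnS !add2n.
rewrite [LHS](@big_nat_recr _ _ _ (2 * N).+2) //= (@big_nat_recr _ _ _ (2 * N).+1) //= IH.
rewrite [in RHS](@big_nat_recr _ _ _ N.+1) //= [\sum_(1 <= k < _.+3) _](@big_nat_recr _ _ _ (2 * N).+2) //=.
rewrite [\sum_(1 <= k < _.+2) _](@big_nat_recr _ _ _ (2 * N).+1) //=.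
have -> : (2 * N).+2 = (2 * N.+1)%N by lia.
have -> : (-1) ^+ (2 * N).+1 = -1 :> C by rewrite exprS exprM sqrrN !expr1n mulr1.
have -> : (-1) ^+ (2 * N.+1) = 1 :> C by rewrite exprM sqrrN !expr1n.
by ring.
Qed.

Lemma sum_alt_f2 N w : \sum_(1 <= k < (2 * N).+1) (-1) ^+ k * f2 w k =
  2%:R^-1 * sq2 N (w / 2%:R) - sq2 (2 * N) w - (w ^+ 2)^-1 + ((w + (2 * N)%:R) ^+ 2)^-1.
Proof.
have n2 : 2%:R != 0 :> C by rewrite pnatr_eq0.
rewrite sum_alt_even !sum_f2.
have -> : \sum_(1 <= k < N.+1) f2 w (2 * k) = 4%:R^-1 * \sum_(1 <= k < N.+1) f2 (w / 2%:R) k.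
  rewrite mulr_sumr; apply: eq_bigr => k _; rewrite /f2 mulrDr -!invfM natrM; congr (_ ^-1 + _^-1).
    by rewrite -[w in LHS](divfK n2); ring.
  by rewrite -[w in LHS](divfK n2); ring.
rewrite sum_f2.
have -> : w + (2 * N)%:R = 2%:R * (w / 2%:R + N%:R) by rewrite natrM mulrDr [2%:R * (w / _)]mulrC divfK.
have -> : (w ^+ 2)^-1 = 4%:R^-1 * ((w / 2%:R) ^+ 2)^-1.
  by rewrite -invfM -{1}(divfK n2 w); congr (_^-1); ring.
have -> : (2%:R * (w / 2%:R + N%:R)) ^+ 2 = 4%:R * (w / 2%:R + N%:R) ^+ 2 by ring.
rewrite [(4%:R * _)^-1]invfM.
set a := ((_ + N%:R) ^+ 2)^-1; set b := ((_ / _) ^+ 2)^-1; set x := sq2 _ _; set y := sq2 _ _.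
by field.
Qed.

Lemma clim_sum (a b : nat) (u : nat -> nat -> C) (l : nat -> C) :
  (forall i, (a <= i < b)%N -> clim (u i) (l i)) ->
  clim (fun n => \sum_(a <= i < b) u i n) (\sum_(a <= i < b) l i).
Proof.
have [ab|ba] := leqP a b; last first.
  move=> _; rewrite big_geq ?(ltnW ba) //.
  by apply: eq_clim (clim_cst 0) => n; rewrite big_geq // ltnW.
elim: b ab => [|b IH] ab h.
  by rewrite big_geq //; apply: eq_clim (clim_cst 0) => n; rewrite big_geq.
have [->|ab'] := eqVneq a b.+1.
  by rewrite big_geq //; apply: eq_clim (clim_cst 0) => n; rewrite big_geq.
have ab2 : (a <= b)%N by lia.
rewrite big_nat_recr //=; apply: eq_clim (climD (IH ab2 _) (h b _)) => [n||].
- by rewrite big_nat_recr.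
- by move=> i /andP[h1 h2]; apply: h; rewrite h1 /=; lia.
- by rewrite ab2 /=.
Qed.

Lemma inv_far_null w : far w -> clim (fun m => ((w + (2 ^ m)%:R) ^+ 2)^-1) 0.
Proof.
move=> /far_lb[B B0 hB].
apply: (clim_le (b := fun m => B^-1 ^+ 2 * (1/2) ^+ m)); last first.
  by apply: nullZ; apply: null_geom; lra.
move=> m; rewrite subr0 nrmV nrmX; have [h _] := hB (2 ^ m)%N.
have P0 : 0 < 2 ^+ m :> R by rewrite exprn_gt0.
have P1 : 1 <= 2 ^+ m :> R by rewrite exprn_ege1 //; lra.
have h2 : B * 2 ^+ m <= nrm (w + (2 ^ m)%:R).
  by apply: le_trans h; rewrite ler_pM2l // -natrX ler_nat.
have n0 : 0 < nrm (w + (2 ^ m)%:R) by apply: lt_le_trans h2; rewrite mulr_gt0.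
have -> : B^-1 ^+ 2 * (1/2) ^+ m = (B ^+ 2 * 2 ^+ m)^-1.
  by rewrite invfM mul1r !exprVn.
rewrite lef_pV2 ?posrE ?exprn_gt0 ?mulr_gt0 ?exprn_gt0 //.
apply: le_trans (_ : (B * 2 ^+ m) ^+ 2 <= _).
  rewrite exprMn ler_pM2l ?exprn_gt0 // expr2 ler_peMl //; exact: ltW.
by rewrite lerXn2r ?nnegrE ?(ltW n0) // mulr_ge0 // ltW.
Qed.

Lemma clim_f2 w : far w -> ee w != 1 ->
  clim (fun m => \sum_(1 <= k < (2 ^ m).+1) f2 w k) (lips w - (w ^+ 2)^-1).
Proof.
move=> fw hw; have h := climD (climD (lipschitz fw hw) (clim_cst (- (w ^+ 2)^-1))) (inv_far_null fw).
by rewrite addr0 in h; apply: eq_clim h => m; rewrite sum_f2.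
Qed.

Lemma far_half w : far w -> far (w / 2%:R).
Proof.
move=> [y y0 hy]; exists (y / 2); first by lra.
move=> k; have n2 : 2%:R != 0 :> C by rewrite pnatr_eq0.
have -> : w / 2%:R + k%:~R = (w + (2 * k)%:~R) / 2%:R by rewrite mulrDl intrM mulrAC divff // mul1r.
by rewrite nrmf nrm_nat ler_pM2r ?invr_gt0.
Qed.

Lemma clim_alt_f2 w : far w -> ee w != 1 -> ee (w / 2%:R) != 1 ->
  clim (fun m => \sum_(1 <= k < (2 * 2 ^ m).+1) (-1) ^+ k * f2 w k)
    (2%:R^-1 * lips (w / 2%:R) - lips w - (w ^+ 2)^-1).
Proof.
move=> fw hw hw2.
have h1 := climZ 2%:R^-1 (lipschitz (far_half fw) hw2).
have h2 := climZ (-1) (clim_sub (leqnSn) (lipschitz fw hw)).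
have h3 := clim_sub (leqnSn) (inv_far_null fw).
have h := climD (climD (climD h1 h2) (clim_cst (- (w ^+ 2)^-1))) h3.
rewrite addr0 mulN1r in h; apply: eq_clim h => m /=.
by rewrite sum_alt_f2 -expnS mulN1r.
Qed.

Lemma null_contract (d e : nat -> R) : (forall m, 0 <= d m) -> null e ->
  (forall m, d m.+1 <= d m / 4 + e m) -> null d.
Proof.
move=> d0 ne h eps e0; have e4 : 0 < eps / 4 by lra.
have [N hN] := ne _ e4.
have key k : d (N + k)%N <= d N * (1/4) ^+ k + eps / 3.
  elim: k => [|k IH]; first by rewrite addn0 expr0 mulr1; lra.
  rewrite addnS exprSr; have := h (N + k)%N; have := hN (N + k)%N (leq_addr _ _).
  by have := ler_norm (e (N + k)%N); lra.
have [M hM] := nullZ (d N) (null_geom (r := 1/4 : R) ltac:(lra) ltac:(lra)) (ltac:(lra) : 0 < eps / 3).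
exists (N + M)%N => n hn; rewrite ger0_norm //.
have -> : n = (N + (n - N))%N by lia.
have := key (n - N)%N; have := hM (n - N)%N ltac:(lia); rewrite ger0_norm.
  lra.
by rewrite mulr_ge0 // exprn_ge0 //; lra.
Qed.

Definition zet N : C := \sum_(1 <= k < N.+1) ((k%:R : C) ^+ 2)^-1.

(** Lipschitz's formula at w = 1/2, where lips w = pi^2 and the series is 8 times the sum over odd
    squares. *)
Lemma clim_odd : clim (fun m => \sum_(0 <= j < 2 ^ m) (((2 * j).+1%:R : C) ^+ 2)^-1) (pi ^+ 2 / 8 : R)%:C.
Proof.
have n2 : 2%:R != 0 :> C by rewrite pnatr_eq0.
have fh : far (1 / 2%:R : C).
  exists (1/2); first lra.
  move=> k; have -> : 1 / 2%:R + k%:~R = (1/2 + k%:~R : R)%:C.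
    by rewrite rmorphD rmorph_int rmorphM fmorphV rmorph1 rmorph_nat.
  rewrite nrmR; have [k0|k0] := leP 0 k.
    have : 0 <= k%:~R :> R by rewrite ler0z.
    by move=> h; rewrite ger0_norm; lra.
  have : k%:~R <= -1 :> R by rewrite -[-1](mulrN1z) ler_int; lia.
  by move=> h; rewrite ler0_norm; lra.
have eh : ee (1 / 2%:R : C) != 1.
  rewrite ee_half; apply/eqP => h; have : Re (-1 : C) = 1 by rewrite h.
  by rewrite /=; lra.
have h := climZ (8%:R^-1) (lipschitz fh eh).
have e : 8%:R^-1 * lips (1 / 2%:R : C) = (pi ^+ 2 / 8 : R)%:C.
  rewrite /lips ee_half !rmorphM fmorphV ?rmorphXn !rmorph_nat opprK.
  by field.
rewrite e in h; apply: eq_clim h => m; rewrite /sq2 mulr_sumr; apply: eq_bigr => j _.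
have n2j : (2 * j).+1%:R != 0 :> C by rewrite pnatr_eq0.
have e1 : 1 / 2%:R + j%:R = (2 * j).+1%:R / 2%:R :> C by rewrite -[(2 * j).+1%:R]natr1 natrM; field.
have e2 : 1 / 2%:R - j.+1%:R = - ((2 * j).+1%:R / 2%:R) :> C by rewrite -[(2 * j).+1%:R]natr1 -[j.+1%:R]natr1 natrM; field.
by rewrite e1 e2 sqrrN; set a := (2 * j).+1%:R in n2j *; field.
Qed.

Lemma zet_rec m : zet (2 ^ m.+1) = \sum_(0 <= j < 2 ^ m) (((2 * j).+1%:R : C) ^+ 2)^-1 + 4%:R^-1 * zet (2 ^ m).
Proof.
rewrite expnS; elim: (2 ^ m)%N => [|N IH].
  by rewrite muln0 /zet !big_geq // mulr0 addr0.
rewrite /zet mulnS !add2n in IH *.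
rewrite [LHS](@big_nat_recr _ _ _ (2 * N).+2) //= (@big_nat_recr _ _ _ (2 * N).+1) //= IH.
rewrite [in RHS](@big_nat_recr _ _ _ N) //= [in RHS](@big_nat_recr _ _ _ N.+1) //=.
have -> : ((2 * N).+2%:R ^+ 2 : C)^-1 = 4%:R^-1 * (N.+1%:R ^+ 2)^-1.
  rewrite -invfM (_ : (2 * N).+2 = 2 * N.+1)%N; last lia.
  by rewrite natrM exprMn -[2%:R ^+ 2]natrX.
by ring.
Qed.

(** The even terms are a quarter of the whole sum, so by [zet_rec] the error contracts by 1/4 up to
    the error of the odd part. *)
Lemma clim_zet : clim (fun m => zet (2 ^ m)) (pi ^+ 2 / 6 : R)%:C.
Proof.
apply: (null_contract _ (e := fun m => nrm (\sum_(0 <= j < 2 ^ m) (((2 * j).+1%:R : C) ^+ 2)^-1 - (pi ^+ 2 / 8 : R)%:C))).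
- by move=> m; exact: nrm_ge0.
- exact: clim_odd.
move=> m; rewrite zet_rec.
have e : (pi ^+ 2 / 6 : R)%:C = (pi ^+ 2 / 8 : R)%:C + 4%:R^-1 * (pi ^+ 2 / 6 : R)%:C.
  by rewrite !rmorphM !fmorphV ?rmorphXn !rmorph_nat; field.
rewrite [in leLHS]e opprD addrACA -mulrBr; apply: le_trans (nrmD _ _) _.
by rewrite [leLHS]addrC lerD2r nrmM nrmV nrm_nat mulrC.
Qed.

Lemma clim_zet_alt : clim (fun m => \sum_(1 <= k < (2 * 2 ^ m).+1) (-1) ^+ k * ((k%:R : C) ^+ 2)^-1)
  (- (pi ^+ 2 / 12) : R)%:C.
Proof.
have h := climD (climZ 2%:R^-1 clim_zet) (climZ (-1) (clim_sub leqnSn clim_zet)).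
have e : 2%:R^-1 * (pi ^+ 2 / 6 : R)%:C + -1 * (pi ^+ 2 / 6 : R)%:C = (- (pi ^+ 2 / 12) : R)%:C.
  by rewrite rmorphN !rmorphM !fmorphV ?rmorphXn !rmorph_nat; field.
rewrite e in h; apply: eq_clim h => m /=; rewrite sum_alt_even mulN1r -expnS; congr (_ - _).
rewrite /zet !mulr_sumr; apply: eq_bigr => k _.
have -> : ((2 * k)%:R ^+ 2 : C)^-1 = 4%:R^-1 * ((k%:R : C) ^+ 2)^-1.
  by rewrite natrM -invfM; congr (_^-1); ring.
by set a := (_ ^+ 2)^-1; field.
Qed.

Lemma cube_sum (k L : nat) : (0 < k)%N ->
  \sum_(1 <= M < L.+1) ((M + k)%:R ^+ 3 : R)^-1 <= (k%:R ^+ 2)^-1.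
Proof.
move=> k0; have K0 : 0 < k%:R :> R by rewrite ltr0n.
(* Strengthened to a telescoping bound: with x = L + k, each step uses (x + 1)^(-3) <= k^(-1)
   (x^(-1) - (x + 1)^(-1)). *)
suff h : \sum_(1 <= M < L.+1) ((M + k)%:R ^+ 3 : R)^-1 <= k%:R^-1 * (k%:R^-1 - (L + k)%:R^-1).
  apply: le_trans h _; rewrite expr2 invfM ler_pM2l ?invr_gt0 // gerBl invr_ge0 //.
elim: L => [|L IH]; first by rewrite big_geq // add0n subrr mulr0.
rewrite big_nat_recr //=; apply: le_trans (lerD IH (lexx _)) _.
rewrite -lerBrDl -mulrBr.
set x : R := (L + k)%:R; have x0 : 0 < x by rewrite ltr0n addn_gt0 k0 orbT.
have kx : k%:R <= x by rewrite ler_nat leq_addl.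
have -> : (L.+1 + k)%:R = x + 1 by rewrite addSn -natr1.
have -> : k%:R^-1 - (x + 1)^-1 - (k%:R^-1 - x^-1) = (x * (x + 1))^-1.
  by field; rewrite !lt0r_neq0 //; lra.
rewrite -invfM lef_pV2 ?posrE ?exprn_gt0 ?mulr_gt0 //; try lra.
have : 0 <= x ^+ 2 by exact: sqr_ge0.
have -> : (x + 1) ^+ 3 = (x + 1) * (x * (x + 1)) + (x + 1) ^+ 2 by ring.
move=> _; have h1 : k%:R * (x * (x + 1)) <= (x + 1) * (x * (x + 1)).
  by apply: ler_wpM2r; [apply: mulr_ge0; lra|lra].
by have := sqr_ge0 (x + 1); lra.
Qed.

Lemma sq_tail (K K' : nat) : (0 < K)%N -> (K <= K')%N ->
  \sum_(K <= i < K') (((2 * i).+1%:R : R) ^+ 2)^-1 <= K%:R^-1.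
Proof.
move=> k0 kk; have K0 : 0 < K%:R :> R by rewrite ltr0n.
suff h : \sum_(K <= i < K') (((2 * i).+1%:R : R) ^+ 2)^-1 <= K%:R^-1 - K'%:R^-1.
  by apply: le_trans h _; rewrite gerBl invr_ge0.
rewrite -(subnKC kk); elim: (K' - K)%N => [|n IH]; first by rewrite addn0 big_geq // subrr.
rewrite addnS big_nat_recr ?leq_addr //=; apply: le_trans (lerD IH (lexx _)) _.
rewrite -lerBrDl; set x : R := (K + n)%:R; have x0 : 0 < x by rewrite ltr0n addn_gt0 k0.
have -> : (2 * (K + n)).+1%:R = 2 * x + 1 by rewrite -natr1 natrM.
have -> : (K + n).+1%:R = x + 1 by rewrite -natr1.
have -> : K%:R^-1 - (x + 1)^-1 - (K%:R^-1 - x^-1) = (x * (x + 1))^-1.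
  by field; rewrite !lt0r_neq0 //; lra.
rewrite lef_pV2 ?posrE ?exprn_gt0 ?mulr_gt0 //; try lra.
nra.
Qed.

Lemma alt_tail (f : nat -> C) K K' : (K <= K')%N ->
  \sum_(1 <= k < (2 * K').+1) (-1) ^+ k * f k - \sum_(1 <= k < (2 * K).+1) (-1) ^+ k * f k =
  \sum_(K <= i < K') (f (2 * i).+2 - f (2 * i).+1).
Proof.
move=> kk; rewrite -(subnKC kk); elim: (K' - K)%N => [|n IH].
  by rewrite addn0 subrr big_geq.
rewrite addnS mulnS !add2n [RHS]big_nat_recr ?leq_addr //= -IH.
rewrite (@big_nat_recr _ _ _ (2 * (K + n)).+2) //= (@big_nat_recr _ _ _ (2 * (K + n)).+1) //=.
have -> : (-1) ^+ (2 * (K + n)).+1 = -1 :> C by rewrite exprS exprM sqrrN !expr1n mulr1.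
have -> : (-1) ^+ (2 * (K + n)).+2 = 1 :> C by rewrite !exprS exprM sqrrN !expr1n; ring.
by ring.
Qed.

Lemma lattice_lb z : 0 < Im z -> exists2 c : R, 0 < c & forall (M k : nat), (0 < M)%N ->
  c * (M + k)%:R <= nrm (2%:R * M%:R * z + k%:R) /\ c * (M + k)%:R <= nrm (2%:R * M%:R * z - k%:R).
Proof.
move=> y0; set y := Im z; pose D := 1 + nrm z / y + (2 * y)^-1.
have nz := nrm_ge0 z.
have D0 : 0 < D by rewrite /D; have : 0 <= nrm z / y by [rewrite divr_ge0 // ltW]; have : 0 < (2 * y)^-1 by [rewrite invr_gt0 mulr_gt0]; lra.
exists D^-1; first by rewrite invr_gt0.
move=> M k M0.
have im : Im (2%:R * M%:R * z) = 2 * M%:R * y.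
  by rewrite -natrM -(rmorph_nat (real_complex R)) cImM /= mul0r addr0 natrM.
have key (x : C) : Im x = 2 * M%:R * y -> k%:R <= nrm x + 2 * M%:R * nrm z -> D^-1 * (M + k)%:R <= nrm x.
  move=> ix hk; have h1 := Im_le_nrm x; rewrite ix ger0_norm ?mulr_ge0 ?(ltW y0) // in h1.
  have h2 : M%:R <= nrm x * (2 * y)^-1 by rewrite ler_pdivlMr ?mulr_gt0 //; lra.
  have h3 : 2 * M%:R * nrm z <= nrm x * (nrm z / y).
    rewrite mulrA ler_pdivlMr // mulrAC; apply: ler_wpM2r => //.
  by rewrite mulrC ler_pdivrMr // natrD /D !mulrDr mulr1; lra.
have n2M : nrm (2%:R * M%:R * z) = 2 * M%:R * nrm z by rewrite -natrM nrmM nrm_nat natrM.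
have kC : Im (k%:R : C) = 0 by rewrite -(rmorph_nat (real_complex R)).
split; apply: key.
- by rewrite cImD im kC addr0.
- have := nrmB (2%:R * M%:R * z + k%:R) (2%:R * M%:R * z).
  by rewrite addrAC subrr add0r nrm_nat n2M.
- by rewrite cImD cImN im kC subr0.
- have := nrmB (2%:R * M%:R * z - k%:R) (2%:R * M%:R * z).
  by rewrite addrAC subrr add0r nrmN nrm_nat n2M.
Qed.

(** Pairing consecutive k gains one power: differences decay like the inverse cube, which is
    summable over the lattice, whereas the inverse square is not. *)
Lemma f2_diff_le z : 0 < Im z -> exists2 D : R, 0 < D & forall M k : nat, (0 < M)%N ->
  nrm (f2 (2%:R * M%:R * z) k.+1 - f2 (2%:R * M%:R * z) k) <= D * ((M + k)%:R ^+ 3)^-1.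
Proof.
move=> y0; have [c c0 hc] := lattice_lb y0.
have one (a b : C) (x : R) : 0 < x -> x <= nrm a -> x <= nrm b -> nrm (a - b) = 1 ->
    nrm ((a ^+ 2)^-1 - (b ^+ 2)^-1) <= 2 * (x ^+ 3)^-1.
  move=> x0 xa xb ab.
  have na : 0 < nrm a by lra.
  have nb : 0 < nrm b by lra.
  have a0 : a != 0 by apply/eqP => h; rewrite h nrm0 ltxx in na.
  have b0 : b != 0 by apply/eqP => h; rewrite h nrm0 ltxx in nb.
  have -> : (a ^+ 2)^-1 - (b ^+ 2)^-1 = (b - a) * (a^-1 * (b^-1 * b^-1) + b^-1 * (a^-1 * a^-1)).
    by field; rewrite a0 b0.
  rewrite nrmM nrmBC ab mul1r; apply: le_trans (nrmD _ _) _; rewrite !nrmM !nrmV.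
  have ia : (nrm a)^-1 <= x^-1 by rewrite lef_pV2 ?posrE.
  have ib : (nrm b)^-1 <= x^-1 by rewrite lef_pV2 ?posrE.
  have ia0 : 0 <= (nrm a)^-1 by rewrite invr_ge0 ltW.
  have ib0 : 0 <= (nrm b)^-1 by rewrite invr_ge0 ltW.
  have -> : 2 * (x ^+ 3)^-1 = x^-1 * (x^-1 * x^-1) + x^-1 * (x^-1 * x^-1).
    by rewrite -exprVn; ring.
  by apply: lerD; apply: ler_pM => //; rewrite ?mulr_ge0 //; apply: ler_pM.
exists (4 * (c ^+ 3)^-1); first by rewrite mulr_gt0 // invr_gt0 exprn_gt0.
move=> M k M0; set w := 2%:R * M%:R * z.
have [h1 h2] := hc M k M0; have [h3 h4] := hc M k.+1 M0; rewrite -/w in h1 h2 h3 h4.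
have mono : c * (M + k)%:R <= c * (M + k.+1)%:R by rewrite ler_pM2l // ler_nat leq_add2l.
have x0 : 0 < c * (M + k)%:R by rewrite mulr_gt0 // ltr0n addn_gt0 M0.
have e1 : nrm ((w + k.+1%:R) - (w + k%:R)) = 1.
  by rewrite -natr1 (_ : _ - _ = 1) ?nrm1 //; ring.
have e2 : nrm ((w - k.+1%:R) - (w - k%:R)) = 1.
  by rewrite -natr1 (_ : _ - _ = -1) ?nrmN ?nrm1 //; ring.
have r1 := one _ _ _ x0 (le_trans mono h3) h1 e1.
have r2 := one _ _ _ x0 (le_trans mono h4) h2 e2.
rewrite /f2 opprD addrACA; apply: le_trans (nrmD _ _) _; apply: le_trans (lerD r1 r2) _.
by rewrite exprMn invfM; lra.
Qed.

(** The point is uniformity in the number L of rows; it justifies exchanging the two limits in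
    [eis2_inversion]. *)
Lemma f2_tail z : 0 < Im z -> exists2 D : R, 0 < D & forall K K' L : nat, (0 < K)%N -> (K <= K')%N ->
  nrm (\sum_(1 <= M < L.+1) (\sum_(1 <= k < (2 * K').+1) (-1) ^+ k * f2 (2%:R * M%:R * z) k)
     - \sum_(1 <= M < L.+1) (\sum_(1 <= k < (2 * K).+1) (-1) ^+ k * f2 (2%:R * M%:R * z) k)) <= D / K%:R.
Proof.
move=> y0; have [D D0 hD] := f2_diff_le y0; exists D => // K K' L K0 KK.
rewrite -sumrB (eq_bigr (fun M => \sum_(K <= i < K') (f2 (2%:R * M%:R * z) (2 * i).+2 - f2 (2%:R * M%:R * z) (2 * i).+1))); last first.
  by move=> M _; rewrite alt_tail.
rewrite exchange_big /=; apply: le_trans (nrm_sum _ _ _) _.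
apply: (@le_trans _ _ (\sum_(K <= i < K') D * (((2 * i).+1%:R : R) ^+ 2)^-1)); last first.
  by rewrite -mulr_sumr ler_wpM2l ?(ltW D0) // sq_tail.
apply: ler_sum => i _; apply: le_trans (nrm_sum _ _ _) _.
apply: (@le_trans _ _ (\sum_(1 <= M < L.+1) D * ((M + (2 * i).+1)%:R ^+ 3 : R)^-1)).
  by rewrite !big_nat; apply: ler_sum => M /andP[M0 _]; exact: hD.
by rewrite -mulr_sumr ler_wpM2l ?(ltW D0) // cube_sum.
Qed.

Lemma lips_le z M : 0 < Im z -> (0 < M)%N ->
  nrm (lips (M%:R * z)) <= 4 * pi ^+ 2 * (nrm (ee z) ^+ M / (1 - nrm (ee z)) ^+ 2).
Proof.
move=> y0 M0; rewrite /lips eeMn nrmM nrmN nrmR nrmf !nrmX.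
have r1 := nrm_ee_lt1 y0; set r := nrm (ee z) in r1 *; have r0 : 0 <= r := nrm_ge0 _.
have p2 : 0 <= 4 * pi ^+ 2 :> R by apply: mulr_ge0 => //; exact: sqr_ge0.
rewrite ger0_norm //; apply: ler_wpM2l => //; apply: ler_wpM2l; first exact: exprn_ge0.
have h : 1 - r <= nrm (1 - ee z ^+ M).
  have := nrm_dist 1 (ee z ^+ M); rewrite nrm1 nrmX -/r => h.
  have : r ^+ M <= r by rewrite -[leRHS]expr1; apply: ler_wiXn2l => //; exact: ltW.
  lra.
have d0 : 0 < 1 - r by lra.
have d1 : 0 < nrm (1 - ee z ^+ M) by lra.
by rewrite lef_pV2 ?posrE ?exprn_gt0 // lerXn2r ?nnegrE // ltW.
Qed.

Lemma ee_neq1 z : Im z != 0 -> ee z != 1.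
Proof.
move=> h; apply/eqP => e; have := nrm_ee z; rewrite e nrm1 => h1.
have : expR (- (2 * pi * Im z)) = expR 0 by rewrite expR0.
move/expR_inj/eqP; rewrite oppr_eq0 !mulf_eq0 (negbTE h) orbF.
by rewrite (gt_eqF (pi_gt0 R)) orbF pnatr_eq0.
Qed.

Definition lips_alt z N := \sum_(1 <= M < N.+1) (-1) ^+ M * lips (M%:R * z).

(* Both sides are the two iterated sums of (-1)^k/(2Mz+k)^2 over the lattice. *)
Lemma eis2_inversion z X Y : 0 < Im z ->
  clim (fun m => lips_alt z (2 ^ m)) X -> clim (fun m => lips_alt (- (2%:R * z)^-1) (2 ^ m)) Y ->
  (pi ^+ 2 / 3 : R)%:C + 2%:R * X + (2%:R * z ^+ 2)^-1 * ((pi ^+ 2 / 3 : R)%:C + 2%:R * Y) = 0.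
Proof.
move=> y0 hX hY; set w := - (2%:R * z)^-1 in hY *.
have n2 : 2%:R != 0 :> C by rewrite pnatr_eq0.
have z0 : z != 0 by apply/eqP => h; move: y0; rewrite h ltxx.
have ImM (k : nat) u : Im (k%:R * u) = k%:R * Im u.
  by rewrite -(rmorph_nat (real_complex R)) cImM /= mul0r addr0.
have Imz M : (0 < M)%N -> Im (M%:R * z) != 0.
  by move=> M0; rewrite ImM mulf_neq0 ?lt0r_neq0 // ltr0n.
have w0 : Im w != 0.
  rewrite /w cImN cImV ImM oppr_eq0 mulf_eq0 oppr_eq0 invr_eq0 expf_eq0 /= negb_or.
  apply/andP; split; first by rewrite mulf_neq0 // lt0r_neq0.
  apply/eqP => /nrm_eq0/eqP.
  by rewrite mulf_eq0 (negbTE n2) (negbTE z0).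
have Imw k : (0 < k)%N -> Im (k%:R * w) != 0.
  by move=> k0; rewrite ImM mulf_neq0 // lt0r_neq0 // ltr0n.
(* B is the limit of the row M over k, and A the limit of the column k over M. *)
pose B (M : nat) := 2%:R^-1 * lips (M%:R * z) - lips (2%:R * M%:R * z) - ((2%:R * M%:R * z) ^+ 2)^-1.
pose A (k : nat) := (4%:R * z ^+ 2)^-1 * lips (k%:R * w) - ((k%:R : C) ^+ 2)^-1.
have hB M : (0 < M)%N -> clim (fun m => \sum_(1 <= k < (2 * 2 ^ m).+1) (-1) ^+ k * f2 (2%:R * M%:R * z) k) (B M).
  move=> M0; rewrite /B; have e : M%:R * z = (2%:R * M%:R * z) / 2%:R by field.
  rewrite {1}e; apply: clim_alt_f2; last by rewrite -e; apply: ee_neq1; exact: Imz.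
    by apply: far_Im; rewrite -natrM; apply: Imz; rewrite muln_gt0.
  by apply: ee_neq1; rewrite -natrM; apply: Imz; rewrite muln_gt0.
have hA k : (0 < k)%N -> clim (fun m => \sum_(1 <= M < (2 ^ m).+1) f2 (2%:R * M%:R * z) k) (A k).
  move=> k0; pose v := k%:R / (2%:R * z).
  have kC : k%:R != 0 :> C by rewrite pnatr_eq0 -lt0n.
  have vw : k%:R * w = - v by rewrite /w /v mulrN.
  have Imv : Im v != 0 by have := Imw k k0; rewrite vw cImN oppr_eq0.
  have h := climZ (4%:R * z ^+ 2)^-1 (clim_f2 (far_Im Imv) (ee_neq1 Imv)).
  have e : (4%:R * z ^+ 2)^-1 * (lips v - (v ^+ 2)^-1) = A k.
    rewrite /A vw lips_even ?ee_neq1 // mulrBr; congr (_ - _).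
    by rewrite /v; field; rewrite kC z0.
  rewrite e in h; apply: eq_clim h => m; rewrite mulr_sumr; apply: eq_bigr => M _.
  rewrite /f2 mulrDr -!invfM; congr (_^-1 + _^-1).
    by rewrite /v; field.
  by rewrite /v; field.
pose Bv := - 4%:R^-1 * ((pi ^+ 2 / 6 : R)%:C / z ^+ 2 + 2%:R * X).
pose Av := (4%:R * z ^+ 2)^-1 * Y + (pi ^+ 2 / 12 : R)%:C.
have cA : clim (fun m => \sum_(1 <= k < (2 * 2 ^ m).+1) (-1) ^+ k * A k) Av.
  have h := climD (climZ (4%:R * z ^+ 2)^-1 (clim_sub leqnSn hY)) (climZ (-1) clim_zet_alt).
  have -> : Av = (4%:R * z ^+ 2)^-1 * Y + -1 * (- (pi ^+ 2 / 12) : R)%:C by rewrite rmorphN mulN1r opprK.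
  apply: eq_clim h => m /=; rewrite /lips_alt expnS !mulr_sumr -big_split /=.
  by apply: eq_bigr => k _; rewrite /A; ring.
(* This block of values is the discrepancy between the sum of the B M for M <= 2^m and [lips_alt] up
   to 2^(m+1); it decays exponentially. *)
have nl : clim (fun m => \sum_((2 ^ m).+1 <= M < (2 * 2 ^ m).+1) lips (M%:R * z)) 0.
  set r := nrm (ee z); have r1 : r < 1 := nrm_ee_lt1 y0; have r0 : 0 <= r := nrm_ge0 _.
  have nr := nullZ (4 * pi ^+ 2 / (1 - r) ^+ 2) (null_natX r0 r1).
  apply: (clim_le (b := fun m => 4 * pi ^+ 2 / (1 - r) ^+ 2 * ((2 ^ m)%:R * r ^+ (2 ^ m)))); last first.
    by move=> e /nr[N hN]; exists N => n Nn; apply: hN; apply: leq_trans Nn _; rewrite ltnW // ltn_expl.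
  move=> m; rewrite subr0; apply: le_trans (nrm_sum _ _ _) _.
  have -> : 4 * pi ^+ 2 / (1 - r) ^+ 2 * ((2 ^ m)%:R * r ^+ (2 ^ m)) =
    \sum_((2 ^ m).+1 <= M < (2 * 2 ^ m).+1) 4 * pi ^+ 2 * (r ^+ (2 ^ m) / (1 - r) ^+ 2).
    rewrite sumr_const_nat subSS mul2n -addnn addKn -[RHS]mulr_natl; ring.
  rewrite !big_nat; apply: ler_sum => M /andP[M1 _]; apply: le_trans (lips_le y0 _) _; first by lia.
  apply: ler_wpM2l; first by apply: mulr_ge0 => //; exact: sqr_ge0.
  apply: ler_wpM2r; first by rewrite invr_ge0 sqr_ge0.
  by apply: ler_wiXn2l => //; [exact: ltW|exact: ltnW].
have cB : clim (fun l => \sum_(1 <= M < (2 ^ l).+1) B M) Bv.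
  have h := climZ (- 4%:R^-1) (climD (climD (climZ (z ^+ 2)^-1 clim_zet) (climZ 2%:R (clim_sub leqnSn hX))) (climZ 2%:R nl)).
  have -> : Bv = - 4%:R^-1 * ((z ^+ 2)^-1 * (pi ^+ 2 / 6 : R)%:C + 2%:R * X + 2%:R * 0) by rewrite /Bv; ring.
  apply: eq_clim h => l /=; rewrite /lips_alt expnS sum_alt_even.
  rewrite [\sum_(1 <= k < (2 * 2 ^ l).+1) _](@big_cat_nat _ _ _ (2 ^ l).+1) //=; last by lia.
  rewrite /B !sumrB -[\sum_(1 <= i < _) 2%:R^-1 * _]mulr_sumr /=.
  have -> : \sum_(1 <= M < (2 ^ l).+1) ((2%:R * M%:R * z) ^+ 2)^-1 = (4%:R * z ^+ 2)^-1 * zet (2 ^ l).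
    rewrite /zet mulr_sumr; apply: eq_bigr => M _; rewrite -invfM; congr (_^-1); ring.
  have -> : \sum_(1 <= k < (2 ^ l).+1) (fun M : nat => lips (M%:R * z)) (2 * k)%N = \sum_(1 <= M < (2 ^ l).+1) lips (2%:R * M%:R * z).
    by apply: eq_bigr => M _; rewrite natrM.
  set p := \sum_(_ <= _ < _) _; set q := \sum_(_ <= _ < _) _; set s := \sum_(_ <= _ < _) _.
  by field.
have [D D0 hD] := f2_tail y0.
(* The bound of [f2_tail] survives the limit over k for a fixed number 2^l of rows, and then the
   limit over l. *)
have key m : nrm (Bv - \sum_(1 <= k < (2 * 2 ^ m).+1) (-1) ^+ k * A k) <= D / (2 ^ m)%:R.
  pose S l K := \sum_(1 <= M < (2 ^ l).+1) \sum_(1 <= k < (2 * K).+1) (-1) ^+ k * f2 (2%:R * M%:R * z) k.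
  have c1 : clim (fun l => S l (2 ^ m)%N) (\sum_(1 <= k < (2 * 2 ^ m).+1) (-1) ^+ k * A k).
    have h : clim (fun l => \sum_(1 <= k < (2 * 2 ^ m).+1) (-1) ^+ k * \sum_(1 <= M < (2 ^ l).+1) f2 (2%:R * M%:R * z) k)
        (\sum_(1 <= k < (2 * 2 ^ m).+1) (-1) ^+ k * A k).
      by apply: clim_sum => k /andP[k0 _]; apply: climZ; exact: hA.
    apply: eq_clim h => l; rewrite /S exchange_big /=; apply: eq_bigr => k _.
    by rewrite mulr_sumr.
  have c2 l : clim (fun m' => S l (2 ^ m')%N) (\sum_(1 <= M < (2 ^ l).+1) B M).
    by apply: clim_sum => M /andP[M0 _]; exact: hB.
  rewrite -[- \sum_(_ <= _ < _) _]mulN1r.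
  apply: (clim_nrm_le (climD cB (climZ (-1) c1))) => l; rewrite mulN1r.
  apply: (clim_nrm_le (climD (clim_sub (leq_addl m) (c2 l)) (clim_cst (- S l (2 ^ m)%N)))) => m' /=.
  by apply: hD; rewrite ?expn_gt0 // leq_exp2l // leq_addr.
have AB : Bv = Av.
  apply: (clim_unique (u := fun m => \sum_(1 <= k < (2 * 2 ^ m).+1) (-1) ^+ k * A k)) cA.
  apply: (clim_le (b := fun m => D * (1/2) ^+ m)).
    by move=> m; rewrite nrmBC; apply: le_trans (key m) _; rewrite natrX mul1r exprVn.
  by apply: nullZ; apply: null_geom; lra.
move: AB; rewrite /Bv /Av => AB.
have -> : (2%:R * z ^+ 2)^-1 * ((pi ^+ 2 / 3 : R)%:C + 2%:R * Y) =
   (2%:R * z ^+ 2)^-1 * (pi ^+ 2 / 3 : R)%:C + 4%:R * ((4%:R * z ^+ 2)^-1 * Y) by field.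
have e12 : (pi ^+ 2 / 12 : R)%:C = 12%:R^-1 * (pi ^+ 2 : R)%:C by rewrite rmorphM fmorphV rmorph_nat mulrC.
have e6 : (pi ^+ 2 / 6 : R)%:C = 6%:R^-1 * (pi ^+ 2 : R)%:C by rewrite rmorphM fmorphV rmorph_nat mulrC.
have e3 : (pi ^+ 2 / 3 : R)%:C = 3%:R^-1 * (pi ^+ 2 : R)%:C by rewrite rmorphM fmorphV rmorph_nat mulrC.
rewrite e12 e6 in AB; rewrite e3; set P := (pi ^+ 2 : R)%:C in AB *.
have -> : (4%:R * z ^+ 2)^-1 * Y = - 4%:R^-1 * (6%:R^-1 * P / z ^+ 2 + 2%:R * X) - 12%:R^-1 * P.
  by rewrite AB addrK.
by field.
Qed.

End Eisenstein.

(** * The eta quotient F and its inversion law *)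

Section Growth.
Variable R : realType.
Notation C := R[i].
Implicit Types (c d e : nat -> R) (t z : C) (x y r s : R).

Lemma eq_ev c d t : c =1 d -> ev c t = ev d t.
Proof. by move=> h; congr (ev _ t); apply: boolp.funext. Qed.

Lemma good_le c d : (forall n, `|c n| <= `|d n|) -> good d -> good c.
Proof.
move=> h gd r r0 r1; have [K hK] := gd r r0 r1; exists K => n.
by apply: le_trans (hK n); rewrite ler_wpM2r ?exprn_ge0.
Qed.

Lemma eq_good c d : c =1 d -> good c -> good d.
Proof. by move=> h; apply: good_le => n; rewrite h. Qed.

Lemma good_cst (k : R) : good (fun=> k).
Proof.
move=> r r0 r1; exists `|k| => n; rewrite -[leRHS]mulr1 ler_wpM2l //.
by rewrite exprn_ile1 // ltW.
Qed.

(* Beyond index M the recursion cannot increase max |c_n| r^n, where M bounds the sum of |e_n| r^n. *)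
Lemma good_rec e c : good e -> e 0%N = 0 -> (forall n, n%:R * c n = conv e c n) -> good c.
Proof.
move=> ge e0 hc r r0 r1; have [K [s [K0 s0 s1 h]]] := good_geom ge r0 r1.
pose M := K / (1 - s); have M0 : 0 <= M by rewrite divr_ge0 // subr_ge0 ltW.
pose N0 := (Num.bound M).
pose B := \sum_(0 <= k < N0.+1) `|c k| * r ^+ k.
have pos k : 0 <= `|c k| * r ^+ k by rewrite mulr_ge0 ?exprn_ge0.
have B0 : 0 <= B by rewrite /B big_nat; apply: sumr_ge0 => k _.
exists B => n; elim/ltn_ind: n => n IH.
have [nN|nN] := leqP n N0.
  rewrite /B (bigD1_seq n) ?mem_index_iota ?iota_uniq //= lerDl.
  by apply: sumr_ge0 => k _.
have n0 : (0 < n)%N by exact: leq_ltn_trans nN.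
have nR : 0 < n%:R :> R by rewrite ltr0n.
have Mn : M <= n%:R.
  apply: le_trans (ltW (archi_boundP M0)) _; rewrite ler_nat; exact: ltnW.
rewrite -(ler_pM2l nR); apply: le_trans (ler_wpM2r B0 Mn).
have -> : n%:R * (`|c n| * r ^+ n) = `|conv e c n * r ^+ n|.
  by rewrite -hc !normrM (ger0_norm (exprn_ge0 n r0)) (ger0_norm (ltW nR)) mulrA.
rewrite /conv mulr_suml; apply: le_trans (ler_norm_sum _ _ _) _.
apply: (@le_trans _ _ (\sum_(0 <= i < n.+1) K * s ^+ i * B)).
  rewrite !big_nat; apply: ler_sum => i /andP[_ ilt].
  have [->|i0] := posnP i.
    by rewrite e0 !mul0r normr0 expr0 mulr1 mulr_ge0.
  have -> : r ^+ n = r ^+ i * r ^+ (n - i) by rewrite -exprD subnKC.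
  have -> : e i * c (n - i)%N * (r ^+ i * r ^+ (n - i)) = (e i * r ^+ i) * (c (n - i)%N * r ^+ (n - i)) by ring.
  rewrite normrM; apply: ler_pM => //; rewrite normrM (ger0_norm (exprn_ge0 _ r0)) //.
  by apply: IH; rewrite ltn_subrL i0 n0.
rewrite -mulr_suml -mulr_sumr ler_wpM2r // ler_wpM2l //.
by apply: le_trans (geom_sum_le 0 n.+1 s0 s1) _; rewrite expr0 mul1r.
Qed.

Definition delta0 (n : nat) : R := (n == 0)%:R.

Lemma good_delta0 : good delta0.
Proof.
by apply: good_le (good_cst 1) => n; rewrite /delta0 normr1; case: eqP => _; rewrite ?normr1 ?normr0.
Qed.

Lemma ev_delta0 t : ev delta0 t = 1.
Proof.
apply: ev_eq; apply: clim_near (clim_cst 1).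
apply: null_le (null_geom (lexx 0) ltr01); exists 1%N => -[//|n] _.
rewrite /psum big_nat_recl //= /term /delta0 expr0 mulr1 big1 ?addr0 ?subrr ?nrm0 ?normr0 ?exprn_ge0 //.
by move=> i _; rewrite mul0r.
Qed.

Definition divR (n : nat) : R := (divs n n)%:~R.

Lemma good_divR : good divR.
Proof.
apply: good_le (good_natM (good_natM (good_natM (good_cst 1)))) => N.
rewrite /divR mulr1 [X in _ <= X]ger0_norm; last by rewrite !mulr_ge0.
rewrite -intr_norm.
have : `|divs N N| <= N%:R * (N%:R * N%:R).
  rewrite /divs; apply: le_trans (ler_norm_sum _ _ _) _.
  apply: (@le_trans _ _ (\sum_(1 <= M < N.+1) (N%:R * N%:R : int))); last first.
    by rewrite sumr_const_nat subn1 /= -[leLHS]mulr_natl.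
  apply: ler_sum => M _; apply: le_trans (ler_norm_sum _ _ _) _.
  apply: (@le_trans _ _ (\sum_(1 <= n < N.+1) (N%:R : int))); last first.
    by rewrite sumr_const_nat subn1 /= -[leLHS]mulr_natl.
  rewrite !big_nat; apply: ler_sum => n /andP[_ nN]; case: ifP => _; last by rewrite normr0.
  by rewrite normrM normrX normrN1 expr1n mul1r normr_nat ler_nat.
by rewrite -(ler_int R) !rmorphM /= !rmorph_nat.
Qed.

Lemma nat_geom (x : C) L : (1 - x) ^+ 2 * \sum_(1 <= n < L.+1) n%:R * x ^+ n =
  x - L.+1%:R * x ^+ L.+1 + L%:R * x ^+ L.+2.
Proof.
elim: L => [|L IH]; first by rewrite big_geq // mulr0; ring.
rewrite big_nat_recr //= mulrDr IH -[L.+2%:R]natr1 -[L.+1%:R]natr1 !exprS; ring.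
Qed.

(** Each of the K rows has an error O(K^2 |q|^K): the tail n > K of x/(1 - x)^2 = sum of n x^n, and
    the points M n > K of the square, absent from the partial power series. *)
Lemma lambert_lim (q : C) : nrm q < 1 ->
  clim (fun K => \sum_(1 <= M < K.+1) (-1) ^+ M * (q ^+ M / (1 - q ^+ M) ^+ 2)) (ev divR q).
Proof.
move=> q1; set r := nrm q in q1; have r0 : 0 <= r := nrm_ge0 q.
have r1' : 0 < 1 - r by rewrite subr_gt0.
apply: (@clim_near _ _ (fun K => psum (term divR q) K.+1)); last first.
  exact: (clim_sub (fun n => leqnSn n) (evP good_divR q1)).
pose A := 3 / (1 - r) ^+ 2 + 1 : R.
apply: null_le (nullZ A (null_powX 3 r0 q1)); exists 1%N => K K0.
rewrite ger0_norm ?nrm_ge0 //.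
have -> : psum (term divR q) K.+1 = \sum_(1 <= M < K.+1) \sum_(1 <= n < K.+1)
    if (M * n <= K)%N then (-1) ^+ M * n%:R * (q ^+ M) ^+ n else 0.
  rewrite /psum; transitivity (\sum_(0 <= N < K.+1) \sum_(1 <= M < K.+1) \sum_(1 <= n < K.+1)
     if (M * n == N)%N then (-1) ^+ M * n%:R * q ^+ N else 0).
    rewrite !big_nat; apply: eq_bigr => N /andP[_ NK]; rewrite /term /divR -(@divs_stable K) // /divs.
    rewrite rmorph_sum /= rmorph_sum /= mulr_suml; apply: eq_bigr => M _.
    rewrite rmorph_sum /= rmorph_sum /= mulr_suml; apply: eq_bigr => n _; case: ifP => _; last by rewrite !rmorph0 mul0r.
    by rewrite !rmorphM /= !rmorphXn /= !rmorphN1 !rmorph_nat.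
  rewrite exchange_big /= !big_nat; apply: eq_bigr => M /andP[M0 MK].
  rewrite exchange_big /= !big_nat; apply: eq_bigr => n /andP[n0 nK].
  case: leqP => hMn.
    rewrite (bigD1_seq (M * n)%N) ?mem_index_iota ?iota_uniq //= eqxx big1 ?addr0 -?exprM //.
    by move=> N; rewrite eq_sym => /negbTE ->.
  rewrite big_nat big1 // => N /andP[_ NK]; rewrite ifF //; apply/negbTE/eqP; lia.
rewrite -sumrB; apply: le_trans (nrm_sum _ _ _) _.
have rK0 : 0 <= r ^+ K by exact: exprn_ge0.
have K1 : 1 <= K%:R :> R by rewrite ler1n.
apply: (@le_trans _ _ (\sum_(1 <= M < K.+1) ((2 * K).+1%:R * r ^+ K / (1 - r) ^+ 2 + K%:R * (K%:R * r ^+ K)))); last first.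
  rewrite sumr_const_nat subn1 /= -[_ *+ K]mulr_natl.
  have -> : (2 * K).+1%:R = 2 * K%:R + 1 :> R by rewrite -natr1 natrM.
  have p2 : 0 <= r ^+ K / (1 - r) ^+ 2 by rewrite divr_ge0 // exprn_ge0 // ltW.
  rewrite /A -subr_ge0.
  have -> : (3 / (1 - r) ^+ 2 + 1) * (K%:R ^+ 3 * r ^+ K) -
    K%:R * ((2 * K%:R + 1) * r ^+ K / (1 - r) ^+ 2 + K%:R * (K%:R * r ^+ K)) =
    (K%:R * (3 * K%:R ^+ 2 - 2 * K%:R - 1)) * (r ^+ K / (1 - r) ^+ 2).
    rewrite !exprS expr0; ring.
  rewrite mulr_ge0 //; apply: mulr_ge0; [lra|rewrite expr2; nra].
rewrite !big_nat; apply: ler_sum => M /andP[M0 MK].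
set x := q ^+ M.
have nx : nrm x <= r by rewrite /x nrmX -/r -[leRHS]expr1; apply: ler_wiXn2l => //; exact: ltW.
have nxM : nrm x = r ^+ M by rewrite /x nrmX.
have nx0 := nrm_ge0 x; clearbody x.
have d1 : 1 - r <= nrm (1 - x).
  have := nrm_dist 1 x; rewrite nrm1 => hh; lra.
have x1 : 1 - x != 0 by apply/eqP => e; move: d1; rewrite e nrm0; lra.
have e1 : x / (1 - x) ^+ 2 = \sum_(1 <= n < K.+1) n%:R * x ^+ n + (K.+1%:R * x ^+ K.+1 - K%:R * x ^+ K.+2) / (1 - x) ^+ 2.
  have x2 : (1 - x) ^+ 2 != 0 by rewrite expf_neq0.
  apply: (mulfI x2); rewrite mulrDr nat_geom ![(1 - x) ^+ 2 * (_ / _)]mulrC !divfK //; ring.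
rewrite e1 mulrDr mulr_sumr addrAC -sumrB addrC; apply: le_trans (nrmD _ _) _; apply: lerD.
  rewrite nrmM nrmX nrmN nrm1 expr1n mul1r nrmf !nrmX; apply: ler_pM; rewrite ?nrm_ge0 ?invr_ge0 ?exprn_ge0 ?nrm_ge0 //.
    apply: le_trans (nrmB _ _) _; rewrite (nrmM K.+1%:R) (nrmM K%:R) !nrm_nat !nrmX.
    have -> : (2 * K).+1%:R = K.+1%:R + K%:R :> R by rewrite -natrD; congr (_%:R); lia.
    have xK j : (K <= j)%N -> nrm x ^+ j <= r ^+ K.
      move=> Kj; apply: (@le_trans _ _ (r ^+ j)); first by apply: lerXn2r; rewrite ?nnegrE.
      by apply: ler_wiXn2l => //; exact: ltW.
    by rewrite mulrDl; apply: lerD; apply: ler_wpM2l => //; apply: xK; lia.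
  rewrite lef_pV2 ?posrE ?exprn_gt0 //; last by apply: lt_le_trans d1.
  by apply: lerXn2r; rewrite ?nnegrE ?nrm_ge0 // ltW.
apply: le_trans (nrm_sum _ _ _) _.
apply: (@le_trans _ _ (\sum_(1 <= n < K.+1) (K%:R * r ^+ K))); last first.
  by rewrite sumr_const_nat subn1 /= -[_ *+ K]mulr_natl.
rewrite !big_nat; apply: ler_sum => n /andP[n0 nK].
case: leqP => hMn; first by rewrite -mulrA subrr nrm0 mulr_ge0.
rewrite subr0 (nrmM ((-1) ^+ M)) (nrmM n%:R) (nrmX (-1) M) nrmN nrm1 expr1n mul1r nrm_nat; apply: ler_pM => //.
- exact: nrm_ge0.
- by rewrite ler_nat.
by rewrite nrmX nxM -exprM; apply: ler_wiXn2l => //; [exact: ltW|exact: ltnW].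
Qed.

Definition epsR (n : nat) : R := (epsm n)%:~R.
(* F' = (pi i / 6) F E. *)
Definition Ez z : C := 1 + 12%:R * ev epsR (ee z).

Lemma epsR_divR : epsR =1 (fun n => -2 * divR n).
Proof. by move=> n; rewrite /epsR /epsm /divR rmorphM rmorphN rmorph_nat. Qed.
Lemma good_epsR : good epsR.
Proof. by apply: eq_good (goodZ (-2) good_divR) => n; rewrite epsR_divR. Qed.

Definition Wz z : C := - (2%:R * z)^-1.

Lemma Im_Wz z : Im (Wz z) = Im z / (2 * nrm z ^+ 2).
Proof.
rewrite /Wz cImN cImV nrmM nrm_nat.
have -> : Im (2%:R * z) = 2 * Im z by rewrite mulr_natl mulr2n cImD; ring.
have [->|z0] := eqVneq (nrm z) 0; first by rewrite mulr0 !expr0n /= mulr0 !invr0 !mulr0 oppr0.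
by field.
Qed.

Lemma Im_neq0 z : 0 < Im z -> z != 0.
Proof. by move=> h; apply/eqP => e; move: h; rewrite e /= ltxx. Qed.
Lemma Wz_gt0 z : 0 < Im z -> 0 < Im (Wz z).
Proof. by move=> h; rewrite Im_Wz divr_gt0 // mulr_gt0 // exprn_gt0 // nrm_gt0 // Im_neq0. Qed.
Lemma WzK z : 0 < Im z -> Wz (Wz z) = z.
Proof.
move=> /Im_neq0 z0; rewrite /Wz; have n2 : 2%:R != 0 :> C by rewrite pnatr_eq0.
by field; rewrite ?z0 ?n2.
Qed.

Lemma lips_alt_lim z : 0 < Im z ->
  clim (fun m => lips_alt z (2 ^ m)) (- (4 * pi ^+ 2 : R)%:C * ev divR (ee z)).
Proof.
move=> z0; have h := lambert_lim (nrm_ee_lt1 z0).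
have hs : forall m, (m <= 2 ^ m)%N by move=> m; exact: ltnW (ltn_expl m (ltnSn 1)).
apply: eq_clim (climZ _ (clim_sub hs h)) => m /=.
rewrite /lips_alt mulr_sumr; apply: eq_bigr => M _; rewrite /lips eeMn; ring.
Qed.

Lemma Ez_inversion z : 0 < Im z -> Ez z = - (2%:R * z ^+ 2)^-1 * Ez (Wz z).
Proof.
move=> z0; have := eis2_inversion z0 (lips_alt_lim z0) (lips_alt_lim (Wz_gt0 z0)).
have k w : 0 < Im w -> (pi ^+ 2 / 3 : R)%:C + 2%:R * (- (4 * pi ^+ 2 : R)%:C * ev divR (ee w)) = (pi ^+ 2 / 3 : R)%:C * Ez w.
  move=> w0; rewrite /Ez (eq_ev _ epsR_divR) evZ ?nrm_ee_lt1 //; last exact: good_divR.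
  have -> : (4 * pi ^+ 2 : R)%:C = 12%:R * (pi ^+ 2 / 3 : R)%:C.
    by rewrite -[12%:R](rmorph_nat (real_complex R)) -rmorphM; congr (_%:C); field.
  have -> : (-2 : R)%:C = - 2%:R :> C by rewrite rmorphN rmorph_nat.
  by move: (_%:C) (ev _ _) => a b; ring.
move=> h0; have : (pi ^+ 2 / 3 : R)%:C * Ez z + (2%:R * z ^+ 2)^-1 * ((pi ^+ 2 / 3 : R)%:C * Ez (Wz z)) = 0.
  exact: etrans (f_equal2 (fun a b => a + (2%:R * z ^+ 2)^-1 * b) (esym (k _ z0)) (esym (k _ (Wz_gt0 z0)))) h0.
have : (pi ^+ 2 / 3 : R)%:C != 0 by rewrite fmorph_eq0 gt_eqF // divr_gt0 // exprn_gt0 // pi_gt0.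
move: ((pi ^+ 2 / 3 : R)%:C) (Ez z) (Ez (Wz z)) ((2%:R * z ^+ 2)^-1) => p A B q p0 h.
have /eqP : p * (A + q * B) = 0 by rewrite -h; ring.
by rewrite mulf_eq0 (negbTE p0) addr_eq0 mulNr => /eqP.
Qed.

Lemma invr_le (a b : R) : 0 < a -> a <= b -> b^-1 <= a^-1.
Proof. by move=> a0 ab; rewrite lef_pV2 ?posrE // (lt_le_trans a0). Qed.

End Growth.

(** * The eta quotient F, its derivative and the constant C *)

Section EtaQuotient.
Variable R : realType.
Notation C := R[i].
Implicit Types (c d e : nat -> R) (t z h : C) (x y r s : R).

Definition alphaR n : R := (alpha n)%:~R.
Definition gammaR n : R := (gamma n)%:~R.

Lemma good_alphaR : good alphaR.
Proof.
apply: (@good_rec _ (epsR R)); [exact: good_epsR|by rewrite /epsR epsm0|move=> n].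
have := congr1 (fun x : int => x%:~R : R) (alpha_rec n); rewrite /= rmorphM /= rmorph_nat => ->.
by rewrite rmorph_sum /=; apply: eq_bigr => i _; rewrite rmorphM.
Qed.
Lemma good_gammaR : good gammaR.
Proof.
apply: (@good_rec _ (fun n => -1 * epsR R n)); [exact: goodZ (@good_epsR R)|by rewrite /epsR epsm0 mulr0|move=> n].
have := congr1 (fun x : int => x%:~R : R) (gamma_rec n); rewrite /= rmorphM /= rmorph_nat => ->.
by rewrite rmorphN rmorph_sum /= -sumrN; apply: eq_bigr => i _; rewrite rmorphM /epsR mulN1r mulNr.
Qed.

Definition tz z : C := ee (z / 12%:R).
(* F = eta(2z)^2 / eta(z)^2 and G = 1/F. *)
Definition Fm z : C := tz z * ev alphaR (ee z).
Definition Gm z : C := (tz z)^-1 * ev gammaR (ee z).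

Lemma tz12 z : tz z ^+ 12 = ee z.
Proof. by rewrite /tz -eeMn mulrCA divff ?mulr1 // pnatr_eq0. Qed.
Lemma tz_neq0 z : tz z != 0. Proof. exact: ee_neq0. Qed.
Lemma nrm_tz z : nrm (tz z) = expR (- (pi / 6 * Im z)).
Proof.
rewrite /tz nrm_ee; congr (expR (- _)).
have -> : Im (z / 12%:R) = Im z / 12.
  have -> : z / 12%:R = (12^-1 : R)%:C * z by rewrite fmorphV rmorph_nat mulrC.
  by rewrite cImM /=; ring.
by field.
Qed.
Lemma nrm_tz_lt1 z : 0 < Im z -> nrm (tz z) < 1.
Proof.
move=> z0; rewrite nrm_tz -[ltRHS]expR0 ltr_expR oppr_lt0.
by apply: mulr_gt0 => //; apply: divr_gt0 => //; exact: pi_gt0.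
Qed.
Lemma tzD z w : tz (z + w) = tz z * tz w.
Proof. by rewrite /tz mulrDl eeD. Qed.

Lemma FGm z : 0 < Im z -> Fm z * Gm z = 1.
Proof.
move=> z0; have q1 := nrm_ee_lt1 z0; rewrite /Fm /Gm mulrACA divff ?tz_neq0 // mul1r.
rewrite -ev_conv //; [|exact: good_alphaR|exact: good_gammaR].
rewrite -(ev_delta0 (ee z)); apply: eq_ev => n; rewrite /delta0.
have := congr1 (fun x : int => x%:~R : R) (alpha_gamma n); rewrite /= rmorph_nat => <-.
by rewrite /conv rmorph_sum /=; apply: eq_bigr => i _; rewrite rmorphM.
Qed.
Lemma Fm_neq0 z : 0 < Im z -> Fm z != 0.
Proof. by move=> /FGm h; apply/eqP => e; move: h; rewrite e mul0r => /eqP; rewrite eq_sym oner_eq0. Qed.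
Lemma GmE z : 0 < Im z -> Gm z = (Fm z)^-1.
Proof. by move=> z0; apply: (mulfI (Fm_neq0 z0)); rewrite FGm // divff // Fm_neq0. Qed.

Definition fz (n : nat) : int := if (n < 1)%N then 0 else if (12 %| n - 1)%N then alpha ((n - 1) %/ 12) else 0.
Definition fR n : R := (fz n)%:~R.

Lemma fRE : fR =1 shift 1 (undil 12 alphaR).
Proof. by move=> n; rewrite /fR /fz /shift /undil /alphaR; case: ifP => // _; case: ifP. Qed.
Lemma good_fR : good fR.
Proof. by apply: (@eq_good _ (shift 1 (undil 12 alphaR))); [move=> n; rewrite fRE|apply: good_shift; apply: good_undil => //; exact: good_alphaR]. Qed.
Lemma ev_fR t : nrm t < 1 -> ev fR t = t * ev alphaR (t ^+ 12).
Proof.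
move=> t1; rewrite (eq_ev _ fRE) ev_shift ?expr1 ?ev_undil //; first exact: good_alphaR.
by apply: good_undil => //; exact: good_alphaR.
Qed.
Lemma Fm_ev z : 0 < Im z -> Fm z = ev fR (tz z).
Proof. by move=> z0; rewrite ev_fR; [rewrite /Fm tz12|exact: nrm_tz_lt1]. Qed.

Lemma good_ea : good (conv (epsR R) alphaR).
Proof. by apply: good_conv; [exact: good_epsR|exact: good_alphaR]. Qed.

(** In degree 12 m + 1 the recurrence [alpha_rec] reads (12 m + 1) alpha_m = alpha_m + 12 (eps *
    alpha)_m, where * is convolution. *)
Lemma ev_nfR z : 0 < Im z -> ev (fun n => n%:R * fR n) (tz z) = Fm z * Ez z.
Proof.
move=> z0; have t1 := nrm_tz_lt1 z0; have q1 := nrm_ee_lt1 z0.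
have g2 := @good_undil R 12 _ isT good_ea.
have -> : ev (fun n => n%:R * fR n) (tz z) = ev (fun n => fR n + 12 * shift 1 (undil 12 (conv (epsR R) alphaR)) n) (tz z).
  apply: eq_ev => n; rewrite !fRE /shift /undil; case: ltnP => n0; first by rewrite !mulr0 addr0.
  case: ifP => [/dvdnP[m hm]|_]; last by rewrite !mulr0 addr0.
  rewrite hm mulnK //.
  have -> : n = (m * 12 + 1)%N by lia.
  have := congr1 (fun x : int => x%:~R : R) (alpha_rec m); rewrite /= rmorphM /= rmorph_nat => ha.
  have -> : conv (epsR R) alphaR m = m%:R * alphaR m.
    by rewrite ha rmorph_sum /=; apply: eq_bigr => i _; rewrite rmorphM.
  by rewrite natrD natrM; ring.
rewrite evD ?evZ ?ev_shift ?ev_undil ?expr1 ?tz12 //; try exact: good_ea; try exact: good_fR; try exact: good_shift;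
  try by [apply: good_shift|apply: goodZ; apply: good_shift].
rewrite ev_conv //; [|exact: good_epsR|exact: good_alphaR].
by rewrite -Fm_ev // /Ez /Fm (rmorph_nat (real_complex R) 12); ring.
Qed.

Definition kap : C := 2%:R * (pi : R)%:C * 'i / 12%:R.

Lemma tz_cexp z h : tz (z + h) = tz z * cexp (kap * h).
Proof. by rewrite tzD; congr (_ * _); rewrite /tz /ee /kap; congr cexp; ring. Qed.

Lemma nrm_tz_le y z : y <= Im z -> nrm (tz z) <= expR (- (pi / 6 * y)).
Proof.
move=> h; rewrite nrm_tz ler_expR lerN2; apply: ler_wpM2l => //.
by apply: divr_ge0 => //; exact: pi_ge0.
Qed.
Lemma expR_lt1 y : 0 < y -> expR (- (pi / 6 * y)) < 1 :> R.
Proof.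
move=> y0; rewrite -[ltRHS]expR0 ltr_expR oppr_lt0.
by apply: mulr_gt0 => //; apply: divr_gt0 => //; exact: pi_gt0.
Qed.

Lemma Fm_taylor y : 0 < y -> exists K del : R, [/\ 0 <= K, 0 < del &
  forall z h, y <= Im z -> 0 < Im (z + h) -> nrm h <= del ->
    nrm (Fm (z + h) - Fm z - h * (kap * Fm z * Ez z)) <= K * nrm h ^+ 2].
Proof.
move=> y0; have [K [del [K0 d0 hK]]] := ev_taylor good_fR (expR_ge0 _) (expR_lt1 y0).
have k0 := nrm_ge0 kap.
have k1 : 0 < nrm kap + 1 by lra.
exists (K * nrm kap ^+ 2), (del / (nrm kap + 1)); split; first by rewrite mulr_ge0 // sqr_ge0.
  by rewrite divr_gt0.
move=> z h yz zh hd; have z0 : 0 < Im z by exact: lt_le_trans yz.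
have hu : nrm (kap * h) <= del.
  rewrite nrmM; move: hd; rewrite ler_pdivlMr // => hd; have := nrm_ge0 h; nra.
have := hK (tz z) (kap * h) (nrm_tz_le yz) hu.
rewrite -tz_cexp -!Fm_ev // ev_nfR // nrmM exprMn.
have -> : kap * h * (Fm z * Ez z) = h * (kap * Fm z * Ez z) by ring.
have -> : K * nrm kap ^+ 2 * nrm h ^+ 2 = K * (nrm kap ^+ 2 * nrm h ^+ 2) by rewrite mulrA.
by [].
Qed.

Lemma Fm_bounded y : 0 < y -> exists K : R, forall z, y <= Im z -> nrm (Fm z) <= K.
Proof.
move=> y0; have [K hK] := ev_bounded good_fR (expR_ge0 _) (expR_lt1 y0).
by exists K => z yz; rewrite Fm_ev ?(lt_le_trans y0 yz) //; apply: hK; exact: nrm_tz_le.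
Qed.

Lemma Ez_bounded y : 0 < y -> exists K : R, forall z, y <= Im z -> nrm (Ez z) <= K.
Proof.
move=> y0; have [K hK] := ev_bounded (@good_epsR R) (expR_ge0 _) (expR_lt1 y0).
exists (1 + 12 * K) => z yz; apply: le_trans (nrmD _ _) _; rewrite nrm1 lerD2l nrmM nrm_nat ler_wpM2l //.
apply: hK; rewrite -tz12 nrmX; apply: le_trans (nrm_tz_le yz).
rewrite -[leRHS]expr1; apply: ler_wiXn2l => //; first exact: nrm_ge0.
by apply: ltW; apply: nrm_tz_lt1; exact: lt_le_trans yz.
Qed.

Definition Pm z : C := Fm z * Fm (Wz z).

(* The first-order terms cancel by Ez_inversion. *)
Lemma Pm_step (y B : R) : 0 < y -> exists K del : R, [/\ 0 <= K, 0 < del &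
  forall z h, y <= Im z -> y <= Im (z + h) -> nrm z <= B -> nrm (z + h) <= B -> nrm h <= del ->
    nrm (Pm (z + h) - Pm z) <= K * nrm h ^+ 2].
Proof.
move=> y0; pose B1 := `|B| + 1; have B10 : 0 < B1 by rewrite /B1; have := normr_ge0 B; lra.
(* Im (W z) = Im z / (2 |z|^2), so y1 bounds from below the imaginary parts of both z and W z on the
   region considered. *)
pose y1 := Num.min y (y / (2 * B1 ^+ 2)).
have y10 : 0 < y1 by rewrite lt_min y0 divr_gt0 // mulr_gt0 // exprn_gt0.
have [K [del [K0 d0 hK]]] := Fm_taylor y10; move: kap hK => kp hK.
have [M0 hM0] := Fm_bounded y10; have [E0 hE0] := Ez_bounded y10.
pose M := `|M0| + 1; pose E := `|E0| + 1.
have M1 : 0 < M by rewrite /M; have := normr_ge0 M0; lra.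
have E1 : 0 < E by rewrite /E; have := normr_ge0 E0; lra.
have hM z : y1 <= Im z -> nrm (Fm z) <= M.
  by move=> /hM0 h; rewrite /M; have := ler_norm M0; lra.
have hE z : y1 <= Im z -> nrm (Ez z) <= E.
  by move=> /hE0 h; rewrite /E; have := ler_norm E0; lra.
pose c := (2 * y ^+ 2)^-1; have c0 : 0 < c by rewrite invr_gt0 mulr_gt0 // exprn_gt0.
pose S := nrm kp * M * E; have S0 : 0 <= S by rewrite /S !mulr_ge0 ?nrm_ge0 // ltW.
exists (K * M + M * (K * c ^+ 2) + (S + K) * (c * S + K * c ^+ 2) + nrm kp * M * M * E * (c / y)),
  (Num.min 1 (Num.min del (del / c))); split.
- have [M2 c2 E2 y2] : [/\ 0 <= M, 0 <= c, 0 <= E & 0 <= y] by split; exact: ltW.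
  have k0 := nrm_ge0 kp.
  by do ![apply: addr_ge0 => //|apply: mulr_ge0 => //|exact: exprn_ge0|rewrite invr_ge0].
- by rewrite !lt_min ltr01 d0 divr_gt0.
move=> z h yz yzh zB zhB; rewrite !le_min => /and3P[h1 hd hdc].
have n0 := nrm_ge0 h.
have z0 : 0 < Im z by exact: lt_le_trans yz.
have zh0 : 0 < Im (z + h) by exact: lt_le_trans yzh.
have zn : y <= nrm z by apply: le_trans (Im_le_nrm z); rewrite ger0_norm // ltW.
have zhn : y <= nrm (z + h) by apply: le_trans (Im_le_nrm (z + h)); rewrite ger0_norm // ltW.
have Wy w : y <= Im w -> nrm w <= B -> y1 <= Im (Wz w).
  move=> yw wB; have w0 : 0 < Im w by exact: lt_le_trans yw.
  rewrite Im_Wz; apply: (@le_trans _ _ (y / (2 * B1 ^+ 2))); first by rewrite ge_min lexx orbT.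
  have nw : 0 < nrm w by rewrite nrm_gt0 // Im_neq0.
  apply: ler_pM => //; first exact: ltW.
    by rewrite invr_ge0 mulr_ge0 // exprn_ge0 // ltW.
  rewrite lef_pV2 ?posrE ?mulr_gt0 ?exprn_gt0 // ler_wpM2l //; apply: lerXn2r; rewrite ?nnegrE ?(ltW nw) ?(ltW B10) //.
  by rewrite /B1; have := ler_norm B; lra.
have y1y : y1 <= y by rewrite ge_min lexx.
set k := Wz (z + h) - Wz z.
have zz : z != 0 by exact: Im_neq0.
have zzh : z + h != 0 by exact: Im_neq0.
have n2 : 2%:R != 0 :> C by rewrite pnatr_eq0.
have kE : k = h * (2%:R * z * (z + h))^-1 by rewrite /k /Wz; field; rewrite ?zz ?zzh ?n2.
have kn : nrm k <= c * nrm h.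
  rewrite kE nrmM mulrC; apply: ler_wpM2r => //; rewrite nrmV /c !nrmM nrm_nat -mulrA.
  apply: invr_le; first by rewrite mulr_gt0 // exprn_gt0.
  by apply: ler_wpM2l => //; rewrite expr2; apply: ler_pM => //; exact: ltW.
have k2 : k - h * (2%:R * z ^+ 2)^-1 = - (h ^+ 2 * (2%:R * z ^+ 2 * (z + h))^-1).
  by rewrite kE; field; rewrite ?zz ?zzh ?n2.
have k2n : nrm (k - h * (2%:R * z ^+ 2)^-1) <= c / y * nrm h ^+ 2.
  rewrite k2 nrmN nrmM nrmX mulrC; apply: ler_wpM2r; first exact: sqr_ge0.
  rewrite nrmV /c -invfM (nrmM _ (z + h)) (nrmM _ (z ^+ 2)) nrm_nat nrmX.
  apply: invr_le; first by rewrite mulr_gt0 // mulr_gt0 // exprn_gt0.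
  apply: ler_pM => //; first by rewrite mulr_ge0 // exprn_ge0 // ltW.
    exact: ltW.
  by apply: ler_wpM2l => //; apply: lerXn2r; rewrite ?nnegrE ?nrm_ge0 // ltW.
have kd : nrm k <= del.
  apply: le_trans kn _; by move: hdc; rewrite ler_pdivlMr // mulrC.
have W1 : Wz (z + h) = Wz z + k by rewrite /k [RHS]addrC subrK.
have yW := Wy z yz zB.
have := hK z h (le_trans y1y yz) zh0 hd.
have := hK (Wz z) k yW; rewrite -W1 => /(_ (Wz_gt0 zh0) kd).
have := hM z (le_trans y1y yz); have := hM (Wz z) yW.
have := hE z (le_trans y1y yz); have := hE (Wz z) yW.
have EI := Ez_inversion z0.
rewrite /Pm; move: EI.
set f := Fm z; set f' := Fm (Wz z); set g := Fm (z + h); set g' := Fm (Wz (z + h)).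
set e := Ez z; set e' := Ez (Wz z) => EI ne' ne nf' nf hb ha.
clearbody f f' g g' e e'.
have na : nrm (g - f) <= (S + K) * nrm h.
  have hh : nrm (h * (kp * f * e)) <= S * nrm h.
    rewrite mulrC nrmM; apply: ler_wpM2r => //; rewrite /S !nrmM.
    by apply: ler_pM; rewrite ?mulr_ge0 ?nrm_ge0 //; apply: ler_wpM2l; rewrite ?nrm_ge0.
  apply: le_trans (nrm_dist _ (h * (kp * f * e))) _; apply: le_trans (lerD hh ha) _.
  rewrite mulrDl lerD2l; apply: ler_wpM2l => //; rewrite expr2; nra.
have nb : nrm (g' - f') <= (c * S + K * c ^+ 2) * nrm h.
  have hh : nrm (k * (kp * f' * e')) <= S * (c * nrm h).
    rewrite mulrC nrmM; apply: ler_pM => //; rewrite ?nrm_ge0 // /S !nrmM.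
    by apply: ler_pM; rewrite ?mulr_ge0 ?nrm_ge0 //; apply: ler_wpM2l; rewrite ?nrm_ge0.
  apply: le_trans (nrm_dist _ (k * (kp * f' * e'))) _; apply: le_trans (lerD hh hb) _.
  have : K * nrm k ^+ 2 <= K * (c ^+ 2 * nrm h).
    apply: ler_wpM2l => //; apply: (@le_trans _ _ ((c * nrm h) ^+ 2)).
      by apply: lerXn2r; rewrite ?nnegrE ?nrm_ge0 // mulr_ge0 // ltW.
    rewrite exprMn; apply: ler_wpM2l; first exact: sqr_ge0.
    rewrite expr2; nra.
  by move: (K * nrm k ^+ 2) => x hx; rewrite mulrDl; lra.
(* The two linear parts combine through e = -e'/(2 z^2) into the last term, which is of second order
   because 1/(2 z^2) is the derivative of W. *)
have -> : g * g' - f * f' = (g - f - h * (kp * f * e)) * f' + f * (g' - f' - k * (kp * f' * e')) +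
   (g - f) * (g' - f') + kp * f * f' * e' * (k - h * (2%:R * z ^+ 2)^-1).
  by rewrite EI; ring.
apply: le_trans (nrmD _ _) _; rewrite [leRHS]mulrDl; apply: lerD; last first.
  rewrite nrmM -[leRHS]mulrA; apply: ler_pM; [exact: nrm_ge0|exact: nrm_ge0| |exact: k2n].
  rewrite !nrmM.
  by apply: ler_pM; rewrite ?mulr_ge0 ?nrm_ge0 //; apply: ler_pM; rewrite ?mulr_ge0 ?nrm_ge0 //; apply: ler_wpM2l; rewrite ?nrm_ge0.
apply: le_trans (nrmD _ _) _; rewrite [leRHS]mulrDl; apply: lerD; last first.
  rewrite nrmM.
  have -> : (S + K) * (c * S + K * c ^+ 2) * nrm h ^+ 2 = ((S + K) * nrm h) * ((c * S + K * c ^+ 2) * nrm h) by ring.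
  by apply: ler_pM; rewrite ?nrm_ge0.
apply: le_trans (nrmD _ _) _; rewrite [leRHS]mulrDl; apply: lerD.
  by rewrite nrmM [leRHS]mulrAC; apply: ler_pM; [exact: nrm_ge0|exact: nrm_ge0|exact: ha|exact: nf'].
rewrite nrmM -[leRHS]mulrA; apply: ler_pM; [exact: nrm_ge0|exact: nrm_ge0|exact: nf|]; apply: le_trans hb _.
rewrite -[leRHS]mulrA; apply: ler_wpM2l => //; rewrite -exprMn; apply: lerXn2r; rewrite ?nnegrE ?nrm_ge0 //.
by rewrite mulr_ge0 // ltW.
Qed.

(** The segment is cut into n + 1 equal steps; each changes [Pm] by O(1/n^2), so the total change is
    O(1/n). *)
Lemma Pm_cst z0 z1 : 0 < Im z0 -> 0 < Im z1 -> Pm z0 = Pm z1.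
Proof.
move=> i0 i1; pose y := Num.min (Im z0) (Im z1); pose B := nrm z0 + nrm z1.
have y0 : 0 < y by rewrite lt_min i0.
have [K [del [K0 d0 hK]]] := Pm_step B y0.
pose d := z1 - z0.
pose pt (s : R) : C := z0 + s%:C * d.
have ptE s : pt s = (1 - s)%:C * z0 + s%:C * z1 by rewrite /pt /d rmorphB rmorph1; ring.
have ptI s : 0 <= s -> s <= 1 -> y <= Im (pt s).
  move=> s0 s1; rewrite ptE cImD !cImM /= !mul0r !addr0.
  have a0 : y <= Im z0 by rewrite ge_min lexx.
  have a1 : y <= Im z1 by rewrite ge_min lexx orbT.
  have e : y = (1 - s) * y + s * y by ring.
  rewrite [leLHS]e; apply: lerD; apply: ler_wpM2l => //; lra.
have ptB s : 0 <= s -> s <= 1 -> nrm (pt s) <= B.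
  move=> s0 s1; rewrite ptE; apply: le_trans (nrmD _ _) _; rewrite !nrmM !nrmR.
  rewrite (ger0_norm s0) ger0_norm; last lra.
  have := nrm_ge0 z0; have := nrm_ge0 z1; rewrite /B; nra.
have [N hN] := null_inv (nrm d) d0.
have key n : (N <= n)%N -> nrm (Pm z1 - Pm z0) <= K * nrm d ^+ 2 / n.+1%:R.
  move=> Nn; have n0 : 0 < n.+1%:R :> R by rewrite ltr0n.
  have nz : n.+1%:R != 0 :> R by rewrite gt_eqF.
  have step : forall i, (i <= n.+1)%N -> nrm (Pm (pt (i%:R / n.+1%:R)) - Pm z0) <= i%:R * (K * (nrm d / n.+1%:R) ^+ 2).
    elim=> [|i IH] iN; first by rewrite !mul0r /pt rmorph0 mul0r addr0 subrr nrm0.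
    have s0 : 0 <= i%:R / n.+1%:R :> R by rewrite divr_ge0.
    have s1 : i%:R / n.+1%:R <= 1 :> R by rewrite ler_pdivrMr // mul1r ler_nat ltnW.
    have t0 : 0 <= i.+1%:R / n.+1%:R :> R by rewrite divr_ge0.
    have t1 : i.+1%:R / n.+1%:R <= 1 :> R by rewrite ler_pdivrMr // mul1r ler_nat.
    pose h := (n.+1%:R^-1 : R)%:C * d.
    have eh : pt (i.+1%:R / n.+1%:R) = pt (i%:R / n.+1%:R) + h.
      rewrite /pt /h -addrA; congr (_ + _); rewrite -mulrDl -rmorphD; congr (_%:C * _).
      by rewrite -natr1 mulrDl mul1r.
    have nh : nrm h = nrm d / n.+1%:R by rewrite /h nrmM nrmR ger0_norm ?invr_ge0 // mulrC.
    have hs : nrm (Pm (pt (i.+1%:R / n.+1%:R)) - Pm (pt (i%:R / n.+1%:R))) <= K * (nrm d / n.+1%:R) ^+ 2.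
      rewrite eh -nh; apply: hK; rewrite -?eh; [exact: ptI|exact: ptI|exact: ptB|exact: ptB|].
      rewrite nh; apply: ltW; apply: le_lt_trans (hN n Nn); exact: ler_norm.
    have -> : Pm (pt (i.+1%:R / n.+1%:R)) - Pm z0 = (Pm (pt (i%:R / n.+1%:R)) - Pm z0) + (Pm (pt (i.+1%:R / n.+1%:R)) - Pm (pt (i%:R / n.+1%:R))) by rewrite [RHS]addrC addrA subrK.
    apply: le_trans (nrmD _ _) _.
    have -> : i.+1%:R * (K * (nrm d / n.+1%:R) ^+ 2) = i%:R * (K * (nrm d / n.+1%:R) ^+ 2) + K * (nrm d / n.+1%:R) ^+ 2.
      by rewrite -natr1 mulrDl mul1r.
    exact: lerD (IH (ltnW iN)) hs.
  have := step n.+1 (leqnn _); rewrite divff // /pt rmorph1 mul1r /d [z0 + _]addrC subrK => hh.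
  apply: le_trans hh _; rewrite le_eqVlt; apply/orP; left; apply/eqP.
  by rewrite expr2; field.
have : nrm (Pm z1 - Pm z0) = 0.
  apply: (@null_ub _ _ (fun n => K * nrm d ^+ 2 / (N + n).+1%:R)).
    apply: null_le (null_inv (K * nrm d ^+ 2)); exists 0%N => n _.
    have p : 0 <= K * nrm d ^+ 2 by rewrite mulr_ge0 // sqr_ge0.
    rewrite ger0_norm ?divr_ge0 //; apply: ler_wpM2l => //.
    by rewrite lef_pV2 ?posrE ?ltr0n // ler_nat ltnS leq_addl.
  by move=> n; rewrite ger0_norm ?nrm_ge0 //; apply: key; exact: leq_addr.
by move/nrm_eq0/eqP; rewrite subr_eq0 eq_sym => /eqP.
Qed.

Lemma ev_real c (x : R) : good c -> `|x| < 1 -> Im (ev c x%:C) = 0.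
Proof.
move=> gc x1; have x1' : nrm (x%:C : C) < 1 by rewrite nrmR.
have h := evP gc x1'; apply: (null_ub h) => n.
apply: le_trans (_ : `|Im (psum (term c x%:C) n - ev c x%:C)| <= _); last exact: Im_le_nrm.
have -> : Im (psum (term c x%:C) n - ev c x%:C) = - Im (ev c x%:C).
  rewrite cImD cImN /psum cIm_sum big1 ?add0r // => i _.
  by rewrite /term -rmorphXn -rmorphM /=.
by rewrite normrN.
Qed.

(** On the imaginary axis t is real, so F is real there; W exchanges i and i/2, and F has no zero
    since F G = 1. Reality of the constant is used in [k_sqr]. *)
Lemma Pm_real : exists2 k : R, k != 0 & forall z, 0 < Im z -> Pm z = k%:C.
Proof.
have r y : 0 < y -> Fm (0 +i* y) = (Re (Fm (0 +i* y)))%:C.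
  move=> y0; have t0 : 0 < Im (0 +i* y : C) by [].
  rewrite Fm_ev //.
  have -> : tz (0 +i* y) = (expR (- (pi / 6 * y)))%:C.
    have -> : tz (0 +i* y) = cexp ((- (pi / 6 * y))%:C).
      rewrite /tz /ee; congr cexp.
      have -> : (0 +i* y) / 12%:R = (12^-1 : R)%:C * (0 +i* y) by rewrite fmorphV rmorph_nat mulrC.
      by apply: complex_ext; rewrite (ReIpi, ImIpi) (cReM, cImM) /=; field.
    by apply: complex_ext; rewrite /cexp /= ?cos0 ?sin0 ?mulr1 ?mulr0.
  apply: complex_ext => //=; rewrite ev_real //; first exact: good_fR.
  by rewrite ger0_norm ?expR_ge0 // expR_lt1.
have i0 : 0 < Im (0 +i* 1 : C) by rewrite /= ltr01.
have W0 : Wz (0 +i* 1 : C) = 0 +i* (1/2).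
  apply: (mulfI (_ : 2%:R * (0 +i* 1 : C) != 0)).
    by rewrite mulf_neq0 ?pnatr_eq0 // Im_neq0.
  rewrite /Wz mulrN divff ?mulf_neq0 ?pnatr_eq0 ?Im_neq0 //.
  have -> : 2%:R = (2 : R)%:C :> C by rewrite (rmorph_nat (real_complex R) 2).
  by apply: complex_ext; rewrite !(cReM, cImM) /=; lra.
exists (Re (Fm (0 +i* 1)) * Re (Fm (0 +i* (1/2)))).
  have f1 := Fm_neq0 i0; have f2 := Fm_neq0 (Wz_gt0 i0); rewrite W0 in f2.
  have h2 : 0 < 1/2 :> R by lra.
  by apply: mulf_neq0; apply/eqP => e; [move: f1|move: f2]; rewrite r ?ltr01 // e eqxx.
move=> z z0; have e1 := r 1 ltr01; have h2 : 0 < 1/2 :> R by lra.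
rewrite (Pm_cst z0 i0) /Pm W0.
exact: etrans (f_equal2 (fun a b : C => a * b) e1 (r _ h2)) (esym (rmorphM _ _ _)).
Qed.

End EtaQuotient.

(** * Modularity under integer matrices and the vanishing lemma *)

Section Congruences.
Implicit Types a b c d s x : int.

Lemma int_mod2 a : exists x, a = 2 * x \/ a = 2 * x + 1.
Proof. by exists (a %/ 2)%Z; lia. Qed.
Lemma int_mod3 a : exists x, [\/ a = 3 * x, a = 3 * x + 1 | a = 3 * x - 1].
Proof.
have := divz_eq a 3; have := modz_ge0 a (isT : (3 : int) != 0); have := ltz_pmod a (isT : (0 : int) < 3).
move: (a %/ 3)%Z (a %% 3)%Z => q r h1 h2 ->.
have : r = 0 \/ r = 1 \/ r = 2 by lia.
by case=> [->|[->|->]]; [exists q; apply: Or31|exists q; apply: Or32|exists (q + 1); apply: Or33]; ring.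
Qed.

Lemma det_odd a b c d : a * d - 2 * b * c = 1 -> exists x, a = 2 * x + 1.
Proof.
move=> h; have [x [e|e]] := int_mod2 a; last by exists x.
have : 2 * (x * d - b * c) = 1 by rewrite -[RHS]h e; ring.
by move: (x * d - b * c) => y; lia.
Qed.

Lemma det_mod3 a b c d x y : a * d - 2 * b * c = 1 -> a = 3 * x -> b = 3 * y -> False.
Proof.
move=> h e1 e2; have : 3 * (x * d - 2 * y * c) = 1 by rewrite -[RHS]h e1 e2; ring.
by move: (x * d - 2 * y * c) => z; lia.
Qed.

(** x (x + 1) is a multiple of 3 unless x = 1 modulo 3. Then 3 divides 2 x + 1, hence not c, and 2
    c^2 + 1 is a multiple of 3. *)
Lemma mod3_factor x c : (forall y z, 2 * x + 1 = 3 * y -> c = 3 * z -> False) ->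
  exists u, x * (x + 1) * (2 * c ^+ 2 + 1) = 3 * u.
Proof.
move=> h; have [y [e|e|e]] := int_mod3 x.
- by exists (y * (x + 1) * (2 * c ^+ 2 + 1)); rewrite {1}e; ring.
- have [z [e2|e2|e2]] := int_mod3 c.
  + by exfalso; apply: (h (2 * y + 1) z) => //; rewrite e; ring.
  + by exists (x * (x + 1) * (6 * z ^+ 2 + 4 * z + 1)); rewrite e2; ring.
  + by exists (x * (x + 1) * (6 * z ^+ 2 - 4 * z + 1)); rewrite e2; ring.
- by exists (x * y * (2 * c ^+ 2 + 1)); rewrite {2}e; ring.
Qed.

(* F(gamma z) = zeta_12^(mult_exp a b c d) F(z) for gamma = ((a, b), (2c, d)). *)
Definition mult_exp a b c d : int := (2 * d - a) * c + b * d * (2 * c ^+ 2 + 1).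

(** With d = 2 x + 1 the defect is 4 s x (x + 1)(2 c^2 + 1), and [mod3_factor] supplies the missing
    factor 3. *)
Lemma mult_expT a b c d s : a * d - 2 * b * c = 1 ->
  exists l, mult_exp (a + 2 * s * c) (b + s * d) c d = mult_exp a b c d + s + 12 * l.
Proof.
move=> h; have h' : d * a - 2 * c * b = 1 by rewrite -[RHS]h; ring.
have [x e] := det_odd h'.
have [u hu] : exists u, x * (x + 1) * (2 * c ^+ 2 + 1) = 3 * u.
  by apply: mod3_factor => y z e1 e2; apply: (det_mod3 h') e2; rewrite e e1.
exists (s * u); have -> : 12 * (s * u) = 4 * s * (3 * u) by ring.
by rewrite -hu /mult_exp e; ring.
Qed.

Lemma mult_expL a b c d s : a * d - 2 * b * c = 1 -> s * s = 1 ->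
  exists l, mult_exp a b (c + s * a) (d + 2 * s * b) = mult_exp a b c d + s + 12 * l.
Proof.
move=> h ss; have [x e] := det_odd h.
have [u hu] : exists u, x * (x + 1) * (2 * b ^+ 2 + 1) = 3 * u.
  by apply: mod3_factor => y z e1 e2; apply: (det_mod3 h) e2; rewrite e e1.
have [w hw] : exists w, b * (s * b + a) = 2 * w.
  have hs : s = 1 \/ s = -1 by nia.
  have [y [eb|eb]] := int_mod2 b; first by exists (y * (s * b + a)); rewrite {1}eb; ring.
  by case: hs => ->; [exists (b * (y + x + 1))|exists (b * (x - y))]; rewrite e {2}eb; ring.
exists (s * (2 * u - x * (x + 1)) + w + (s * b * c + s * b ^+ 2 * c ^+ 2 + a * b ^+ 2 * c)).
have -> : 12 * (s * (2 * u - x * (x + 1)) + w + (s * b * c + s * b ^+ 2 * c ^+ 2 + a * b ^+ 2 * c)) =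
  8 * s * (3 * u) - 12 * s * (x * (x + 1)) + 6 * (2 * w) + 12 * (s * b * c + s * b ^+ 2 * c ^+ 2 + a * b ^+ 2 * c) by ring.
rewrite -hu -hw /mult_exp.
(* Explicit multiples of s * s - 1 and of the determinant relation turn the claim into a polynomial
   identity. *)
have -> : (2 * (d + 2 * s * b) - a) * (c + s * a) + b * (d + 2 * s * b) * (2 * (c + s * a) ^+ 2 + 1) =
  (2 * d - a) * c + b * d * (2 * c ^+ 2 + 1) + s * (2 - a ^+ 2 + 12 * b * c + 12 * b ^+ 2 * c ^+ 2 + 4 * a ^+ 2 * b ^+ 2 + 2 * b ^+ 2)
   + 6 * a * b + 12 * a * b ^+ 2 * c
   + (s * s - 1) * (6 * a * b + 12 * a * b ^+ 2 * c + 4 * s * a ^+ 2 * b ^+ 2)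
   + (a * d - 2 * b * c - 1) * (s * (2 + 4 * b * c) + 2 * s * s * a * b) by ring.
by rewrite ss h !subrr !mul0r !addr0 e; ring.
Qed.

End Congruences.

(** * The transformation law of F under integer matrices *)

Section Modularity.
Variable R : realType.
Notation C := R[i].
Implicit Types (z w v : C) (a b c d s : int).
Variable k : R.
Hypothesis k0 : k != 0.
Hypothesis hk : forall z, 0 < Im z -> Pm z = k%:C.

Definition zeta (n : int) : C := ee (n%:~R / 12%:R).
Lemma zetaD m n : zeta (m + n) = zeta m * zeta n.
Proof. by rewrite /zeta rmorphD mulrDl eeD. Qed.
Lemma zeta0 : zeta 0 = 1. Proof. by rewrite /zeta mul0r ee0. Qed.
Lemma zeta_neq0 n : zeta n != 0. Proof. exact: ee_neq0. Qed.
Lemma zeta12 n : zeta (12 * n) = 1.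
Proof. by rewrite /zeta rmorphM /= mulrAC divff ?mul1r ?ee_int // pnatr_eq0. Qed.

Lemma Fm_T z s : Fm (z + s%:~R) = zeta s * Fm z.
Proof. by rewrite /Fm tzD eeD ee_int mulr1 /tz /zeta; ring. Qed.

Lemma kC0 : k%:C != 0 :> C. Proof. by rewrite fmorph_eq0. Qed.
Lemma Fm_W z : 0 < Im z -> Fm (Wz z) = k%:C * Gm z.
Proof.
move=> z0; rewrite GmE //; apply: (mulfI (Fm_neq0 z0)); rewrite [RHS]mulrCA divff ?Fm_neq0 // mulr1.
exact: hk.
Qed.
Lemma Im_addz z s : Im (z + s%:~R) = Im z.
Proof. by rewrite cImD -(rmorph_int (real_complex R)) /= addr0. Qed.

(** The map v/(2 s v + 1) is the translation by -s conjugated by W. Both inversions pass through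
    1/F, so C cancels and the multiplier is that of the translation by s. *)
Lemma Fm_L v s : 0 < Im v -> let v' := Wz (Wz v - s%:~R) in
  [/\ 0 < Im v', v' * (2%:R * s%:~R * v + 1) = v & Fm v' = zeta s * Fm v].
Proof.
move=> v0 v'; have w0 := Wz_gt0 v0.
have e : Wz v - s%:~R = Wz v + (- s)%:~R by rewrite rmorphN.
have u0 : 0 < Im (Wz v - s%:~R) by rewrite e Im_addz.
have n2 : 2%:R != 0 :> C by rewrite pnatr_eq0.
have vn := Im_neq0 v0; have un := Im_neq0 u0.
split; first exact: Wz_gt0.
  have e2 : 2%:R * s%:~R * v + 1 = - (2%:R * v) * (Wz v - s%:~R).
    rewrite /Wz; field; by rewrite ?vn ?n2.
  by rewrite e2 /v' {1}/Wz; move: un; move: (Wz v - _) => u un; field; rewrite ?un ?n2.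
rewrite /v' (Fm_W u0) (GmE u0) e Fm_T (Fm_W v0) (GmE v0) invfM.
have z1 : zeta s * zeta (- s) = 1 by rewrite -zetaD subrr zeta0.
have f0 := Fm_neq0 v0; have k1 := kC0.
move: (zeta_neq0 (- s)) z1; move: (zeta s) (zeta _) (Fm v) (k%:C) f0 k1 => p q f kk f0 k1 q0 pq.
have -> : p = q^-1 by apply: (mulIf q0); rewrite pq mulVf.
by rewrite invfM invrK; field; rewrite ?q0 ?k1.
Qed.

Lemma mult_unit a d : a * d = 1 -> (a = 1 /\ d = 1) \/ (a = -1 /\ d = -1).
Proof.
move=> h; have d0 : d <> 0 by move=> e; rewrite e mulr0 in h.
have dd : d >= 1 \/ d <= -1 by lia.
have [e|[e|[e|[e|e]]]] : a = 0 \/ 2 <= a \/ a <= -2 \/ a = 1 \/ a = -1 by lia.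
- by rewrite e mul0r in h.
- by nia.
- by nia.
- by left; split=> //; rewrite e mul1r in h.
- by right; split=> //; rewrite e mulN1r in h; lia.
Qed.

(* Euclid's algorithm on (a, 2c), with steps z + s and z/(2sz + 1). *)
Lemma Fm_mob a b c d w v : a * d - 2 * b * c = 1 -> 0 < Im w -> 0 < Im v ->
  v * (2%:R * c%:~R * w + d%:~R) = a%:~R * w + b%:~R ->
  Fm v = zeta (mult_exp a b c d) * Fm w.
Proof.
have [N] := ubnP (`|a| + 2 * `|c|)%N.
elim: N a b c d w v => // N IH a b c d w v; rewrite ltnS => hN det w0 v0 rel.
have [x ao] := det_odd det.
have [c0|c0] := eqVneq c 0.
  have /mult_unit ad : a * d = 1 by rewrite -[RHS]det c0 mulr0 subr0.
  have -> : mult_exp a b c d = b * d by rewrite /mult_exp c0; ring.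
  suff -> : v = w + (b * d)%:~R by rewrite Fm_T.
  move: rel; rewrite c0 mulr0 mul0r add0r; case: ad => [[-> ->]|[-> ->]].
    by rewrite !mulr1 mul1r.
  have e1 : (-1 : int)%:~R = -1 :> C by [].
  by rewrite e1 [v * _]mulrN1 mulN1r => h; rewrite mulrN1 rmorphN /= -[v]opprK h opprD opprK.
have close s e' l : e' = mult_exp a b c d + s + 12 * l -> zeta s * Fm v = zeta e' * Fm w ->
    Fm v = zeta (mult_exp a b c d) * Fm w.
  move=> ->; rewrite !zetaD zeta12 mulr1 => h; apply: (mulfI (zeta_neq0 s)); rewrite h; ring.
have [ac|ac] := ltnP (2 * `|c|)%N `|a|%N.
  pose s : int := if 0 < a then (if 0 < c then -1 else 1) else if 0 < c then 1 else -1.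
  have dec : (absz (a + 2 * s * c)%R < absz a)%N.
    by rewrite /s; case: ltrP => h1; case: ltrP => h2; lia.
  have [l hl] := mult_expT s det.
  apply: (close s _ l hl); rewrite -Fm_T; apply: (IH _ _ c d) => //.
  - by apply: leq_trans hN; rewrite ltn_add2r.
  - by rewrite -[RHS]det; ring.
  - by rewrite Im_addz.
  by rewrite mulrDl rel !rmorphD !rmorphM /=; ring.
(* a is odd, so |a| = 2 |c| is impossible and one of the two steps always makes progress. *)
have aN : (0 < `|a| < 2 * `|c|)%N by lia.
pose s : int := if 0 < a then (if 0 < c then -1 else 1) else if 0 < c then 1 else -1.
have ss : s * s = 1 by rewrite /s; case: ifP => _; case: ifP.
have dec : (absz (c + s * a)%R < absz c)%N.
  by rewrite /s; case: ltrP => h1; case: ltrP => h2; lia.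
have [l hl] := mult_expL det ss.
have [v'0 v'r v'F] := Fm_L s v0.
apply: (close s _ l hl); rewrite -v'F; apply: (IH a b _ _) => //.
- apply: leq_trans hN; lia.
- by rewrite -[RHS]det; ring.
rewrite -rel -{2}v'r; set v' := Wz _.
have -> : 2%:R * (c + s * a)%:~R * w + (d + 2 * s * b)%:~R = (2%:R * c%:~R * w + d%:~R) + 2%:R * s%:~R * (a%:~R * w + b%:~R) :> C.
  by rewrite !rmorphD !rmorphM /=; ring.
by rewrite -rel; ring.
Qed.

End Modularity.

(** * Contraction of bounds on the half-plane *)

Section Vanishing.
Variable R : realType.
Notation C := R[i].
Implicit Types (z : C) (t : C).

(** After translation |Re z| <= 1/2. If also Im z < 2/5, then 2 |z|^2 <= 41/50 < 5/6, so W
    multiplies Im z by at least 6/5. The corners of the fundamental domain have height 1/2; stopping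
    at 2/5 leaves room for a uniform factor. *)
Lemma strip_reduction (Q : C -> Prop) :
  (forall z (n : int), 0 < Im z -> Q (z + n%:~R) -> Q z) ->
  (forall z, 0 < Im z -> Q (Wz z) -> Q z) ->
  (forall z, 2/5 <= Im z -> Q z) -> forall z, 0 < Im z -> Q z.
Proof.
move=> hT hW hD.
have step m : forall z, 0 < Im z -> 2/5 <= Im z * (6/5) ^+ m -> Q z.
  elim: m => [|m IH] z z0 hz; first by apply: hD; rewrite expr0 mulr1 in hz.
  have [yz|yz] := lerP (2/5) (Im z); first exact: hD.
  pose n : int := - Num.floor (Re z + 1/2).
  apply: (hT _ n) => //; set z' := z + _.
  have iz : Im z' = Im z by rewrite /z' Im_addz.
  have rz : -(1/2) <= Re z' /\ Re z' <= 1/2.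
    have -> : Re z' = Re z + n%:~R by rewrite /z' cReD -(rmorph_int (real_complex R)).
    have := floor_le_tmp (Re z + 1/2); have := floorD1_gt (Re z + 1/2).
    by rewrite /n rmorphN /= rmorphD rmorph1 /=; move: (Num.floor _)%:~R => f; lra.
  have z'0 : 0 < Im z' by rewrite iz.
  apply: hW => //; apply: IH; first exact: Wz_gt0.
  apply: le_trans hz _; rewrite exprS mulrA; apply: ler_wpM2r; first by apply: exprn_ge0; lra.
  rewrite Im_Wz sqr_nrm -iz ler_pdivlMr; last first.
    by rewrite mulr_gt0 // ltr_wpDl ?sqr_ge0 // exprn_gt0.
  have : Re z' ^+ 2 <= 1/4 by rewrite expr2; case: rz => a b; nra.
  have : Im z' ^+ 2 <= 4/25 by rewrite iz expr2; nra.
  move=> h1 h2; rewrite -mulrA -[leRHS]mulr1; apply: ler_wpM2l; [exact: ltW|lra].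
move=> z z0.
have h0 : 0 < Im z * (5/2) by lra.
have r0 : 0 <= 5/6 :> R by lra.
have r1 : 5/6 < 1 :> R by lra.
have [m hm] := null_geom r0 r1 h0.
apply: (step m) => //; have := hm m (leqnn m); rewrite ger0_norm ?exprn_ge0 // => h.
have e : (5/6) ^+ m * (6/5) ^+ m = 1 :> R.
  by rewrite -exprMn (_ : 5/6 * (6/5) = 1 :> R) ?expr1n //; lra.
have p0 : 0 < (6/5) ^+ m :> R by apply: exprn_gt0; lra.
have : (5/6) ^+ m * (6/5) ^+ m <= Im z * (5/2) * (6/5) ^+ m by apply: ler_wpM2r; exact: ltW.
rewrite e; lra.
Qed.

Definition in_class (r : nat) (c : nat -> R) := forall n, c n != 0 -> (n %% 12)%N = r.

Lemma ev_class c r (u t : C) : good c -> in_class r c -> u ^+ 12 = 1 -> nrm u = 1 -> nrm t < 1 ->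
  ev c (t * u) = u ^+ r * ev c t.
Proof.
move=> gc cr u12 u1 t1; apply: ev_eq; apply: eq_clim (climZ (u ^+ r) (evP gc t1)) => n.
rewrite /psum mulr_sumr; apply: eq_bigr => i _; rewrite /term.
have [->|ci] := eqVneq (c i) 0; first by rewrite !mul0r mulr0.
have ui : u ^+ i = u ^+ r.
  by rewrite (divn_eq i 12) exprD [(i %/ 12 * 12)%N]mulnC exprM u12 expr1n mul1r (cr _ ci).
by rewrite exprMn ui; ring.
Qed.

Lemma nrm_ev_T c r z (n : int) : good c -> in_class r c -> 0 < Im z ->
  nrm (ev c (tz (z + n%:~R))) = nrm (ev c (tz z)).
Proof.
move=> gc cr z0; rewrite tzD (@ev_class _ r) ?nrm_tz_lt1 //; last first.
- have -> : tz (n%:~R : C) = ee ((n%:~R / 12 : R)%:C).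
    by rewrite /tz rmorphM fmorphV rmorph_nat (rmorph_int (real_complex R)).
  exact: nrm_ee_real.
- by rewrite tz12 ee_int.
rewrite nrmM nrmX.
have -> : nrm (tz (n%:~R : C)) = 1.
  have -> : tz (n%:~R : C) = ee ((n%:~R / 12 : R)%:C).
    by rewrite /tz rmorphM fmorphV rmorph_nat (rmorph_int (real_complex R)).
  exact: nrm_ee_real.
by rewrite expr1n mul1r.
Qed.

(** Cauchy's estimate on the circles |t| = exp(-1/(m + 1)), whose radius tends to 1. *)
Lemma coef_le_sup c (B : R) : good c -> (forall z, 0 < Im z -> nrm (ev c (tz z)) <= B) -> forall n, `|c n| <= B.
Proof.
move=> gc hB n; apply: (null_le_lim (null_inv (`|c n| * n%:R))) => m.
pose x : R := m.+1%:R^-1; have x0 : 0 < x by rewrite invr_gt0 ltr0n.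
have p0 := pi_gt0 R.
pose z : C := 0 +i* (6 * x / pi).
have z0 : 0 < Im z by rewrite /=; apply: divr_gt0 => //; lra.
have nt : nrm (tz z) = expR (- x).
  rewrite nrm_tz /=; congr (expR (- _)).
  by move: (x) (pi : R) (lt0r_neq0 p0) => x1 P Pn; field.
have := @coef_bound R c (tz z) B n gc (nrm_tz_lt1 z0); rewrite nt => /(_ _)/Wrap[].
  move=> s; have -> : tz z * ee s%:C = tz (z + (12 * s)%:C).
    rewrite tzD; congr (_ * _); rewrite /tz rmorphM rmorph_nat; congr ee.
    by rewrite mulrAC divff ?mul1r // pnatr_eq0.
  by apply: hB; rewrite cImD /= addr0.
move=> h; have e1 : 1 - n%:R * x <= expR (- x) ^+ n.
  by rewrite -expRM_natl; apply: le_trans (expR_ge1Dx _); rewrite mulrN.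
have := ler_wpM2l (normr_ge0 (c n)) e1; rewrite mulrBr mulr1 -/x => h2.
have -> : `|c n| * n%:R / m.+1%:R = `|c n| * (n%:R * x) by rewrite mulrA.
lra.
Qed.

(** At height 2/5, pi > 3 gives |t| <= exp(-1/5), and squaring exp(1/10) >= 11/10 gives 121/100. The
    twelfth power is reached by repeated squaring with rounding. *)
Lemma theta_bound y : 2/5 <= y -> let r := expR (- (pi / 6 * y)) in
  [/\ 0 <= r, r <= 100/121 & r ^+ 12 <= 1/9 :> R].
Proof.
move=> hy r; have p3 := pi_gt3 R.
have r0 : 0 <= r := expR_ge0 _.
have h1 : r <= expR (- (1/5)).
  rewrite ler_expR lerN2; have : 3 / 6 * (2/5) <= pi / 6 * y.
    by apply: ler_pM; lra.
  lra.
have h2 : (11/10) ^+ 2 <= expR (1/5) :> R.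
  have -> : 1/5 = 2%:R * (1/10) :> R by lra.
  have a0 : 0 <= 11/10 :> R by lra.
  rewrite expRM_natl; apply: lerXn2r; rewrite ?nnegrE ?expR_ge0 //.
  by apply: le_trans (expR_ge1Dx _); lra.
have h3 : r <= 100/121.
  apply: le_trans h1 _; rewrite expRN -[leRHS]invrK; apply: invr_le; first by lra.
  by apply: le_trans h2; rewrite expr2; lra.
split=> //.
have a2 : r ^+ 2 <= 684/1000 by rewrite expr2; nra.
have b2 : 0 <= r ^+ 2 by exact: sqr_ge0.
have a4 : r ^+ 4 <= 468/1000 by rewrite (exprM r 2 2) expr2; nra.
have b4 : 0 <= r ^+ 4 by exact: exprn_ge0.
have a8 : r ^+ 8 <= 220/1000 by rewrite (exprM r 4 2) expr2; nra.
have b8 : 0 <= r ^+ 8 by exact: exprn_ge0.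
by rewrite (exprD r 8 4); nra.
Qed.

(** Each block of 12 exponents contains one term, and r > 0 gives an extra factor |t|. Hence the
    bound B |t|/(1 - |t|^12), at most (100/121)(9/8) B < (19/20) B. *)
Lemma ev_improve c r (B : R) z : good c -> in_class r c -> (0 < r < 12)%N ->
  (forall n, `|c n| <= B) -> 2/5 <= Im z -> nrm (ev c (tz z)) <= 19/20 * B.
Proof.
move=> gc cr /andP[r0 r12] hB hz; have z0 : 0 < Im z by lra.
have [q0 q1 q12] := theta_bound hz; rewrite -nrm_tz in q0 q1 q12.
set q := nrm (tz z) in q0 q1 q12.
have B0 : 0 <= B by apply: le_trans (hB 0%N).
have t1 := nrm_tz_lt1 z0.
have sub : forall n, (n <= 12 * n)%N by move=> n; lia.
apply: (clim_nrm_le (clim_sub sub (evP gc t1))) => N /=.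
apply: le_trans (nrm_sum _ _ _) _; rewrite sum_blocks.
apply: (@le_trans _ _ (\sum_(0 <= k < N) B * q * (q ^+ 12) ^+ k)).
  apply: ler_sum => k _; rewrite (bigD1_seq r) ?mem_index_iota ?iota_uniq //= big_nat_cond big1 ?addr0.
    rewrite nrm_term -/q -[leRHS]mulrA; apply: ler_pM => //; first exact: exprn_ge0.
    rewrite exprD exprM mulrC; apply: ler_wpM2r; first by rewrite !exprn_ge0.
    rewrite -[leRHS]expr1; apply: ler_wiXn2l => //; lra.
  move=> j /andP[/andP[_ j12] jr]; rewrite nrm_term.
  have [->|cj] := eqVneq (c (12 * k + j)%N) 0; first by rewrite normr0 mul0r.
  by have := cr _ cj; rewrite mulnC modnMDl modn_small // => e; rewrite e eqxx in jr.
rewrite -mulr_sumr.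
have q12' : 0 <= q ^+ 12 by exact: exprn_ge0.
have gs : \sum_(0 <= i < N) (q ^+ 12) ^+ i <= 9/8.
  apply: le_trans (geom_sum_le 0 N q12' _) _; first lra.
  by rewrite expr0 mul1r -[leRHS]invrK; apply: invr_le; lra.
apply: le_trans (ler_wpM2l _ gs) _; first by rewrite mulr_ge0.
have : B * q <= B * (100/121) by apply: ler_wpM2l.
lra.
Qed.

(* A bound B for both series on the upper half-plane bounds their coefficients, which improves the bound to
   19/20 B on Im z >= 2/5; this region meets every orbit under z + 1 and -1/(2z). *)
Lemma vanishing c d r r' : good c -> good d -> in_class r c -> in_class r' d ->
  (0 < r < 12)%N -> (0 < r' < 12)%N ->
  (forall z, 0 < Im z -> ev c (tz (Wz z)) = ev d (tz z)) -> forall n, c n = 0.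
Proof.
move=> gc gd cr dr r0 r'0 hcd.
have hdc z : 0 < Im z -> ev d (tz (Wz z)) = ev c (tz z) by move=> z0; have := hcd _ (Wz_gt0 z0); rewrite (WzK z0) => ->.
pose Q (B : R) z := nrm (ev c (tz z)) <= B /\ nrm (ev d (tz z)) <= B.
have red (B : R) : (forall z, 2/5 <= Im z -> Q B z) -> forall z, 0 < Im z -> Q B z.
  move=> hD; apply: (strip_reduction (Q := Q B)); [|move=> z|exact: hD].
    move=> z n z0 [h1 h2]; split; first by rewrite -(nrm_ev_T n gc cr z0).
    by rewrite -(nrm_ev_T n gd dr z0).
  by move=> z0; rewrite /Q (hcd _ z0) (hdc _ z0) => -[h1 h2]; split.
have [B hB] : exists B : R, forall z, 0 < Im z -> Q B z.
  have r1 : expR (- (pi / 6 * (2/5))) < 1 :> R by apply: expR_lt1; lra.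
  have [K1 h1] := ev_bounded gc (expR_ge0 _) r1.
  have [K2 h2] := ev_bounded gd (expR_ge0 _) r1.
  exists (Num.max K1 K2); apply: red => z hz; split; rewrite le_max.
    by rewrite h1 // nrm_tz_le.
  by rewrite h2 ?orbT // nrm_tz_le.
have it m : forall z, 0 < Im z -> Q ((19/20) ^+ m * B) z.
  elim: m => [|m IH]; first by rewrite expr0 mul1r.
  rewrite exprS -mulrA; apply: red => z hz; split.
    by apply: (ev_improve gc cr r0 _ hz); apply: coef_le_sup => // w /IH[].
  by apply: (ev_improve gd dr r'0 _ hz); apply: coef_le_sup => // w /IH[].
move=> n; have s0 : 0 <= 19/20 :> R by lra.
have s1 : 19/20 < 1 :> R by lra.
apply: (null_ub (nullZ B (null_geom s0 s1))) => m.
by rewrite mulrC; apply: coef_le_sup => // z /(it m)[].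
Qed.

End Vanishing.

(** * Hecke operators on powers of F *)

Section Powers.
Variable R : realType.
Notation C := R[i].
Implicit Types (c d : nat -> R) (z : C).

Definition isint c := forall n, c n \is a Num.int.

Lemma isint_conv c d : isint c -> isint d -> isint (conv c d).
Proof. by move=> hc hd n; apply: rpred_sum => i _; apply: rpredM. Qed.
Lemma isint_shift m c : isint c -> isint (shift m c).
Proof. by move=> hc n; rewrite /shift; case: ifP => // _; rewrite rpred0. Qed.
Lemma isint_undil m c : isint c -> isint (undil m c).
Proof. by move=> hc n; rewrite /undil; case: ifP => // _; rewrite rpred0. Qed.
Lemma isint_delta0 : isint (delta0 R).
Proof. by move=> n; rewrite /delta0 rpred_nat. Qed.
Lemma isint_fR : isint (fR R). Proof. by move=> n; exact: intr_int. Qed.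

(** The coefficients of t G. As G itself starts with t^(-1), powers of G are always accompanied by
    powers of t. *)
Definition gR : nat -> R := undil 12 (gammaR R).
Lemma isint_gR : isint gR. Proof. by apply: isint_undil => n; exact: intr_int. Qed.
Lemma good_gR : good gR. Proof. by apply: good_undil => //; exact: good_gammaR. Qed.

Fixpoint fp j : nat -> R := if j is j'.+1 then conv (fR R) (fp j') else delta0 R.
Fixpoint gp j : nat -> R := if j is j'.+1 then conv gR (gp j') else delta0 R.

Lemma good_fp j : good (fp j).
Proof. by elim: j => [|j IH]; [exact: good_delta0|apply: good_conv IH; exact: good_fR]. Qed.
Lemma good_gp j : good (gp j).
Proof. by elim: j => [|j IH]; [exact: good_delta0|apply: good_conv IH; exact: good_gR]. Qed.
Lemma isint_fp j : isint (fp j).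
Proof. by elim: j => [|j IH]; [exact: isint_delta0|apply: isint_conv IH; exact: isint_fR]. Qed.
Lemma isint_gp j : isint (gp j).
Proof. by elim: j => [|j IH]; [exact: isint_delta0|apply: isint_conv IH; exact: isint_gR]. Qed.

Lemma ev_fp j z : 0 < Im z -> ev (fp j) (tz z) = Fm z ^+ j.
Proof.
move=> z0; elim: j => [|j IH]; first by rewrite ev_delta0 expr0.
rewrite [fp _]/= (ev_conv (@good_fR R) (@good_fp j) (nrm_tz_lt1 z0)) IH exprS.
by rewrite (Fm_ev z0).
Qed.
Lemma ev_gp j z : 0 < Im z -> ev (gp j) (tz z) = tz z ^+ j * Gm z ^+ j.
Proof.
move=> z0; rewrite -exprMn; elim: j => [|j IH]; first by rewrite ev_delta0 expr0.
rewrite [gp _]/= (ev_conv good_gR (@good_gp j) (nrm_tz_lt1 z0)) IH exprS; congr (_ * _).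
rewrite /gR (ev_undil _ (@good_gammaR R) (nrm_tz_lt1 z0)) // tz12 /Gm mulrA divff ?mul1r //.
exact: tz_neq0.
Qed.

Lemma conv_class r s c d : in_class (r %% 12) c -> in_class (s %% 12) d -> in_class ((r + s) %% 12) (conv c d).
Proof.
move=> hc hd n; apply: contraNeq => hn; apply/eqP; rewrite /conv big_nat big1 // => i /andP[_ ilt].
have [->|ci] := eqVneq (c i) 0; first by rewrite mul0r.
have [->|di] := eqVneq (d (n - i)%N) 0; first by rewrite mulr0.
move/negP: hn; case; apply/eqP.
by rewrite -modnDm -(hc _ ci) -(hd _ di) modnDm subnKC.
Qed.
Lemma fR_class : in_class 1 (fR R).
Proof.
move=> n; rewrite fRE /shift /undil; case: ltnP => n1; first by rewrite eqxx.
case: ifP => [/dvdnP[m hm] _|]; last by rewrite eqxx.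
by have -> : n = (m * 12 + 1)%N; [lia|rewrite modnMDl].
Qed.
Lemma gR_class : in_class 0 gR.
Proof. by move=> n; rewrite /gR /undil; case: ifP => [/eqP //|]; rewrite eqxx. Qed.
Lemma delta0_class : in_class 0 (delta0 R).
Proof. by move=> n; rewrite /delta0; case: (n =P 0%N) => [->|_] //; rewrite eqxx. Qed.
Lemma fp_class j : in_class (j %% 12) (fp j).
Proof. by elim: j => [|j IH]; [exact: delta0_class|exact: (@conv_class 1 j) fR_class IH]. Qed.
Lemma gp_class j : in_class 0 (gp j).
Proof. by elim: j => [|j IH]; [exact: delta0_class|exact: (@conv_class 0 0) gR_class IH]. Qed.

Lemma fR0 : fR R 0 = 0. Proof. by rewrite fRE. Qed.
Lemma fR1 : fR R 1 = 1. Proof. by rewrite fRE /shift /undil /= /alphaR alpha0. Qed.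

Lemma fp_small j n : (n < j)%N -> fp j n = 0.
Proof.
elim: j n => // j IH n nj; rewrite /= /conv big_nat big1 // => i /andP[_ ilt].
have [->|i0] := posnP i; first by rewrite fR0 mul0r.
by rewrite IH ?mulr0 //; lia.
Qed.
Lemma fp_diag j : fp j j = 1.
Proof.
elim: j => // j IH; rewrite /= /conv big_ltn // fR0 mul0r add0r big_ltn // subn1 /= IH fR1 mulr1.
rewrite big_nat big1 ?addr0 // => i /andP[i2 ij]; rewrite fp_small ?mulr0 //; lia.
Qed.
Lemma gp_0 j : gp j 0 = 1.
Proof.
elim: j => // j IH; rewrite /= /conv big_nat1 subnn IH mulr1 /gR /undil /= /gammaR.
have := alpha_gamma 0; rewrite big_nat1 alpha0 mul1r subnn => ->.
by [].
Qed.
Lemma fp1 : fp 1 =1 fR R.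
Proof.
move=> n; rewrite /= /conv big_nat_recr //= subnn /delta0 /= mulr1 big_nat big1 ?add0r // => i /andP[_ ilt].
by rewrite (_ : (n - i == 0)%N = false) ?mulr0 //; lia.
Qed.

Lemma good_sum (I : Type) (s : seq I) (a : I -> R) (F : I -> nat -> R) : (forall i, good (F i)) ->
  good (fun n => \sum_(i <- s) a i * F i n).
Proof.
move=> gF; elim: s => [|i s IH].
  by apply: (@eq_good _ (fun=> 0)) (good_cst 0) => n; rewrite big_nil.
by apply: (@eq_good _ (fun n => a i * F i n + \sum_(i <- s) a i * F i n)); [move=> n; rewrite big_cons|apply: goodD IH; exact: goodZ].
Qed.
Lemma ev_sum (I : Type) (s : seq I) (a : I -> R) (F : I -> nat -> R) (t : C) : (forall i, good (F i)) -> nrm t < 1 ->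
  ev (fun n => \sum_(i <- s) a i * F i n) t = \sum_(i <- s) (a i)%:C * ev (F i) t.
Proof.
move=> gF t1; elim: s => [|i s IH].
  rewrite big_nil; apply: ev_eq; apply: eq_clim (clim_cst 0) => n.
  by rewrite /psum big1 // => j _; rewrite /term big_nil rmorph0 mul0r.
rewrite big_cons -IH -(evZ _ (gF i) t1) -evD //; [|exact: goodZ|exact: good_sum].
by apply: eq_ev => n; rewrite big_cons.
Qed.

(* On functions: (U_p f)(z) = f(p z) + sum_(b < p) f((z + 24 b)/p). *)
Definition Up p c n : R := p%:R * c (p * n)%N + undil p c n.

Lemma good_Up p c : (0 < p)%N -> good c -> good (Up p c).
Proof. by move=> p0 gc; apply: goodD; [apply: goodZ; exact: good_dil|exact: good_undil]. Qed.
Lemma isint_Up p c : isint c -> isint (Up p c).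
Proof. by move=> ic n; rewrite /Up rpredD //; [rewrite rpredM ?rpred_nat|exact: isint_undil]. Qed.

(** For p > 3 the multiples of 24 represent all residues modulo p, and with them the multipliers of
    F in [Fm_zb_W] are trivial. *)
Definition zb p z b : C := (z + (24 * b)%:R) / p%:R.

Lemma Im_zb p z b : Im (zb p z b) = Im z / p%:R.
Proof.
have -> : zb p z b = (p%:R^-1 : R)%:C * (z + ((24 * b)%:R : R)%:C).
  by rewrite /zb fmorphV !rmorph_nat mulrC.
by rewrite cImM cImD /=; ring.
Qed.
Lemma Im_natM p z : Im (p%:R * z) = p%:R * Im z.
Proof.
have -> : p%:R = (p%:R : R)%:C :> C by rewrite rmorph_nat.
by rewrite cImM /=; ring.
Qed.
Lemma zb_gt0 p z b : (0 < p)%N -> 0 < Im z -> 0 < Im (zb p z b).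
Proof. by move=> p0 z0; rewrite Im_zb divr_gt0 // ltr0n. Qed.
Lemma natM_gt0 p z : (0 < p)%N -> 0 < Im z -> 0 < Im (p%:R * z).
Proof. by move=> p0 z0; rewrite Im_natM mulr_gt0 // ltr0n. Qed.

Lemma tz_natM p z : tz (p%:R * z) = tz z ^+ p.
Proof. by rewrite /tz -mulrA eeMn. Qed.
Lemma tz_zb p z b : (0 < p)%N -> tz (zb p z b) = tz (z / p%:R) * ee (2%:R / p%:R) ^+ b.
Proof.
move=> p0; rewrite /zb mulrDl tzD; congr (_ * _); rewrite -eeMn /tz; congr ee.
rewrite natrM; have -> : 24%:R = 12%:R * 2%:R :> C by rewrite -natrM.
have n12 : 12%:R != 0 :> C by rewrite pnatr_eq0.
have pn : p%:R != 0 :> C by rewrite pnatr_eq0 -lt0n.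
by field; rewrite ?n12 ?pn.
Qed.
Lemma tz_zb_pow p z b : (0 < p)%N -> tz (zb p z b) ^+ p = tz z.
Proof.
move=> p0; have pn : p%:R != 0 :> C by rewrite pnatr_eq0 -lt0n.
rewrite -tz_natM /zb mulrCA divff // mulr1 tzD /tz.
have -> : (24 * b)%:R / 12%:R = (2 * b)%:R :> C.
  rewrite -[24%N]/(12 * 2)%N -mulnA natrM mulrAC divff ?mul1r // pnatr_eq0 //.
by rewrite ee_nat mulr1.
Qed.

Lemma zb_sum p c z : (0 < p)%N -> odd p -> good c -> 0 < Im z ->
  \sum_(0 <= b < p) ev c (tz (zb p z b)) = p%:R * ev (fun n => c (p * n)%N) (tz z).
Proof.
move=> p0 po gc z0.
have t1 : nrm (tz (z / p%:R)) < 1.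
  apply: nrm_tz_lt1; have -> : z / p%:R = zb p z 0 by rewrite /zb muln0 addr0.
  exact: zb_gt0.
have -> : tz z = tz (z / p%:R) ^+ p.
  by rewrite -tz_natM mulrCA divff ?mulr1 // pnatr_eq0 -lt0n.
rewrite -(ev_root_sum p0 po gc t1); apply: eq_bigr => b _.
by rewrite tz_zb.
Qed.

Lemma UF_ev p c z : (0 < p)%N -> odd p -> good c -> 0 < Im z ->
  ev c (tz (p%:R * z)) + \sum_(0 <= b < p) ev c (tz (zb p z b)) = ev (Up p c) (tz z).
Proof.
move=> p0 po gc z0; rewrite zb_sum // tz_natM -(ev_undil p0 gc (nrm_tz_lt1 z0)).
rewrite /Up evD ?nrm_tz_lt1 //; [|by apply: goodZ; exact: good_dil|exact: good_undil].
by rewrite evZ ?nrm_tz_lt1 //; [rewrite rmorph_nat addrC|exact: good_dil].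
Qed.

(* ev (ug p j) t = t^(p j) U_p(G^j). *)
Definition ug p j n : R :=
  undil p (gp j) n + shift ((p - 1) * j) (fun n => p%:R * shift ((p - 1) * j) (gp j) (p * n)%N) n.

Lemma good_ug p j : (0 < p)%N -> good (ug p j).
Proof.
move=> p0; apply: goodD; first by apply: good_undil => //; exact: good_gp.
by apply: good_shift; apply: goodZ; apply: good_dil => //; apply: good_shift; exact: good_gp.
Qed.
Lemma isint_ug p j : isint (ug p j).
Proof.
move=> n; rewrite /ug rpredD //; first by apply: isint_undil; exact: isint_gp.
apply: isint_shift => m; rewrite rpredM ?rpred_nat //; apply: isint_shift; exact: isint_gp.
Qed.
Lemma ug_0 p j : (1 < p)%N -> (0 < j)%N -> ug p j 0 = 1.
Proof.
move=> p1 j0; rewrite /ug /undil dvdn0 div0n gp_0 /shift ifT ?addr0 //.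
by rewrite muln_gt0 subn_gt0 p1.
Qed.
Lemma prime_sqr12 p : prime p -> (3 < p)%N -> (p * p %% 12 = 1)%N.
Proof.
move=> pp p3; have o : odd p by case: (even_prime pp) => // e; rewrite e in p3.
have h3 : ~~ (3 %| p)%N by apply/negP; rewrite dvdn_prime2 // => /eqP e; rewrite -e in p3.
have e : (p = p %/ 6 * 6 + p %% 6)%N := divn_eq p 6.
have : (p %% 6 < 6)%N by rewrite ltn_mod.
have : (p %% 6 = 1 \/ p %% 6 = 5)%N by lia.
move: e; move: (p %/ 6)%N (p %% 6)%N => a r e [rr|rr] _; rewrite rr in e; rewrite e.
  have e2 : ((a * 6 + 1) * (a * 6 + 1) = (3 * a * a + a) * 12 + 1)%N by nia.
  by rewrite e2 modnMDl.
have e2 : ((a * 6 + 5) * (a * 6 + 5) = (3 * a * a + 5 * a + 2) * 12 + 1)%N by nia.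
by rewrite e2 modnMDl.
Qed.
Lemma coprime12 p : prime p -> (3 < p)%N -> coprime 12 p.
Proof.
move=> pp p3; rewrite -[12%N]/(2 ^ 2 * 3)%N coprimeMl; apply/andP; split; first rewrite coprimeXl //.
  by rewrite prime_coprime // dvdn_prime2 //; apply/eqP; lia.
by rewrite prime_coprime // dvdn_prime2 //; apply/eqP; lia.
Qed.
(** The operator multiplies or divides exponents by p, which has the same effect on classes because
    p^2 = 1 modulo 12. *)
Lemma ug_class p j : prime p -> (3 < p)%N -> in_class 0 (ug p j).
Proof.
move=> pp p3 n; rewrite /ug; have [->|h1] := eqVneq (undil p (gp j) n) 0.
  rewrite add0r /shift; case: ltnP => hn; first by rewrite eqxx.
  case: ltnP => hn2; first by rewrite mulr0 eqxx.
  rewrite mulf_eq0 negb_or => /andP[_ /gp_class] /eqP h; apply/eqP.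
  have d : (12 %| p * n)%N.
    have -> : (p * n = (p * (n - (p - 1) * j) - (p - 1) * j) + (p * p - 1) * j)%N.
      have -> : (p * n = p * (n - (p - 1) * j) + p * ((p - 1) * j))%N by rewrite -mulnDr subnK.
      have : (p * ((p - 1) * j) = (p * p - 1) * j - (p - 1) * j)%N.
        by have := prime_gt1 pp; nia.
      have : ((p - 1) * j <= (p * p - 1) * j)%N by rewrite leq_mul2r; apply/orP; right; nia.
      have gen (X Y Z T : nat) : (X <= Z -> X <= Y -> T = Y - X -> Z + T = Z - X + Y)%N by clear; lia.
      by move=> u1 u2; exact: gen hn2 u1 u2.
    rewrite dvdn_add //; apply: dvdn_mulr.
    by rewrite -eqn_mod_dvd ?prime_sqr12 // muln_gt0 prime_gt0.
  by move: d; rewrite Gauss_dvdr ?coprime12.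
move=> _; move: h1; rewrite /undil; case: ifP => [/dvdnP[m ->]|]; last by rewrite eqxx.
rewrite mulnK ?prime_gt0 // => /gp_class h; apply/eqP.
by rewrite -/(dvdn 12 _) dvdn_mulr // /dvdn h.
Qed.

Lemma UG_ev p j z : (0 < p)%N -> odd p -> 0 < Im z ->
  Gm (p%:R * z) ^+ j + \sum_(0 <= b < p) Gm (zb p z b) ^+ j = (tz z ^+ (p * j))^-1 * ev (ug p j) (tz z).
Proof.
move=> p0 po z0; have t1 := nrm_tz_lt1 z0.
have tn : tz z ^+ (p * j) != 0 by rewrite expf_neq0 // tz_neq0.
apply: (mulfI tn); rewrite mulrA divff // mul1r.
have gg := @good_gp j.
have gs := good_shift ((p - 1) * j) gg.
have gd := good_dil p0 gs.
rewrite /ug evD //; [|exact: good_undil|by apply: good_shift; exact: goodZ].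
rewrite ev_undil // mulrDr; congr (_ + _).
  by rewrite -(tz_natM p z) ev_gp ?natM_gt0 // tz_natM exprM.
rewrite ev_shift //; last exact: goodZ.
rewrite evZ // rmorph_nat -(zb_sum p0 po gs z0) !mulr_sumr; apply: eq_bigr => b _.
have b0 := zb_gt0 b p0 z0.
rewrite ev_shift ?nrm_tz_lt1 // ev_gp // mulrA -[RHS]mulrA [_ * (tz _ ^+ j * _)]mulrA -exprD mulrA; congr (_ * _).
have -> : ((p - 1) * j + j = p * j)%N by rewrite -{2}[j]mul1n -mulnDl subnK.
by rewrite [tz (zb p z b) ^+ (p * j)]exprM tz_zb_pow // -exprD -{3}[j]mul1n -mulnDl subnK.
Qed.

(** Poles are removed from the highest order down. v_0 G^N cancels t^(-N), since t^N G^N has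
    constant term 1, and the order then rises by 12 because all exponents lie in one class. As 12
    does not divide N, only positive exponents remain at the end. *)
Lemma laurent_reduction N v : good v -> isint v -> in_class 0 v -> ~~ (12 %| N)%N ->
  exists A w, [/\ good w, forall n, w n != 0 -> (12 %| n + N)%N,
    forall i, A i \is a Num.int,
    forall i, A i != 0 -> [&& (0 < i)%N, (i <= N)%N & (i %% 12 == N %% 12)%N] &
    A N = v 0%N /\ forall z, 0 < Im z -> (tz z ^+ N)^-1 * ev v (tz z) =
      \sum_(1 <= i < N.+1) (A i)%:C * Gm z ^+ i + ev w (tz z)].
Proof.
elim/ltn_ind: N v => N IH v gv iv cv N12.
have N0 : (0 < N)%N by rewrite lt0n; apply: contra N12 => /eqP ->.
pose v' n := v (n + 12)%N + - v 0%N * gp N (n + 12)%N.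
have gdrop c : good c -> good (fun n => c (n + 12)%N).
  move=> gc r r0 r1; have [rho [s [/andP[h0 h1] /andP[s0 s1] hr _]]] := mid_radius r0 r1.
  have [K hK] := gc rho (ltW h0) h1.
  exists (K / rho ^+ 12) => n; rewrite ler_pdivlMr ?exprn_gt0 //.
  apply: le_trans (hK (n + 12)%N); rewrite -mulrA; apply: ler_wpM2l => //.
  rewrite exprD; apply: ler_wpM2r; first by apply: exprn_ge0; exact: ltW.
  by apply: lerXn2r; rewrite ?nnegrE // ltW.
have gv' : good v'.
  apply: goodD; first exact: gdrop gv.
  by apply: goodZ; apply: (gdrop (gp N)); exact: good_gp.
have iv' : isint v'.
  by move=> n; rewrite rpredD // rpredM ?rpredN //; exact: isint_gp.
have cv' : in_class 0 v'.
  move=> n; rewrite /v'; have [->|h] := eqVneq (v (n + 12)%N) 0; last first.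
    by move=> _; have := cv _ h; rewrite modnDr.
  rewrite add0r mulf_eq0 negb_or => /andP[_ /gp_class]; by rewrite modnDr.
have ve : v =1 (fun n => v 0%N * gp N n + shift 12 v' n).
  move=> n; rewrite /shift /v'; case: ltnP => hn; last by rewrite subnK //; ring.
  rewrite addr0; have [->|n0] := posnP n; first by rewrite gp_0 mulr1.
  have nz c : in_class 0 c -> c n = 0.
    by move=> hc; apply/eqP/negPn/negP => /hc; rewrite modn_small // => e; rewrite e in n0.
  by rewrite (nz _ cv) (nz _ (@gp_class N)) mulr0.
have key z : 0 < Im z -> (tz z ^+ N)^-1 * ev v (tz z) =
    (v 0%N)%:C * Gm z ^+ N + (tz z ^+ N)^-1 * (tz z ^+ 12 * ev v' (tz z)).
  move=> z0; have t1 := nrm_tz_lt1 z0.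
  rewrite (eq_ev _ ve) evD //; [|by apply: goodZ; exact: good_gp|exact: good_shift].
  rewrite evZ ?ev_shift //; last exact: good_gp.
  rewrite ev_gp // mulrDr; congr (_ + _); rewrite mulrCA; congr (_ * _).
  by rewrite mulrA mulVf ?mul1r // expf_neq0 // tz_neq0.
have sumA (A : nat -> R) z : \sum_(1 <= i < N.+1) ((A i + (i == N)%:R * v 0%N)%:C) * Gm z ^+ i =
   \sum_(1 <= i < N.+1) (A i)%:C * Gm z ^+ i + (v 0%N)%:C * Gm z ^+ N.
  transitivity (\sum_(1 <= i < N.+1) ((A i)%:C * Gm z ^+ i + ((i == N)%:R * v 0%N)%:C * Gm z ^+ i)).
    by apply: eq_bigr => i _; rewrite rmorphD mulrDl.
  rewrite big_split /=; congr (_ + _).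
  rewrite (bigD1_seq N) ?mem_index_iota ?iota_uniq ?N0 ?ltnS ?leqnn //= eqxx mul1r big1 ?addr0 //.
  by move=> i /negbTE ->; rewrite mul0r rmorph0 mul0r.
have [N12'|N12'] := ltnP N 12.
  exists (fun i => 0 + (i == N)%:R * v 0%N), (shift (12 - N) v'); split.
  - exact: good_shift.
  - move=> n; rewrite /shift; case: ltnP => hn; first by rewrite eqxx.
    by move/cv' => /eqP h; have -> : (n + N = (n - (12 - N)) + 12)%N; [lia|rewrite dvdn_addl].
  - by move=> i; rewrite add0r rpredM ?rpred_nat.
  - move=> i; rewrite add0r; case: (i =P N) => [->|_]; last by rewrite mul0r eqxx.
    by rewrite N0 leqnn eqxx.
  split; first by rewrite eqxx mul1r add0r.
  move=> z z0; rewrite key // sumA big1 ?add0r; last by move=> i _; rewrite rmorph0 mul0r.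
  congr (_ + _); rewrite ev_shift ?nrm_tz_lt1 // mulrA; congr (_ * _).
  have -> : tz z ^+ 12 = tz z ^+ N * tz z ^+ (12 - N) by rewrite -exprD subnKC // ltnW.
  by rewrite mulrA mulVf ?mul1r // expf_neq0 // tz_neq0.
have lt : (N - 12 < N)%N by lia.
have nd : ~~ (12 %| N - 12)%N by rewrite dvdn_subl.
have [A [w [gw cw iA sA [AN hz]]]] := IH _ lt v' gv' iv' cv' nd.
exists (fun i => A i + (i == N)%:R * v 0%N), w; split=> //.
- move=> n /cw h; have -> : (n + N = n + (N - 12) + 12)%N by lia.
  by rewrite dvdn_addl.
- by move=> i; rewrite rpredD // rpredM ?rpred_nat.
- move=> i; case: (i =P N) => [-> _|_]; first by rewrite N0 leqnn eqxx.
  rewrite mul0r addr0 => /sA /and3P[h1 h2 /eqP h3]; rewrite h1 /=; apply/andP; split; first by lia.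
  by rewrite h3 -{2}(subnK N12') modnDr.
have A0 i : (N - 12 < i)%N -> A i = 0.
  by move=> hi; apply/eqP/negPn/negP => /sA /and3P[_ h _]; rewrite leqNgt hi in h.
split; first by rewrite A0 // eqxx mul1r add0r.
move=> z z0; rewrite key // sumA.
have -> : (tz z ^+ N)^-1 * (tz z ^+ 12 * ev v' (tz z)) = (tz z ^+ (N - 12))^-1 * ev v' (tz z).
  have -> : tz z ^+ N = tz z ^+ (N - 12) * tz z ^+ 12 by rewrite -exprD subnK.
  have gen (x y e : C) : y != 0 -> (x * y)^-1 * (y * e) = x^-1 * e.
    by move=> y0; rewrite invfM -mulrA [y^-1 * _]mulrA mulVf // mul1r.
  by apply: gen; rewrite expf_neq0 // tz_neq0.
rewrite (hz _ z0) addrC addrAC; congr (_ + _ + _).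
rewrite [RHS](@big_cat_nat _ _ _ (N - 12).+1) ?ltnS ?leq_subr //= [X in _ = _ + X]big_nat [X in _ = _ + X]big1 ?addr0 //.
by move=> i /andP[hi _]; rewrite A0 // rmorph0 mul0r.
Qed.

End Powers.

(** * Action of W on U_p and the expansion of U_p F^j *)

Section Hecke.
Variable R : realType.
Notation C := R[i].
Implicit Types (z : C).
Variable k : R.
Hypothesis k0 : k != 0.
Hypothesis hk : forall z, 0 < Im z -> Pm z = k%:C.

(** The matrix ((l, 24 b), (2 * 24 b', p)) carries W(z_b') to (W z)_b, and 1152 = 2 * 24 * 24 makes
    the hypothesis its determinant relation. Its multiplier exponent is a multiple of 12. *)
Lemma Fm_zb_W p b b' l z : (0 < p)%N -> (1152 * b * b' + 1 = p * l)%N -> 0 < Im z ->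
  Fm (zb p (Wz z) b) = k%:C * Gm (zb p z b').
Proof.
move=> p0 hl z0; have z0' := zb_gt0 b' p0 z0.
rewrite -(Fm_W hk z0').
have det : (l%:Z * p%:Z - 2 * (24 * b)%:Z * (24 * b')%:Z = 1)%R by lia.
have rel : zb p (Wz z) b * (2%:R * ((24 * b')%:Z)%:~R * Wz (zb p z b') + (p%:Z)%:~R) = (l%:Z)%:~R * Wz (zb p z b') + ((24 * b)%:Z)%:~R.
  have zn := Im_neq0 z0; have zbn := Im_neq0 z0'.
  have pn : p%:R != 0 :> C by rewrite pnatr_eq0 -lt0n.
  have n2 : 2%:R != 0 :> C by rewrite pnatr_eq0.
  have zbn2 : z + (24 * b')%:R != 0 by move: zbn; rewrite /zb mulf_eq0 negb_or => /andP[].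
  have hl' : l%:R = (1152%:R * b%:R * b'%:R + 1) / p%:R :> C.
    by apply: (mulIf pn); rewrite divfK // -(natrM _ l p) [(l * p)%N]mulnC -hl natrD !natrM.
  rewrite -!pmulrn hl' /zb /Wz; move: zbn2; rewrite !natrM => zbn2.
  by field; rewrite ?zn ?pn ?n2 ?zbn2.
rewrite (Fm_mob k0 hk det (Wz_gt0 z0') (zb_gt0 b p0 (Wz_gt0 z0)) rel).
have -> : mult_exp l%:Z (24 * b)%:Z (24 * b')%:Z p%:Z = 12 * ((2 * p%:Z - l%:Z) * (2 * b')%:Z + (2 * b)%:Z * p%:Z * (2 * (24 * b')%:Z ^+ 2 + 1)).
  rewrite /mult_exp (_ : (24 * b)%:Z = 12 * (2 * b)%:Z); last lia.
  by rewrite (_ : (24 * b')%:Z = 12 * (2 * b')%:Z); [ring|lia].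
by rewrite zeta12 mul1r.
Qed.

Lemma sum_Fp (V : nmodType) p (f : nat -> V) : prime p ->
  \sum_(0 <= b < p) f b = \sum_(b : 'F_p) f b.
Proof. by move=> pp; rewrite -{1}(Fp_cast pp) big_mkord. Qed.

(** Under W the point p z is exchanged with the point of index b = 0, and the other indices are
    permuted by b' = -1/(1152 b) modulo p; 1152 = 2^7 3^2 is invertible as p > 3. *)
Lemma reindex_Fp p (f g : nat -> C) (x y K : C) : prime p -> (3 < p)%N ->
  f 0%N = K * y -> x = K * g 0%N ->
  (forall b b' l, (1152 * b * b' + 1 = p * l)%N -> f b = K * g b') ->
  x + \sum_(0 <= b < p) f b = K * (y + \sum_(0 <= b < p) g b).
Proof.
move=> pp p3 e2 e1 hfg.
have sp (h : nat -> C) : \sum_(0 <= b < p) h b = h 0%N + \sum_(b : 'F_p | b != 0) h b.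
  by rewrite (sum_Fp _ pp) (bigD1 (0 : 'F_p)).
rewrite (sp f) (sp g) e1 e2 addrA [K * g 0%N + _]addrC -addrA !mulrDr; congr (_ + (_ + _)).
have [c cE] : exists c : 'F_p, c = 1152%:R by exists 1152%:R.
have c0 : c != 0.
  rewrite cE -(dvdn_pcharf (pchar_Fp pp)) -[1152%N]/(2 ^ 7 * 3 ^ 2)%N Euclid_dvdM // !Euclid_dvdX //= !dvdn_prime2 //.
  by clear -p3; lia.
pose phi (b : 'F_p) : 'F_p := (- (c * b))^-1.
have phiI : injective phi by move=> a b /invr_inj /oppr_inj /(mulfI c0).
rewrite [RHS]mulr_sumr [RHS](reindex_inj phiI); apply: eq_big => b.
  by rewrite /phi invr_eq0 oppr_eq0 mulf_eq0 (negbTE c0).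
move=> b0; have hd : (p %| 1152 * b * phi b + 1)%N.
  rewrite (dvdn_pcharf (pchar_Fp pp)) natrD natrM natrM !natr_Zp -cE /phi invrN mulrN mulfV ?addNr //.
  by rewrite mulf_neq0.
have hl := divnK hd; rewrite mulnC in hl.
exact: hfg (esym hl).
Qed.

Lemma UF_W p j z : prime p -> (3 < p)%N -> 0 < Im z ->
  Fm (p%:R * Wz z) ^+ j + \sum_(0 <= b < p) Fm (zb p (Wz z) b) ^+ j =
  k%:C ^+ j * (Gm (p%:R * z) ^+ j + \sum_(0 <= b < p) Gm (zb p z b) ^+ j).
Proof.
move=> pp p3 z0; have p0 := prime_gt0 pp.
have pn : p%:R != 0 :> C by rewrite pnatr_eq0 -lt0n.
have zn := Im_neq0 z0; have n2 : 2%:R != 0 :> C by rewrite pnatr_eq0.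
have e1 : Fm (p%:R * Wz z) = k%:C * Gm (zb p z 0).
  rewrite -(Fm_W hk (zb_gt0 0 p0 z0)); congr Fm; rewrite /zb /Wz muln0 addr0.
  by field; rewrite ?zn ?pn ?n2.
have e2 : Fm (zb p (Wz z) 0) = k%:C * Gm (p%:R * z).
  rewrite -(Fm_W hk (natM_gt0 p0 z0)); congr Fm; rewrite /zb /Wz muln0 addr0.
  by field; rewrite ?zn ?pn ?n2.
apply: (reindex_Fp (f := fun b => Fm (zb p (Wz z) b) ^+ j) (g := fun b => Gm (zb p z b) ^+ j) pp p3).
- by rewrite e2 exprMn.
- by rewrite e1 exprMn.
by move=> b b' l hl; rewrite (Fm_zb_W p0 hl z0) exprMn.
Qed.

(** W turns U_p F^j into C^j U_p G^j, and subtracting the combination of the A_i G^i leaves the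
    pole-free series w. The difference of both sides and its image under W thus satisfy [vanishing];
    their classes p j and -p j modulo 12 are nonzero because p j is odd. *)
Theorem hecke_expansion p j : prime p -> (3 < p)%N -> odd j -> exists A : nat -> R,
  [/\ forall i, A i \is a Num.int,
      forall i, A i != 0 -> [&& (0 < i)%N, (i <= p * j)%N & (i %% 12 == (p * j) %% 12)%N],
      A (p * j)%N = 1 &
      forall n, Up p (fp R j) n = \sum_(1 <= i < (p * j).+1) (k ^+ j / k ^+ i * A i) * fp R i n].
Proof.
move=> pp p3 jo; have p0 := prime_gt0 pp.
have po : odd p by case: (even_prime pp) => // e; rewrite e in p3.
have j0 : (0 < j)%N by case: (j) jo.
set N := (p * j)%N.
have No : odd N by rewrite /N oddM po.
have N12 : ~~ (12 %| N)%N by apply/negP => /dvdnP[m e]; move: No; rewrite e oddM andbF.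
have [A [w [gw cw iA sA [AN hz]]]] := laurent_reduction (@good_ug R p j p0) (@isint_ug R p j) (@ug_class R p j pp p3) N12.
exists A; split=> //; first by rewrite AN ug_0 // prime_gt1.
pose a i := k ^+ j / k ^+ i * A i.
have gsum : good (fun n => \sum_(1 <= i < N.+1) a i * fp R i n) by apply: good_sum => i; exact: good_fp.
have gU : good (Up p (fp R j)) by apply: good_Up => //; exact: good_fp.
pose c n := Up p (fp R j) n + -1 * \sum_(1 <= i < N.+1) a i * fp R i n.
pose d n := k ^+ j * w n.
have gc : good c by apply: goodD gU _; exact: goodZ.
have gd : good d by exact: goodZ.
have r0 : (0 < N %% 12)%N by rewrite lt0n.
have r12 : (N %% 12 < 12)%N by rewrite ltn_mod.
have cc : in_class (N %% 12) c.
  move=> n; rewrite /c => h; apply/eqP/negPn/negP => hn; move/negP: h; apply; apply/eqP.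
  have psq := prime_sqr12 pp p3.
  rewrite /Up /undil.
  have -> : fp R j (p * n)%N = 0.
    apply/eqP/negPn/negP => /fp_class h; move/negP: hn; apply; apply/eqP.
    by rewrite /N -modnMmr -h modnMmr mulnA -modnMml psq mul1n.
  have -> : (if (p %| n)%N then fp R j (n %/ p)%N else 0) = 0.
    case: ifP => // /dvdnP[m hm]; rewrite hm mulnK //; apply/eqP/negPn/negP => /fp_class h.
    by move/negP: hn; apply; apply/eqP; rewrite hm /N [(m * p)%N]mulnC -modnMmr h modnMmr.
  rewrite mulr0 !add0r big1 ?mulr0 // => i _.
  have [Ai|Ai] := eqVneq (A i) 0; first by rewrite /a Ai mulr0 mul0r.
  have /and3P[_ _ /eqP hi] := sA _ Ai.
  have [->|/fp_class h] := eqVneq (fp R i n) 0; first by rewrite mulr0.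
  by move/negP: hn; case; apply/eqP; rewrite h.
have cd : in_class (12 - N %% 12) d.
  move=> n; rewrite /d mulf_eq0 negb_or => /andP[_ /cw h].
  by have : (12 %| n %% 12 + N %% 12)%N by [rewrite /dvdn modnDm]; case/dvdnP => m hm; have := ltn_mod n 12; lia.
suff h : forall n, c n = 0.
  by move=> n; have /eqP := h n; rewrite /c mulN1r subr_eq0 => /eqP.
apply: (vanishing gc gd cc cd); [by rewrite r0|by lia|].
move=> z z0; have w0 := Wz_gt0 z0; have t1 := nrm_tz_lt1 z0; have t1' := nrm_tz_lt1 w0.
rewrite (evD gU (goodZ _ gsum) t1') (evZ _ gsum t1') (ev_sum _ _ (@good_fp R) t1') /d (evZ _ gw t1).
rewrite -(UF_ev p0 po (@good_fp R j) w0) (ev_fp _ (natM_gt0 p0 w0)).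
have -> : \sum_(0 <= b < p) ev (fp R j) (tz (zb p (Wz z) b)) = \sum_(0 <= b < p) Fm (zb p (Wz z) b) ^+ j.
  by apply: eq_bigr => b _; rewrite (ev_fp _ (zb_gt0 b p0 w0)).
rewrite (UF_W _ pp p3 z0) (UG_ev _ p0 po z0) (hz _ z0).
have -> : \sum_(1 <= i < N.+1) (a i)%:C * ev (fp R i) (tz (Wz z)) = k%:C ^+ j * \sum_(1 <= i < N.+1) (A i)%:C * Gm z ^+ i.
  rewrite mulr_sumr; apply: eq_bigr => i _; rewrite (ev_fp _ w0) (Fm_W hk z0) exprMn /a.
  have kn : k%:C ^+ i != 0 :> C by rewrite expf_neq0 // fmorph_eq0.
  rewrite !rmorphM fmorphV !rmorphXn /=; move: (Gm z ^+ i) (k%:C ^+ i) kn (k%:C ^+ j) ((A i)%:C) => g ki kn kj ai.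
  by field.
rewrite rmorphXn rmorphN1 mulN1r; move: (\sum_(_ <= _ < _) _) (ev w _) (k%:C ^+ j) => S W K; ring.
Qed.

(* Compare coefficients of t^5 in U_5 F = k^(-4) F^5. *)
Lemma k_sqr : k ^+ 2 = 1/4.
Proof.
have [A [iA sA A5 h]] := @hecke_expansion 5 1 isT isT isT.
have z i : (i < 5)%N -> A i = 0.
  move=> hi; apply/eqP/negPn/negP => /sA /and3P[i0 _]; rewrite [(5 * 1 %% 12)%N]/= modn_small; last lia.
  by move/eqP => e; rewrite e in hi.
have S (F : nat -> R) : (forall i, (i < 5)%N -> F i = 0) -> \sum_(1 <= i < (5 * 1).+1) F i = F 5%N.
  by move=> hF; rewrite big_nat_recr //= big_nat big1 ?add0r // => i /andP[_ hi]; exact: hF.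
have a25 : fR R 25 = 3 by rewrite fRE; change (alphaR R 2 = 3); rewrite /alphaR alpha2.
(* The coefficient is 5 alpha_2 + 1, from t^25 and from t. *)
have u : Up 5 (fp R 1) 5 = 16.
  rewrite /Up; have -> : undil 5 (fp R 1) 5 = fp R 1 1 by [].
  by rewrite !fp1 (_ : (5 * 5)%N = 25%N) // a25 fR1; lra.
have := h 5%N; rewrite u S; last by move=> i /z ->; rewrite mulr0 mul0r.
have -> : A 5%N = 1 by [].
rewrite mulr1 fp_diag mulr1.
move=> e; have k4 : (k ^+ 2) ^+ 2 = 1/16.
  have e2 : k ^+ 1 / k ^+ 5 = (k ^+ 4)^-1 by rewrite (exprS k 4) expr1 invfM mulrA divff ?mul1r.
  by rewrite e2 in e; rewrite -exprM -[k ^+ (2 * 2)]invrK -e; lra.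
(* k is real, so the second factor cannot vanish. *)
have : (k ^+ 2 - 1/4) * (k ^+ 2 + 1/4) = 0 by rewrite mulrDr mulrBl mulrBl -expr2 k4; lra.
move/eqP; rewrite mulf_eq0 => /orP[/eqP hh|/eqP hh]; first by lra.
by have := sqr_ge0 k; lra.
Qed.

(** Integrality is a strong induction on i: F^i = t^i + ..., so the coefficient of t^i in U_p F^j is
    m_i plus an integral combination of earlier m. For i >= j the divisibility is that of
    k^(j-i). *)
Theorem hecke_integral p j : prime p -> (3 < p)%N -> odd j -> exists m : nat -> R, exists N : nat,
  [/\ forall i, m i \is a Num.int,
      forall i, m i != 0 -> (i %% 12 == (p * j) %% 12)%N,
      forall i, (j <= i)%N -> m i / 2 ^+ (i - j) \is a Num.int &
      forall n, Up p (fp R j) n = \sum_(1 <= i < N) m i * fp R i n].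
Proof.
move=> pp p3 jo; have [A [iA sA _ h]] := hecke_expansion pp p3 jo.
have po : odd p by case: (even_prime pp) => // e; rewrite e in p3.
set N := (p * j).+1 in h; pose m i := k ^+ j / k ^+ i * A i.
have No : odd (p * j) by rewrite oddM po.
have mA i : m i != 0 -> A i != 0 by rewrite /m mulf_eq0 negb_or => /andP[].
exists m, N; split=> //.
- have m0 i : ~~ (0 < i < N)%N -> m i = 0.
    move=> hi; apply/eqP/negPn/negP => /mA /sA /and3P[h1 h2 _]; move/negP: hi; apply.
    by rewrite h1 /N ltnS.
  elim/ltn_ind => i IH; case: (boolP (0 < i < N)%N) => [/andP[i0 iN]|/m0 ->]; last exact: rpred0.
  have : Up p (fp R j) i \is a Num.int by apply: isint_Up; exact: isint_fp.
  rewrite h (@big_cat_nat _ _ _ i) ?(ltnW iN) //= [X in _ + X]big_ltn // fp_diag mulr1.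
  rewrite [X in _ + (_ + X)]big_nat [X in _ + (_ + X)]big1 ?addr0; last first.
    by move=> i' /andP[hi _]; rewrite fp_small ?mulr0.
  rewrite rpredDl // big_nat; apply: rpred_sum => i' /andP[_ hi]; apply: rpredM; first exact: IH.
  exact: isint_fp.
- by move=> i /mA /sA /and3P[].
move=> i ji; have [->|mi] := eqVneq (m i) 0; first by rewrite mul0r rpred0.
have /and3P[_ _ /eqP ci] := sA _ (mA _ mi).
have io : odd i by have := congr1 odd ci; rewrite !odd_mod // No.
have [e he] : exists e, (i - j = e + e)%N.
  exists ((i - j)./2)%N; have := odd_double_half (i - j); rewrite oddB // io jo /= add0n -addnn; lia.
have -> : m i / 2 ^+ (i - j) = A i; last exact: iA.
have ki : k ^+ i = k ^+ j * k ^+ (e + e) by rewrite -exprD -he subnKC.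
(* i - j = 2 e is even, so the sign of k is irrelevant and the product is (4 k^2)^e = 1. *)
have k4 : k ^+ (e + e) * 2 ^+ (i - j) = 1.
  by rewrite he -exprMn addnn -mul2n exprM exprMn k_sqr (_ : 1/4 * 2 ^+ 2 = 1 :> R) ?expr1n // expr2; lra.
rewrite /m ki; have kj : k ^+ j != 0 by rewrite expf_neq0.
have ke : k ^+ (e + e) != 0 by rewrite expf_neq0.
have two : 2 ^+ (i - j) != 0 :> R by rewrite expf_neq0 // pnatr_eq0.
have -> : k ^+ j / (k ^+ j * k ^+ (e + e)) * A i / 2 ^+ (i - j) = A i / (k ^+ (e + e) * 2 ^+ (i - j)).
  by move: (k ^+ j) (k ^+ (e + e)) (2 ^+ (i - j)) kj ke two => x y t x0 y0 t0; field; rewrite ?x0 ?y0 ?t0.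
by rewrite k4 divr1.
Qed.

End Hecke.

(** * Density of integers with few exact prime divisors *)

Section PeriodicAverages.
Variable R : realType.
Implicit Types f g F : nat -> R.

Definition periodic (a : nat) f := forall n, f (n + a)%N = f n.

Lemma periodic_mod a f n : periodic a f -> f (n %% a)%N = f n.
Proof.
move=> hf; rewrite {2}(divn_eq n a); elim: (n %/ a)%N => [|q IH]; first by rewrite mul0n add0n.
by rewrite mulSn -addnA addnC hf.
Qed.

Lemma affine_sum f a b m : (0 < a)%N -> coprime b a -> periodic a f ->
  \sum_(0 <= l < a) f (b * l + m)%N = \sum_(0 <= l < a) f l.
Proof.
move=> a0 cba hf; rewrite !big_mkord.
pose phi (l : 'I_a) : 'I_a := Ordinal (ltn_pmod (b * l + m) a0).
have phiI : injective phi.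
  move=> x y /(congr1 val) /= /eqP; rewrite eqn_modDr => hxy; apply: val_inj => /=.
  wlog le : x y hxy / (x <= y)%N => [hw|].
    by case/orP: (leq_total x y) => l; [exact: hw|apply/esym/hw => //; rewrite eq_sym].
  move: hxy; rewrite eq_sym eqn_mod_dvd ?leq_mul2l ?le ?orbT // -mulnBr Gauss_dvdr ?(coprime_sym a) //.
  have := ltn_ord y; case: (posnP (y - x)%N) => [e _ _|p ly /(dvdn_leq p)]; lia.
rewrite [RHS](reindex_inj phiI); apply: eq_bigr => l _.
by rewrite /= periodic_mod.
Qed.

(** With n = b l + j the factor g depends on j only, while f runs over a full period as l varies. *)
Lemma crt_sum f g a b : (0 < a)%N -> coprime b a -> periodic a f -> periodic b g ->
  \sum_(0 <= n < b * a) f n * g n = (\sum_(0 <= n < a) f n) * \sum_(0 <= n < b) g n.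
Proof.
move=> a0 cba hf hg; rewrite sum_blocks exchange_big /= mulr_sumr; apply: eq_bigr => j _.
rewrite -(affine_sum j a0 cba hf) mulr_suml; apply: eq_bigr => l _; congr (_ * _).
by rewrite -(periodic_mod _ hg) -[RHS](periodic_mod _ hg) mulnC modnMDl.
Qed.

Lemma periodicM a b f g : periodic a f -> periodic b g -> periodic (b * a) (fun n => f n * g n).
Proof.
move=> hf hg n; congr (_ * _).
  by rewrite -(periodic_mod _ hf) addnC modnMDl periodic_mod.
by rewrite -(periodic_mod _ hg) mulnC addnC modnMDl periodic_mod.
Qed.

Definition modulus e (ps : seq nat) : nat := (\prod_(p <- ps) p ^ e)%N.

Lemma modulus_gt0 e ps : all prime ps -> (0 < modulus e ps)%N.
Proof.
elim: ps => [|p ps IH] /=; first by rewrite /modulus big_nil.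
by case/andP=> pp hp; rewrite /modulus big_cons muln_gt0 expn_gt0 prime_gt0 // IH.
Qed.

Lemma crt_prod e ps (f : nat -> nat -> R) : uniq ps -> all prime ps ->
  (forall p, p \in ps -> periodic (p ^ e) (f p)) ->
  periodic (modulus e ps) (fun n => \prod_(p <- ps) f p n) /\
  \sum_(0 <= n < modulus e ps) \prod_(p <- ps) f p n = \prod_(p <- ps) \sum_(0 <= n < p ^ e) f p n.
Proof.
elim: ps => [|p ps IH] /=.
  move=> _ _ _; split; first by move=> n; rewrite !big_nil.
  by rewrite /modulus !big_nil big_nat1 big_nil.
case/andP=> pps ups /andP[pp hp] hf.
have [h1 h2] := IH ups hp (fun q hq => hf q (mem_behead (s := p :: ps) hq)).
have hfp : periodic (p ^ e) (f p) by apply: hf; rewrite mem_head.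
have co : coprime (modulus e ps) (p ^ e).
  move: pps hp; clear -pp; elim: ps => [|q ps IH] /=; first by rewrite /modulus big_nil coprime1n.
  rewrite inE negb_or => /andP[pq pps] /andP[qq hp]; rewrite /modulus big_cons coprimeMl IH // andbT.
  by rewrite coprimeXl // coprimeXr // prime_coprime // dvdn_prime2 // eq_sym.
have pe0 : (0 < p ^ e)%N by rewrite expn_gt0 prime_gt0.
have mE : modulus e (p :: ps) = (modulus e ps * p ^ e)%N by rewrite /modulus big_cons mulnC.
split.
  by move=> n; rewrite mE !big_cons; have := periodicM hfp h1 n.
rewrite mE big_cons -h2 -(crt_sum pe0 co hfp h1).
by apply: eq_bigr => n _; rewrite big_cons.
Qed.

Lemma sum_range_le F m n : (forall i, 0 <= F i) -> (m <= n)%N ->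
  \sum_(0 <= i < m) F i <= \sum_(0 <= i < n) F i.
Proof. by move=> h mn; rewrite [leRHS](@big_cat_nat _ _ _ m) //= lerDl; apply: sumr_ge0. Qed.

Lemma periodic_sum F Q N : periodic Q F -> \sum_(0 <= n < Q * N) F n = N%:R * \sum_(0 <= n < Q) F n.
Proof.
move=> hF; rewrite sum_blocks (eq_bigr (fun=> \sum_(0 <= n < Q) F n)).
  by rewrite sumr_const_nat subn0 -[LHS]mulr_natl.
move=> l _; apply: eq_bigr => j _; by rewrite -(periodic_mod _ hF) mulnC modnMDl periodic_mod.
Qed.

Lemma periodic_sum_le F Q X : (0 < Q)%N -> periodic Q F -> (forall i, 0 <= F i) ->
  \sum_(0 <= n < X) F n <= (X %/ Q).+1%:R * \sum_(0 <= n < Q) F n.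
Proof.
by move=> Q0 hF F0; rewrite -periodic_sum //; apply: sum_range_le => //; rewrite mulnC ltnW // ltn_ceil.
Qed.
Lemma periodic_sum_ge F Q X : (0 < Q)%N -> periodic Q F -> (forall i, 0 <= F i) ->
  (X %/ Q)%:R * \sum_(0 <= n < Q) F n <= \sum_(0 <= n < X) F n.
Proof.
by move=> Q0 hF F0; rewrite -periodic_sum //; apply: sum_range_le => //; rewrite mulnC leq_divM.
Qed.

End PeriodicAverages.

(** * Divergence of the sum of reciprocals of the primes 3 modulo 4 *)

Section PrimesThreeModFour.
Variable R : realType.

Lemma prime_factor3 N : (N %% 4 = 3)%N -> exists q, [/\ prime q, (q %| N)%N & (q %% 4 = 3)%N].
Proof.
elim/ltn_ind: N => N IH hN; have N1 : (1 < N)%N by case: N hN {IH} => [|[|N]].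
set p := pdiv N; have pp : prime p := pdiv_prime N1; have pN : (p %| N)%N := pdiv_dvd N.
have [p3|p3] := eqVneq (p %% 4)%N 3%N; first by exists p.
have e : N = (N %/ p * p)%N by rewrite divnK.
have po : odd p.
  have : odd N by rewrite -(odd_mod N (erefl false : odd 4 = false)) hN.
  by rewrite e oddM => /andP[].
have p1 : (p %% 4 = 1)%N by move: po p3; rewrite -(odd_mod p (erefl false : odd 4 = false)); have := ltn_mod p 4; case: (p %% 4)%N => [|[|[|[|]]]].
have hq : ((N %/ p) %% 4 = 3)%N by move: hN; rewrite {1}e -modnMmr p1 muln1.
have lt : (N %/ p < N)%N by rewrite ltn_Pdiv ?prime_gt1 // ltnW.
have [q [q1 q2 q3]] := IH _ lt hq; exists q; split=> //.
by apply: dvdn_trans q2 _; rewrite {2}e dvdn_mulr.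
Qed.

Definition P3 (p : nat) : bool := prime p && (p %% 4 == 3)%N.
Arguments P3 : simpl never.
Definition S3 Y := [seq p <- iota 0 Y | P3 p].
Definition rs (ps : seq nat) : R := \sum_(p <- ps) p%:R^-1.

Lemma S3_uniq Y : uniq (S3 Y). Proof. by rewrite filter_uniq // iota_uniq. Qed.
Lemma S3_prime Y : all prime (S3 Y).
Proof. by apply/allP => p; rewrite mem_filter => /andP[/andP[]]. Qed.
Lemma mem_S3 Y p : (p \in S3 Y) = P3 p && (p < Y)%N.
Proof. by rewrite mem_filter mem_iota add0n. Qed.
Lemma rs_S3 Y : rs (S3 Y) = \sum_(0 <= p < Y | P3 p) p%:R^-1.
Proof. by rewrite /rs /S3 big_filter /index_iota subn0. Qed.
Lemma P3_ge3 p : P3 p -> (3 <= p)%N.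
Proof. by move=> /andP[pp /eqP h]; case: p pp h => [|[|[|p]]]. Qed.

(** For 0 <= x <= 1/3 one has (1 - x)(1 + 2 x) >= 1, hence 1 - x >= exp(-2 x). *)
Lemma prod_ge_exp ps : all P3 ps -> expR (- (2 * rs ps)) <= \prod_(p <- ps) (1 - p%:R^-1).
Proof.
rewrite /rs; elim: ps => [|p ps IH] /=; first by rewrite !big_nil mulr0 oppr0 expR0.
case/andP=> pp hp; rewrite !big_cons mulrDr opprD expRD.
have h3 : 3 <= p%:R :> R by rewrite ler_nat P3_ge3.
have x1 : p%:R^-1 <= 3^-1 :> R by rewrite lef_pV2 ?posrE //; lra.
have x0 : 0 <= p%:R^-1 :> R by rewrite invr_ge0.
apply: ler_pM; rewrite ?expR_ge0 //; last exact: IH.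
set x := p%:R^-1 in x0 x1 *.
rewrite expRN -[leRHS]invrK lef_pV2 ?posrE ?expR_gt0 ?invr_gt0; [|lra|lra].
apply: le_trans (_ : 1 + 2 * x <= _); last exact: expR_ge1Dx.
by rewrite -[leLHS]mul1r ler_pdivrMr; nra.
Qed.

(** There are at most X/q + 1 multiples, and q < 4 X absorbs the 1 into 4 X/q. *)
Lemma count_AP_le q X : P3 q -> (q < 4 * X)%N ->
  \sum_(0 <= n < X) (q %| 4 * n + 3)%N%:R <= 5 * X%:R * q%:R^-1 :> R.
Proof.
move=> Pq qX; have q3 := P3_ge3 Pq; have /andP[pq _] := Pq.
have q0 : (0 < q)%N by apply: leq_trans q3.
have qR : 0 < q%:R :> R by rewrite ltr0n.
pose f (n : nat) : R := (q %| n)%N%:R.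
have pf : periodic q f by move=> n; rewrite /f dvdn_addl.
have cq : coprime 4 q.
  by rewrite -[4%N]/(2 ^ 2)%N coprimeXl // prime_coprime // dvdn_prime2 //; apply/eqP; lia.
have pf4 : periodic q (fun n => f (4 * n + 3)%N).
  by move=> n; rewrite /f mulnDr addnAC dvdn_addl // dvdn_mull.
apply: le_trans (periodic_sum_le X q0 pf4 _) _; first by move=> i; rewrite /f ler0n.
rewrite (affine_sum 3 q0 cq pf).
have -> : \sum_(0 <= l < q) f l = 1.
  rewrite big_ltn // /f dvdn0 big_nat big1 ?addr0 // => l /andP[l0 lq].
  by rewrite gtnNdvd.
rewrite mulr1 ler_pdivlMr // -natr1 mulrDl mul1r.
have h1 : (X %/ q)%:R * q%:R <= X%:R :> R by rewrite -natrM ler_nat leq_divM.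
have h2 : q%:R <= 4 * X%:R :> R by rewrite -natrM ler_nat ltnW.
lra.
Qed.

(* Every 4n + 3 has a prime factor q = 3 mod 4. If the reciprocals of these primes had a finite sum, the
   numbers 4n + 3 free of small q would have a density bounded below, and too few multiples of large q would be
   available to cover them. *)
Lemma rs_unbounded (B : R) : exists Y, B < rs (S3 Y).
Proof.
apply/boolp.not_existsP => hB.
have {}hB Y : rs (S3 Y) <= B by rewrite leNgt; apply/negP; exact: hB.
have mono a b : (a <= b)%N -> rs (S3 b) = rs (S3 a) + \sum_(a <= p < b | P3 p) p%:R^-1.
  by move=> ab; rewrite !rs_S3 (@big_cat_nat _ _ _ a).
have B0 : 0 <= B by have := hB 0%N; rewrite rs_S3 big_geq.
pose c0 : R := expR (- (2 * B)); have c00 : 0 < c0 := expR_gt0 _.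
(* For X = 3 M the sieve bound 3 M c0 will contradict the covering bound 5 X eta = (3/2) M c0. *)
pose eta := c0 / 10; have eta0 : 0 < eta by rewrite divr_gt0.
have [Y0 hY0] : exists Y0, forall Y, (Y0 <= Y)%N -> rs (S3 Y) <= rs (S3 Y0) + eta.
  apply: boolp.contrapT => /boolp.forallNP h.
  have step m : exists Y, m%:R * eta <= rs (S3 Y).
    elim: m => [|m [Y hY]]; first by exists 0%N; rewrite mul0r rs_S3 big_geq.
    have /boolp.existsNP[Y' hY'] := h Y.
    have /boolp.not_implyP[h1 /negP] := hY'; rewrite -ltNge => h2.
    by exists Y'; rewrite -natr1 mulrDl mul1r; lra.
  have [Y hY] := step (Num.bound (B / eta)).
  have := archi_boundP (_ : 0 <= B / eta); rewrite divr_ge0 ?(ltW eta0) // => /(_ isT).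
  rewrite ltr_pdivrMr // => h3; have := hB Y; lra.
set ps := S3 Y0; pose M := modulus 1 ps.
have aP : all P3 ps by apply/allP => p; rewrite mem_S3 => /andP[].
have M0 : (0 < M)%N by apply: modulus_gt0; exact: S3_prime.
pose f (p n : nat) : R := (~~ (p %| 4 * n + 3)%N)%:R.
have pf p : p \in ps -> periodic (p ^ 1) (f p).
  by move=> _ n; rewrite /f expn1 mulnDr addnAC dvdn_addl // dvdn_mull.
have [perF sumF] := crt_prod (S3_uniq Y0) (S3_prime Y0) pf.
set F := (fun n => \prod_(p <- ps) f p n) in perF sumF.
have F0 n : 0 <= F n by rewrite /F; apply: prodr_ge0 => p _; rewrite /f ler0n.
have avg : M%:R * c0 <= \sum_(0 <= n < M) F n.
  rewrite sumF /M /modulus natr_prod.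
  have -> : \prod_(p <- ps) \sum_(0 <= n < p ^ 1) f p n = \prod_(p <- ps) ((p ^ 1)%:R * (1 - p%:R^-1)).
    rewrite !big_seq; apply: eq_bigr => p hp; have Pp := allP aP _ hp; have p3 := P3_ge3 Pp.
    have /andP[pp _] := Pp; have p0 : (0 < p)%N by exact: prime_gt0.
    have cq : coprime 4 p.
      by rewrite -[4%N]/(2 ^ 2)%N coprimeXl // prime_coprime // dvdn_prime2 //; apply/eqP; lia.
    pose h (n : nat) : R := (~~ (p %| n)%N)%:R.
    have ph : periodic p h by move=> n; rewrite /h dvdn_addl.
    rewrite expn1 -[LHS]/(\sum_(0 <= n < p) h (4 * n + 3)%N) (affine_sum 3 p0 cq ph).
    rewrite big_ltn // /h dvdn0 add0r big_nat (eq_bigr (fun=> 1)); last first.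
      by move=> l /andP[l0 lp]; rewrite gtnNdvd.
    rewrite -big_nat sumr_const_nat mulrBr mulr1 divff ?pnatr_eq0 -?lt0n // natrB //.
  rewrite big_split /=; apply: ler_wpM2l; first by apply: prodr_ge0.
  apply: le_trans (prod_ge_exp aP); rewrite ler_expR lerN2 ler_wpM2l //; exact: hB.
have up X : \sum_(0 <= n < X) F n <= 5 * X%:R * eta.
  apply: (@le_trans _ _ (\sum_(0 <= n < X) \sum_(Y0 <= q < 4 * X + Y0 | P3 q && (q < 4 * X)%N) (q %| 4 * n + 3)%N%:R)).
    rewrite !big_nat; apply: ler_sum => n /andP[_ nX].
    have [q [pq qd q3]] := @prime_factor3 (4 * n + 3) ltac:(lia).
    have Pq : P3 q by rewrite /P3 pq q3.
    have q4 : (q < 4 * X)%N by have := dvdn_leq (isT : (0 < _.+3)%N) (_ : (q %| (4 * n).+3)%N); rewrite -addn3 => /(_ qd); lia.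
    have [qps|qps] := boolP (q \in ps).
      have -> : F n = 0 by rewrite /F (bigD1_seq q) ?S3_uniq //= /f qd mul0r.
      by apply: sumr_ge0.
    have Y0q : (Y0 <= q)%N by rewrite leqNgt; apply: contra qps => h; rewrite mem_S3 Pq.
    apply: (@le_trans _ _ 1).
      by rewrite /F; apply: prodr_ile1 => p _; rewrite /f; case: (~~ _); rewrite ?ler01 ?lexx.
    have qm : q \in index_iota Y0 (4 * X + Y0) by rewrite mem_index_iota Y0q ltn_addr.
    rewrite big_mkcond (bigD1_seq q qm (iota_uniq _ _)) /= Pq q4 qd lerDl.
    by apply: sumr_ge0 => i _; case: ifP.
  rewrite exchange_big /=.
  apply: (@le_trans _ _ (\sum_(Y0 <= q < 4 * X + Y0 | P3 q && (q < 4 * X)%N) 5 * X%:R * q%:R^-1)).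
    by apply: ler_sum => q /andP[Pq q4]; exact: count_AP_le.
  rewrite -mulr_sumr; apply: ler_wpM2l; first by rewrite mulr_ge0.
  apply: (@le_trans _ _ (\sum_(Y0 <= q < 4 * X + Y0 | P3 q) q%:R^-1)).
    rewrite big_mkcond [leRHS]big_mkcond; apply: ler_sum => q _.
    by case: (P3 q) => //=; case: ifP => // _; rewrite invr_ge0.
  have h1 : (Y0 <= 4 * X + Y0)%N by rewrite leq_addl.
  by have := hY0 _ h1; rewrite (mono _ _ h1) lerD2l.
have := up (2 * M + M)%N; have := periodic_sum_ge (2 * M + M) M0 perF F0.
have -> : ((2 * M + M) %/ M = 3)%N by rewrite (_ : 2 * M + M = 3 * M)%N ?mulnK //; lia.
have MR : 0 < M%:R :> R by rewrite ltr0n.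
rewrite natrD natrM /eta => h1 h2.
have h3 : 0 < M%:R * c0 by rewrite mulr_gt0.
move: h1 h2 avg; move: (\sum_(0 <= n < M) F n) => S; lra.
Qed.

End PrimesThreeModFour.

(** * Integers with few exact prime divisors *)

Section ExactDivisors.
Variable R : realType.

Definition exactly_divides (p n : nat) : bool := (p %| 12 * n + 1)%N && ~~ (p ^ 2 %| 12 * n + 1)%N.
Definition hw (p n : nat) : R := if exactly_divides p n then 1/2 else 1.

Lemma hw_gt0 p n : 0 < hw p n. Proof. by rewrite /hw; case: ifP => _; lra. Qed.

Lemma prod_hw ps n : \prod_(p <- ps) hw p n = (1/2) ^+ count (exactly_divides^~ n) ps.
Proof.
elim: ps => [|p ps IH]; first by rewrite big_nil.
by rewrite big_cons IH /hw /=; case: ifP => _; rewrite ?exprS ?mul1r.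
Qed.

Lemma hw_periodic p : periodic (p ^ 2) (hw p).
Proof.
move=> n; have h2 : (p ^ 2 %| 12 * p ^ 2)%N by exact: dvdn_mull.
have h1 : (p %| 12 * p ^ 2)%N by apply: dvdn_trans h2; rewrite expnS dvdn_mulr.
by rewrite /hw /exactly_divides mulnDr addnAC (dvdn_addl _ h1) (dvdn_addl _ h2).
Qed.

(** Among the p^2 residues, p - 1 are divisible by p exactly once, and each of them loses 1/2. *)
Lemma hw_sum p : prime p -> (3 < p)%N ->
  \sum_(0 <= n < p ^ 2) hw p n = (p ^ 2)%:R * (1 - (p%:R - 1) / (2 * p%:R ^+ 2)).
Proof.
move=> pp p3; have p0 := prime_gt0 pp.
have pR : p%:R != 0 :> R by rewrite pnatr_eq0 -lt0n.
pose h (x : nat) : R := if (p %| x)%N && ~~ (p ^ 2 %| x)%N then 1/2 else 1.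
have ph : periodic (p ^ 2) h.
  move=> n; rewrite /h !dvdn_addl //; by rewrite expnS dvdn_mulr.
have c12 : coprime 12 (p ^ 2).
  rewrite coprimeXr // -[12%N]/(2 ^ 2 * 3)%N coprimeMl; apply/andP; split; first rewrite coprimeXl //.
    by rewrite prime_coprime // dvdn_prime2 //; apply/eqP; lia.
  by rewrite prime_coprime // dvdn_prime2 //; apply/eqP; lia.
have p20 : (0 < p ^ 2)%N by rewrite expn_gt0 p0.
rewrite -[LHS]/(\sum_(0 <= n < p ^ 2) h (12 * n + 1)%N) (affine_sum 1 p20 c12 ph).
rewrite -[(p ^ 2)%N]/(p * p)%N sum_blocks.
have inner l : (l < p)%N -> \sum_(0 <= j < p) h (p * l + j)%N = p%:R - (if l == 0%N then 0 else 1/2).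
  move=> lp; rewrite big_ltn // addn0 big_nat (eq_bigr (fun=> 1)); last first.
    by move=> j /andP[j0 jp]; rewrite /h dvdn_addr ?dvdn_mulr // gtnNdvd.
  rewrite -big_nat sumr_const_nat natrB // /h dvdn_mulr // -[(p ^ 2)%N]/(p * p)%N dvdn_pmul2l //.
  have [->|l0] := posnP l; first by rewrite dvdn0 /=; lra.
  by rewrite gtnNdvd //=; lra.
rewrite big_nat (eq_bigr (fun l : nat => p%:R - (if l == 0%N then 0 else 1/2))); last by move=> l /andP[_]; exact: inner.
rewrite -big_nat big_ltn // eqxx (eq_big_nat _ _ (F2 := fun=> p%:R - 1/2)); last first.
  by move=> l /andP[l0 _]; rewrite gtn_eqF.
rewrite sumr_const_nat -[_ *+ (p - 1)]mulr_natl natrB // natrM.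
by field.
Qed.

(** With y = 1/p <= 1/2 each factor is at most 1 - y/4, and (1 - y/4)(1 + (S + y)/4) <= 1 + S/4. *)
Lemma prod_le_inv ps : all prime ps ->
  \prod_(p <- ps) (1 - (p%:R - 1) / (2 * p%:R ^+ 2)) <= (1 + rs R ps / 4)^-1 :> R.
Proof.
rewrite /rs; elim: ps => [|p ps IH] /=; first by rewrite !big_nil mul0r addr0 invr1.
case/andP=> pp hp; rewrite !big_cons; have {IH} := IH hp.
have s0 : 0 <= \sum_(j <- ps) j%:R^-1 :> R by apply: sumr_ge0 => j _; rewrite invr_ge0.
move: (\sum_(j <- ps) _) s0 (\prod_(j <- ps) _) => S S0 P hP.
have p2 : 2 <= p%:R :> R by rewrite ler_nat prime_gt1.
have pn : p%:R != 0 :> R by rewrite gt_eqF //; lra.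
have -> : (p%:R - 1) / (2 * p%:R ^+ 2) = p%:R^-1 / 2 * (1 - p%:R^-1) :> R by field.
have y0 : 0 < p%:R^-1 :> R by rewrite invr_gt0; lra.
have y1 : p%:R^-1 <= 1/2 :> R by rewrite -[leRHS]invrK lef_pV2 ?posrE; lra.
move: (p%:R^-1) y0 y1 => y y0 y1.
have d0 : 0 < 1 + S / 4 by lra.
have d1 : 0 < 1 + (y + S) / 4 by lra.
apply: (@le_trans _ _ ((1 - y / 2 * (1 - y)) * (1 + S / 4)^-1)).
  by apply: ler_wpM2l => //; nra.
rewrite -[leRHS]mul1r ler_pdivlMr // mulrAC ler_pdivrMr //.
have : y / 4 <= y / 2 * (1 - y) by nra.
move: (y / 2 * (1 - y)) => x hx; nra.
Qed.

(* The mean of 2^(-w(n)), w(n) the number of exact divisors, is a product tending to 0. *)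
Theorem exact_divisors_density (m : nat) (e : R) : 0 < e -> exists (ps : seq nat) (K : R),
  [/\ uniq ps, forall p, p \in ps -> [/\ prime p, (3 < p)%N & (p %% 4 = 3)%N] &
    forall X, \sum_(0 <= n < X) (count (exactly_divides^~ n) ps < m)%N%:R <= e * X%:R + K].
Proof.
move=> e0; have [Y hY] := @rs_unbounded R (4 * (2 ^+ m / e) + 1).
pose ps := [seq p <- S3 Y | (3 < p)%N].
have hps p : p \in ps -> [/\ prime p, (3 < p)%N & (p %% 4 = 3)%N].
  by rewrite mem_filter mem_S3 => /andP[h /andP[/andP[pp /eqP ->] _]].
have ups : uniq ps by rewrite filter_uniq // S3_uniq.
have pps : all prime ps by apply/allP => p /hps[].
have rps : 4 * (2 ^+ m / e) <= rs R ps.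
  suff : rs R (S3 Y) <= rs R ps + 1 by lra.
    have h0 : \sum_(p <- S3 Y | ~~ (3 < p)%N) p%:R^-1 <= 1 :> R.
    have [h3|h3] := boolP (3%N \in S3 Y).
      rewrite big_mkcond (bigD1_seq 3%N) ?S3_uniq //= big_seq_cond big1 ?addr0; first by rewrite invf_le1 // ler1n.
      move=> p /andP[]; rewrite mem_S3 => /andP[/P3_ge3 h _] h'; case: ifP => //; lia.
    rewrite big_seq_cond big1 // => p /andP[hp]; have := hp; rewrite mem_S3 => /andP[/P3_ge3 h _] h'.
    by have e3 : p = 3%N; [lia|rewrite e3 in hp; rewrite hp in h3].
  have es : rs R (S3 Y) = rs R ps + \sum_(p <- S3 Y | ~~ (3 < p)%N) p%:R^-1.
    rewrite {1}/rs (bigID (fun p => 3 < p)%N) /=; congr (_ + _).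
    by rewrite /rs /ps [RHS]big_filter.
  by rewrite es lerD2l.
pose Q := modulus 2 ps; have Q0 : (0 < Q)%N := modulus_gt0 2 pps.
pose A : R := \prod_(p <- ps) (1 - (p%:R - 1) / (2 * p%:R ^+ 2)).
have [perF sumF] := crt_prod ups pps (fun p _ => @hw_periodic p).
set F := (fun n => \prod_(p <- ps) hw p n) in perF sumF.
have F0 n : 0 <= F n by apply: prodr_ge0 => p _; exact: ltW (hw_gt0 _ _).
have SA : \sum_(0 <= n < Q) F n = Q%:R * A.
  rewrite sumF /Q /modulus natr_prod /A -big_split /= !big_seq; apply: eq_bigr => p hp.
  by have [p1 p2 _] := hps _ hp; exact: hw_sum.
have t0 : 0 < 2 ^+ m :> R by rewrite exprn_gt0.
have AE : 2 ^+ m * A <= e.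
  have := prod_le_inv pps; rewrite -/A => hA.
  have r0 : 0 < 1 + rs R ps / 4.
    have : 0 < 2 ^+ m / e by rewrite divr_gt0.
    lra.
  apply: le_trans (ler_wpM2l (ltW t0) hA) _; rewrite ler_pdivrMr //.
  have : 2 ^+ m / e <= rs R ps / 4 by lra.
  rewrite ler_pdivrMr // => h; rewrite mulrDr mulr1; lra.
exists ps, (e * Q%:R); split=> // X.
(* Markov's inequality: fewer than m exact divisors force 2^m F(n) >= 1. *)
apply: (@le_trans _ _ (\sum_(0 <= n < X) 2 ^+ m * F n)).
  apply: ler_sum => n _; rewrite /F prod_hw; case: ltnP => h; last by rewrite mulr_ge0 // ?exprn_ge0 //; lra.
  have : (1/2) ^+ m <= (1/2) ^+ count (exactly_divides^~ n) ps :> R by apply: ler_wiXn2l; [lra|lra|exact: ltnW].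
  move/(ler_wpM2l (ltW t0)); apply: le_trans.
  by rewrite -exprMn (_ : 2 * (1/2) = 1 :> R) ?expr1n //; lra.
rewrite -mulr_sumr; apply: le_trans (ler_wpM2l (ltW t0) (periodic_sum_le X Q0 perF F0)) _.
rewrite SA.
have -> : 2 ^+ m * ((X %/ Q).+1%:R * (Q%:R * A)) = (2 ^+ m * A) * ((X %/ Q).+1%:R * Q%:R) by ring.
have h1 : 0 <= (X %/ Q).+1%:R * Q%:R :> R by rewrite mulr_ge0.
apply: le_trans (ler_wpM2r h1 AE) _; rewrite -mulrDr; apply: ler_wpM2l; first exact: ltW.
by rewrite -natr1 mulrDl mul1r lerD2r -natrM ler_nat leq_divM.
Qed.

End ExactDivisors.

(** * 2-adic divisibility *)

Section TwoAdic.
Variable R : realType.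
Implicit Types c : nat -> R.

(* The weight i./2 is chosen so that U_p gains a factor 2: its matrix entries m_ji are divisible by 2^(i - j)
   for i >= j, and m_jj = 0. *)
Definition span2 e c := exists (m : nat -> R) (N : nat),
  [/\ forall i, m i != 0 -> odd i, forall i, m i / 2 ^+ (e + i./2) \is a Num.int &
      forall n, c n = \sum_(1 <= i < N) m i * fp R i n].

Lemma span2_eq e c d : c =1 d -> span2 e c -> span2 e d.
Proof. by move=> h [m [N [h1 h2 h3]]]; exists m, N; split=> // n; rewrite -h. Qed.

Lemma span2_0 e : span2 e (fun=> 0).
Proof.
exists (fun=> 0), 0%N; split=> [i|i|n]; first by rewrite eqxx.
  by rewrite mul0r rpred0.
by rewrite big_geq.
Qed.

Lemma sum_extend (m : nat -> R) (f : nat -> R) N N' : (N <= N')%N ->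
  \sum_(1 <= i < N) m i * f i = \sum_(1 <= i < N') (if (i < N)%N then m i else 0) * f i.
Proof.
move=> NN; case: N NN => [|N] NN; first by rewrite big_geq // big1 // => i _; rewrite mul0r.
rewrite [RHS](@big_cat_nat _ _ _ N.+1) //= [X in _ = _ + X]big_nat [X in _ = _ + X]big1 ?addr0.
  by rewrite !big_nat; apply: eq_bigr => i /andP[_ ->].
by move=> i /andP[h _]; rewrite ltnNge h /= mul0r.
Qed.

Lemma span2D e c d : span2 e c -> span2 e d -> span2 e (fun n => c n + d n).
Proof.
move=> [m [N [h1 h2 h3]]] [m' [N' [h1' h2' h3']]].
exists (fun i => (if (i < N)%N then m i else 0) + (if (i < N')%N then m' i else 0)), (maxn N N'); split.
- move=> i; case: ifP => _; case: ifP => _; rewrite ?addr0 ?add0r ?eqxx //; [|exact: h1|exact: h1'].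
  have [->|/h1 //] := eqVneq (m i) 0; rewrite add0r; exact: h1'.
- by move=> i; rewrite mulrDl rpredD //; case: ifP => _; rewrite ?mul0r ?rpred0.
move=> n; rewrite h3 h3' (sum_extend _ _ (leq_maxl N N')) (sum_extend _ _ (leq_maxr N N')) -big_split /=.
by apply: eq_bigr => i _; rewrite mulrDl.
Qed.

(** Here i = 3 j modulo 4, and 2 j is not a multiple of 4 for odd j. *)
Lemma mod4_neq p i j : (p %% 4 = 3)%N -> odd j -> (i %% 12 == (p * j) %% 12)%N -> i != j /\ odd i.
Proof.
move=> p3 jo /eqP h.
have h4 : (i %% 4 = (3 * j) %% 4)%N.
  have := congr1 (fun x => x %% 4)%N h; rewrite !modn_dvdm // => ->.
  by rewrite -modnMml p3.
split; last by have := congr1 odd h4; rewrite !odd_mod // oddM jo.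
by apply/eqP => e; move: h4; rewrite e; clear -jo; lia.
Qed.

(** Both indices are odd and distinct. For i < j the weight drops by (j - i)/2 >= 1. For i > j it
    rises by (i - j)/2, but the entry brings 2^(i-j), twice that exponent. Either way at least one
    factor 2 is gained. *)
Lemma span2_hecke p e (mu : R) j : prime p -> (3 < p)%N -> (p %% 4 = 3)%N -> odd j ->
  mu / 2 ^+ (e + j./2) \is a Num.int -> span2 e.+1 (fun n => mu * Up p (fp R j) n).
Proof.
move=> pp p3 p4 jo hmu; have [k k0 hk] := Pm_real R.
have [m [N [im sm dm hm]]] := hecke_integral k0 hk pp p3 jo.
have two n : 2 ^+ n != 0 :> R by rewrite expf_neq0 // pnatr_eq0.
exists (fun i => mu * m i), N; split.
- move=> i; rewrite mulf_eq0 negb_or => /andP[_ /sm h]; exact: (mod4_neq p4 jo h).2.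
- move=> i; have [->|mi] := eqVneq (m i) 0; first by rewrite mulr0 mul0r rpred0.
  have [ij io] := mod4_neq p4 jo (sm _ mi).
  have [lt|ge] := ltnP i j.
    have -> : mu * m i / 2 ^+ (e.+1 + i./2) = mu / 2 ^+ (e + j./2) * m i * 2 ^+ (j./2 - i./2 - 1).
      have -> : 2 ^+ (e + j./2) = 2 ^+ (e.+1 + i./2) * 2 ^+ (j./2 - i./2 - 1) :> R.
        rewrite -exprD; congr (_ ^+ _); clear -lt io jo; lia.
      move: (two (e.+1 + i./2)%N) (two (j./2 - i./2 - 1)%N).
      move: (2 ^+ (e.+1 + i./2)) (2 ^+ (j./2 - i./2 - 1)) (m i) => a b x a0 b0; by field; rewrite ?a0 ?b0.
    by apply: rpredM; [exact: rpredM hmu (im i)|apply: rpredX; exact: rpred_nat].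
  have -> : mu * m i / 2 ^+ (e.+1 + i./2) = mu / 2 ^+ (e + j./2) * (m i / 2 ^+ (i - j)) * 2 ^+ (i./2 - j./2 - 1).
    have -> : 2 ^+ (e.+1 + i./2) = 2 ^+ (e + j./2) * (2 * (2 * 2 ^+ (i./2 - j./2 - 1))) :> R.
      rewrite -!exprS -exprD; congr (_ ^+ _); clear -ge ij io jo; lia.
    have -> : 2 ^+ (i - j) = 2 ^+ (i./2 - j./2 - 1) * 2 * (2 * 2 ^+ (i./2 - j./2 - 1)) :> R.
      rewrite -exprSr -exprS -exprD; congr (_ ^+ _); clear -ge ij io jo; lia.
    have t2 : 2 != 0 :> R by rewrite pnatr_eq0.
    move: (two (e + j./2)%N) (two (i./2 - j./2 - 1)%N).
    move: (2 ^+ (e + j./2)) (2 ^+ (i./2 - j./2 - 1)) (m i) => a b x a0 b0; by field; rewrite ?a0 ?b0 ?t2.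
  by apply: rpredM; [exact: rpredM hmu (dm _ ge)|apply: rpredX; exact: rpred_nat].
by move=> n; rewrite hm mulr_sumr; apply: eq_bigr => i _; rewrite mulrA.
Qed.

Lemma span2_Up p e c : prime p -> (3 < p)%N -> (p %% 4 = 3)%N -> span2 e c -> span2 e.+1 (Up p c).
Proof.
move=> pp p3 p4 [m [N [h1 h2 h3]]].
apply: (@span2_eq _ (fun n => \sum_(1 <= j < N) m j * Up p (fp R j) n)).
  move=> n; rewrite /Up h3 /undil; case: ifP => _.
    by rewrite h3 mulr_sumr -big_split /=; apply: eq_bigr => j _; ring.
  by rewrite addr0 mulr_sumr; apply: eq_bigr => j _; ring.
elim: N {h3} => [|[|N] IH].
- by apply: (span2_eq _ (span2_0 _)) => n; rewrite big_geq.
- by apply: (span2_eq _ (span2_0 _)) => n; rewrite big_geq.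
apply: (@span2_eq _ (fun n => \sum_(1 <= j < N.+1) m j * Up p (fp R j) n + m N.+1 * Up p (fp R N.+1) n)).
  by move=> n; rewrite [RHS]big_nat_recr.
apply: span2D IH _; have [->|/h1 jo] := eqVneq (m N.+1) 0.
  by apply: (span2_eq _ (span2_0 _)) => n; rewrite mul0r.
exact: span2_hecke.
Qed.

Lemma span2_start : span2 0 (fp R 1).
Proof.
exists (fun i => (i == 1%N)%:R), 2%N; split=> [i|i|n].
- by case: (i =P 1%N) => [->|_] //; rewrite eqxx.
- by case: (i =P 1%N) => [->|_]; rewrite ?mul0r ?rpred0 //= expr0 divr1 rpred1.
by rewrite big_nat1 eqxx mul1r.
Qed.

Lemma span2_int e c n : span2 e c -> c n / 2 ^+ e \is a Num.int.
Proof.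
move=> [m [N [_ h2 ->]]]; rewrite mulr_suml; apply: rpred_sum => i _.
have -> : m i * fp R i n / 2 ^+ e = m i / 2 ^+ (e + i./2) * 2 ^+ i./2 * fp R i n.
  have two k : 2 ^+ k != 0 :> R by rewrite expf_neq0 // pnatr_eq0.
  rewrite exprD; move: (two e) (two i./2); move: (2 ^+ e) (2 ^+ i./2) (m i) (fp R i n) => a b x y a0 b0.
  by field; rewrite ?a0 ?b0.
by apply: rpredM; [apply: rpredM; [exact: h2|apply: rpredX; exact: rpred_nat]|exact: isint_fp].
Qed.

(** At an index prime to every p the part of U_p that divides the index by p vanishes, so the
    iterate reads off a single coefficient of F. *)
Lemma Up_iter ps N : all prime ps -> uniq ps -> (forall p, p \in ps -> ~~ (p %| N)%N) ->
  foldr (@Up R) (fp R 1) ps N = (\prod_(p <- ps) p)%N%:R * fp R 1 ((\prod_(p <- ps) p) * N)%N.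
Proof.
elim: ps N => [|p ps IH] N /=; first by rewrite big_nil mul1r mul1n.
case/andP=> pp hp /andP[pps ups] hN; rewrite big_cons {1}/Up /undil (negbTE (hN p (mem_head _ _))) addr0 IH //.
  by rewrite natrM mulrA [(p * \prod_(j <- ps) j)%N]mulnC -mulnA.
move=> q qps; have qq := allP hp _ qps; rewrite Euclid_dvdM // negb_or (hN q) ?inE ?qps ?orbT // andbT.
by rewrite dvdn_prime2 //; apply: contra pps => /eqP <-.
Qed.

Lemma exact_factor ps N : all prime ps -> uniq ps ->
  (forall p, p \in ps -> (p %| N)%N && ~~ (p ^ 2 %| N)%N) ->
  exists N', N = ((\prod_(p <- ps) p) * N')%N /\ forall p, p \in ps -> ~~ (p %| N')%N.
Proof.
elim: ps N => [|p ps IH] N /=; first by exists N; rewrite big_nil mul1n.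
case/andP=> pp hp /andP[pps ups] hN.
have /andP[/dvdnP[N1 eN] p2] := hN p (mem_head _ _).
have [q qps|N' [e hN']] := IH N1 hp ups.
  have qq := allP hp _ qps; have /andP[qd q2] := hN q ltac:(by rewrite inE qps orbT).
  have qp : ~~ (q %| p)%N by rewrite dvdn_prime2 //; apply: contra pps => /eqP <-.
  move: qd q2; rewrite eN Euclid_dvdM // (negbTE qp) orbF => -> /=.
  by apply: contra => h; exact: dvdn_mulr.
exists N'; split; first by rewrite big_cons eN e mulnC mulnA.
move=> q; rewrite inE => /orP[/eqP ->|]; last exact: hN'.
apply: contra p2 => /dvdnP[M eM]; rewrite eN e eM expnS expn1 mulnA -mulnA; exact: dvdn_mull.
Qed.

(** Write 12 n + 1 = P N' with P the product of the primes. Iterating the operators gives P alpha_n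
    at the index N', and the odd number P is cancelled. *)
Theorem alpha_div (ps : seq nat) n : uniq ps ->
  (forall p, p \in ps -> [/\ prime p, (3 < p)%N & (p %% 4 = 3)%N]) ->
  (forall p, p \in ps -> exactly_divides p n) -> exists q : int, alpha n = (2 ^ size ps)%:Z * q.
Proof.
move=> ups hps hn.
have pps : all prime ps by apply/allP => p /hps[].
have [N' [e hN']] := exact_factor pps ups hn.
have sp : span2 (size ps) (foldr (@Up R) (fp R 1) ps).
  elim: ps hps {ups hn pps N' e hN'} => [|p ps IH] hps /=; first exact: span2_start.
  have [p1 p2 p3] := hps p (mem_head _ _); apply: span2_Up => //; apply: IH => q qps.
  by apply: hps; rewrite inE qps orbT.
have := span2_int N' sp; rewrite Up_iter // -e fp1 fRE /shift /undil addn1 /= subn1 /= dvdn_mulr // mulKn //.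
set P := (\prod_(p <- ps) p)%N => /intrP[z hz].
have Po : odd P.
  rewrite /P; elim: ps hps {ups hn pps N' e hN' sp P hz} => [|p ps IH] hps; first by rewrite big_nil.
  rewrite big_cons oddM IH ?andbT; last by move=> q qps; apply: hps; rewrite inE qps orbT.
  have [p1 p2 _] := hps p (mem_head _ _).
  by case: (even_prime p1) => // e; rewrite e in p2.
have two : 2 ^+ size ps != 0 :> R by rewrite expf_neq0 // pnatr_eq0.
have eqz : P%:Z * alpha n = (2 ^ size ps)%:Z * z.
  apply: (@intr_inj R); rewrite !rmorphM /= -hz -!pmulrn natrX.
  by rewrite [RHS]mulrC divfK.
have cop : coprimez (2 ^ size ps)%:Z P%:Z by rewrite coprimezE /= coprimeXl // coprime2n.
have : ((2 ^ size ps)%:Z %| alpha n)%Z.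
  by rewrite -(Gauss_dvdzr _ cop) eqz dvdz_mulr.
by case/dvdzP => q ->; exists q; rewrite mulrC.
Qed.

End TwoAdic.

Theorem theorem1p4 (R : realType) (k : nat) (hk : (0 < k)%N) :
  lacunary_mod R G_e (2 ^ k)%N.
Proof.
rewrite /lacunary_mod; apply/cvgrPdist_lt => e e0.
have e4 : 0 < e / 4 by rewrite divr_gt0.
have [ps [K [ups hps dens]]] := exact_divisors_density k.+1 e4.
(* One prime more than k, because 2 G_e = alpha loses a factor 2. *)
have good n : (k.+1 <= count (exactly_divides^~ n) ps)%N -> (G_e n == 0 %[mod (2 ^ k)%N%:Z])%Z.
  move=> hc; pose qs := [seq p <- ps | exactly_divides p n].
  have sz : size qs = count (exactly_divides^~ n) ps by rewrite size_filter.
  have hq p : p \in qs -> [/\ prime p, (3 < p)%N & (p %% 4 = 3)%N].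
    by rewrite mem_filter => /andP[_]; exact: hps.
  have hx p : p \in qs -> exactly_divides p n by rewrite mem_filter => /andP[].
  have [q hq'] := @alpha_div R qs n (filter_uniq _ ups) hq hx.
  (* One such prime is also what makes beta_n vanish. *)
  have [p pqs] : exists p, p \in qs.
    by case: (qs) sz => [|p s] /=; [move=> e1; rewrite -e1 in hc|exists p; rewrite mem_head].
  have [p1 p2 p3] := hq _ pqs; have /andP[p4 p5] := hx _ pqs.
  have := G_e_alpha p1 p3 p4 p5; rewrite hq' sz => h2.
  have e2 : (2 ^ count (exactly_divides^~ n) ps = 2 * (2 ^ k * 2 ^ (count (exactly_divides^~ n) ps - k.+1)))%N.
    by rewrite -expnD -expnS; congr (_ ^ _)%N; lia.
  have h3 : G_e n = (2 ^ k)%:Z * ((2 ^ (count (exactly_divides^~ n) ps - k.+1))%:Z * q).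
    by move: h2; rewrite e2 !PoszM -!mulrA => /mulfI; apply.
  by rewrite mod0z -/(dvdz _ _); apply/eqP/dvdz_mod0P; rewrite h3 dvdz_mulr.
pose cnt X := #|[pred n : 'I_X.+1 | (G_e n == 0 %[mod (2 ^ k)%N%:Z])%Z]|.
have up X : (cnt X <= X.+1)%N by rewrite -[X in (_ <= X)%N]card_ord; exact: max_card.
have lo X : X.+1%:R <= (cnt X)%:R + (e / 4 * X.+1%:R + K) :> R.
  apply: le_trans (lerD (lexx _) (dens X.+1)).
  rewrite -natr_sum -natrD ler_nat /cnt -sum1_card big_mkcond /= big_mkord -big_split /=.
  have e1 : X.+1 = (\sum_(i < X.+1) 1)%N by rewrite sum1_card card_ord.
  rewrite [leqLHS]e1.
  apply: leq_sum => n _; have [lt|ge] := ltnP (count (exactly_divides^~ n) ps) k.+1; first by rewrite leq_addl.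
  by rewrite inE (good n ge).
(* Beyond N0 the constants 1 + |K| cost at most e X/4, and together with e (X + 1)/4 the total stays
   below e X. *)
have [N0 hN0] : exists N0 : nat, 4 * (1 + `|K|) / e <= N0%:R.
  exists (Num.bound (4 * (1 + `|K|) / e)); apply: ltW; apply: archi_boundP.
  by rewrite divr_ge0 ?(ltW e0) // mulr_ge0 // addr_ge0.
exists N0.+1 => // X /= hX.
have X0 : 0 < X%:R :> R by rewrite ltr0n; exact: leq_trans hX.
have hNX : 4 * (1 + `|K|) <= e * X%:R.
  move: hN0; rewrite ler_pdivrMr // => h; apply: le_trans h _; rewrite mulrC ler_wpM2l ?(ltW e0) // ler_nat.
  exact: ltnW.
have := up X; rewrite -(ler_nat R) => hu; have := lo X => hl.
have X1 : X.+1%:R = X%:R + 1 :> R by rewrite natr1.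
have X11 : 1 <= X%:R :> R by rewrite ler1n; exact: leq_trans hX.
have hK := ler_norm K; have hK0 := normr_ge0 K.
rewrite -/(cnt X); rewrite X1 in hu hl.
have -> : 1 - (cnt X)%:R / X%:R = (X%:R - (cnt X)%:R) / X%:R :> R by rewrite mulrBl divff ?gt_eqF.
rewrite normrM (ger0_norm (_ : 0 <= X%:R^-1)) ?invr_ge0 ?ltr_pdivrMr // ?ltr_norml.
have eX : e <= e * X%:R by rewrite ler_peMr // ltW.
by apply/andP; split; lra.
Qed.
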